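(* Let $d\ge 2$ be an integer. For each map $h\in\mathcal{T}_d^*$, the set $\operatorname{Par}(h)$ is finite and $h$ is conjugate to a map $\widetilde{h}\in\mathcal{M}_d^{1+\mathrm{BV}}$ via a $C^{1+\mathrm{BV}}$ diffeomorphism of $\mathbb{S}^1$. Moreover, if $h$ is $C^{r+\epsilon}$ for some $r=2,3,\ldots,\infty$ and $0<\epsilon\le 1$, or $h$ is $C^\omega$, then the conjugacy map can be taken to be $C^{r+\epsilon}$, respectively $C^\omega$.
   Context: Identify $\mathbb{S}^1$ with $\mathbb{R}/\mathbb{Z}$ via $x\mapsto e^{2\pi i x}$ and write $Dh$ for the derivative of $h$ in the coordinate $x$. A map is $C^{1+\mathrm{BV}}$ if it is $C^1$ and its derivative is (continuous and) of bounded variation. $C^{r+\epsilon}$ denotes maps whose $r$-th derivative is $\epsilon$-Hölder (for $r=\infty$ this is just $C^\infty$); $C^\omega$ means real analytic. $\mathcal{F}_d^{1+\mathrm{BV}}$ is the set of locally diffeomorphic covering maps $h:\mathbb{S}^1\to\mathbb{S}^1$ of degree $d>0$ (so orientation preserving) with $h\in C^{1+\mathrm{BV}}$. $\operatorname{Par}(h)$ is the set of parabolic periodic points of $h$, i.e. periodic points $p$, of period $s$, with $Dh^s(p)=1$. $\mathcal{T}_d^*\subset\mathcal{F}_d^{1+\mathrm{BV}}$ is the set of maps $h$ such that for every periodic point $p$ of $h$, say of period $s$, there is a neighborhood $U(p)$ of $p$ such that $Dh^s(x)>1$ for all $x\in U(p)\setminus\{p\}$. $\mathcal{M}_d^{1+\mathrm{BV}}\subset\mathcal{F}_d^{1+\mathrm{BV}}$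 is the set of metrically expanding maps, i.e. those $h$ with $Dh(x)>1$ for all $x\in\mathbb{S}^1\setminus\operatorname{Par}(h)$. *)

(* Defs.v *)
From HB Require Import structures.
From mathcomp Require Import all_boot all_order all_algebra.
From mathcomp Require Import all_classical all_reals all_analysis.

Set Implicit Arguments.
Unset Strict Implicit.
Unset Printing Implicit Defensive.

Import Order.TTheory GRing.Theory Num.Theory.
Import numFieldNormedType.Exports.

Local Open Scope classical_set_scope.
Local Open Scope ring_scope.
Local Open Scope quotient_scope.

Section circle.
Variable R : realType.

Definition modZ : rel R := fun x y => (x - y) \is a Num.int.

Lemma modZ_refl : reflexive modZ.
Proof. by move=> x; rewrite /modZ subrr rpred0. Qed.

Lemma modZ_sym : symmetric modZ.
Proof. by move=> x y; rewrite /modZ -opprB rpredN. Qed.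

Lemma modZ_trans : transitive modZ.
Proof.
move=> y x z xy yz; rewrite /modZ.
by rewrite -(subrK y x) -addrA rpredD.
Qed.

Definition modZ_equiv : equiv_rel R :=
  EquivRel modZ modZ_refl modZ_sym modZ_trans.

(* R/Z with its quotient topology. *)
Definition circle := {eq_quot modZ_equiv}.

HB.instance Definition _ :=
  Topological.copy circle (quotient_topology circle).
HB.instance Definition _ := Quotient.on circle.

Definition toS (x : R) : circle := \pi_circle x.

End circle.

Section covering.
Variable T : topologicalType.
Implicit Types (h : T -> T) (V : set T).

(* h^-1(V) is a disjoint union of open sheets U i, each mapped
   homeomorphically onto V, with inverse g. *)
Definition evenly_covered h V :=
  exists (I : Type) (U : I -> set T),
  [/\ forall i, open (U i),
      trivIset [set: I] U,
      h @^-1` V = \bigcup_i U i &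
      forall i, exists g : T -> T,
      [/\ forall q, V q -> U i (g q),
          {within V, continuous g},
          forall p, U i p -> g (h p) = p &
          forall q, V q -> h (g q) = q]].

Definition covering_map h :=
  [/\ continuous h,
      forall q, exists p, h p = q &
      forall q, exists V, [/\ open V, V q & evenly_covered h V]].

End covering.

Section circle_maps.
Variable R : realType.
Local Notation S1 := (circle R).
Implicit Types (f h phi : S1 -> S1) (p : S1) (x t eps : R) (F H : R -> R).

(* F expresses f in the coordinate of R/Z near x. *)
Definition local_lift f x F := \forall t \near x, toS (F t) = f (toS t).

(* The value a is unique: two local lifts differentiable at x differ near x by
   an integer constant, and so do two coordinates x of p. *)
Definition is_cderive f p (a : R) :=
  exists x F, [/\ toS x = p, local_lift f x F & is_derive x 1 F a].

Definition cderivable f p := exists a, is_cderive f p a.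

(* Df, the derivative in the coordinate x; 0 where f is not differentiable. *)
Definition cderive f p : R := xget 0 [set a | is_cderive f p a].

(* Df as a 1-periodic function on the line. *)
Definition Dper f : R -> R := fun x => cderive f (toS x).

(* Meant for U open. *)
Definition C1_on (U : set S1) f :=
  forall p, U p -> cderivable f p /\ {for p, continuous (cderive f)}.

Definition C1BV f := C1_on setT f /\ bounded_variation 0 1 (Dper f).

(* For a 1-periodic G this is the Hoelder condition for the distance of R/Z,
   which is the least |x - y| over all representatives. *)
Definition hoelder eps (G : R -> R) :=
  exists C : R, forall x y, `|G x - G y| <= C * `|x - y| `^ eps.

(* C^{r+eps} for r >= 1; the r-th derivative of f is the (r-1)-st of Df. *)
Definition Cr_hoelder (r : nat) eps f :=
  [/\ C1_on setT f,
      forall k x, (k < r.-1)%N -> derivable (derive1n k (Dper f)) x 1 &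
      hoelder eps (derive1n r.-1 (Dper f))].

Definition Cinfty f :=
  C1_on setT f /\ forall k x, derivable (derive1n k (Dper f)) x 1.

Definition analytic_at F x :=
  exists (a : nat -> R) (rho : R), 0 < rho /\
    forall t, `|t - x| < rho ->
      series (fun n => a n * (t - x) ^+ n) @ \oo --> F t.

Definition Comega f := forall x, exists F, local_lift f x F /\ analytic_at F x.

Definition C1BV_diffeo phi :=
  exists psi, [/\ cancel phi psi, cancel psi phi, C1BV phi & C1BV psi].

Definition local_C1_diffeo h :=
  forall p, exists (U : set S1) (g : S1 -> S1),
  [/\ open U, U p & open (h @` U)] /\
  [/\ C1_on U h, C1_on (h @` U) g & forall q, U q -> g (h q) = q].

Definition has_degree h (d : nat) :=
  exists H, [/\ continuous H,
                forall x, toS (H x) = h (toS x) &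
                forall x, H (x + 1) = H x + d%:R].

Definition FdBV (d : nat) h :=
  [/\ (0 < d)%N, covering_map h, has_degree h d, local_C1_diffeo h & C1BV h].

Definition has_period h p (s : nat) :=
  [/\ (0 < s)%N, iter s h p = p &
      forall k, (0 < k < s)%N -> iter k h p <> p].

Definition Par h : set S1 :=
  [set p | exists2 s, has_period h p s & cderive (iter s h) p = 1].

Definition Tstar (d : nat) h :=
  FdBV d h /\
  forall p s, has_period h p s ->
    \forall q \near p, q <> p -> 1 < cderive (iter s h) q.

Definition MdBV (d : nat) h :=
  FdBV d h /\ forall p, ~ Par h p -> 1 < cderive h p.

Definition conjugates phi h htilde := phi \o h = htilde \o phi.

(* The class K records the additional regularity of the conjugacy. *)
Definition conj_to_expanding (K : set (S1 -> S1)) (d : nat) h :=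
  exists htilde phi,
  [/\ MdBV d htilde, C1BV_diffeo phi, K phi & conjugates phi h htilde].

End circle_maps.

(* Main.v *)
Require Import Defs.
From HB Require Import structures.
From mathcomp Require Import all_boot all_order all_algebra.
From mathcomp Require Import all_classical all_reals all_analysis.
From mathcomp Require Import ring lra zify.

Set Implicit Arguments.
Unset Strict Implicit.
Unset Printing Implicit Defensive.

Import Order.TTheory GRing.Theory Num.Theory.
Import numFieldNormedType.Exports.
Local Open Scope classical_set_scope.
Local Open Scope ring_scope.

(* On a lift [H] of [h], conjugating [h] to a metrically expanding map amounts to
   finding a positive periodic density [rho] with [rho x < rho (H x) * DH x] off
   the parabolic points: the conjugacy is the normalized primitive of [rho].

   Let [D n] be the derivative of the [n]-th iterate of [H].  Since [ln DH] has
   bounded variation and all periodic points repel, a distortion argument excludes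
   wandering intervals, so that [H] becomes the multiplication by [d] in a suitable
   coordinate.  If all the [D m] stay bounded along a backward orbit, the set of its
   limit points has gaps, whose ends are periodic; the orbit converges to a repelling
   cycle and must be a parabolic cycle itself.  By compactness there are finitely
   many parabolic points, say fixed by [h^s], and the iterates expand uniformly along
   orbits that are away from them at both ends.

   The average [rho0 = \sum_(i < s) D i] satisfies
   [rho0 (H x) * DH x = rho0 x + (D s x - 1)], hence is expanded near the parabolic
   points.  A minimum of pull-backs of [rho0] gives a continuous expanded density
   [rho] equal to [rho0] near the parabolic points.  Finally [rho - rho0] is replaced
   by [g * P], where [P] is a close analytic approximation of [(rho - rho0) / g] and
   the weight [g] is flat at the parabolic points ([exp (- 1 / t)] of a trigonometric
   polynomial), or, in the analytic case, vanishes there to at least the order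
   of [D s - 1].  Then [rho0 + g * P] is as regular as [DH]. *)

(** * Preliminaries on the line *)

(** The obstacle is that the gain [D s x - 1] of [rho0] tends to zero at the parabolic points. A
    uniform approximation of an expanded density may lose the strict inequality there, however close
    it is. Hence [rho0] is kept exactly and only a correction is approximated, with a weight
    dominated by [D s - 1].

    Away from these points no expansion is given either. The only tool is the variation of [ln DH],
    and it bounds distortion, by [expR V], only for arcs whose successive images are disjoint modulo
    1. Disjointness is obtained in three ways: from wandering plateaus, from first returns to arcs
    whose end points never come back inside, and from the fundamental domains on one side of a
    periodic point.

    Failure of expansion is expressed through backward orbits because long backward segments with
    bounded derivatives have limits of the same kind on the compact circle, and such limits can be
    classified. *)

Section real_line.
Variable R : realType.
Implicit Types (f g : R -> R) (x y : R).

Lemma continuousE f : continuous f <->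
  forall x e, 0 < e -> exists2 dl, 0 < dl & forall y, `|y - x| < dl -> `|f y - f x| < e.
Proof.
split=> [fc x e e0|fc x].
  have /cvgrPdist_lt /(_ _ e0) [dl /= dl0 fdl] := fc x.
  exists dl => // y yx; rewrite distrC; apply: fdl => /=.
  by rewrite distrC.
apply/cvgrPdist_lt => e e0; have [dl dl0 fdl] := fc x e e0.
exists dl => //= y /=; rewrite distrC => /fdl; by rewrite distrC.
Qed.

Lemma is_derive_cts f x a : is_derive x 1 f a -> {for x, continuous f}.
Proof. by move=> [fd _]; apply: differentiable_continuous; apply/derivable1_diffP. Qed.

Lemma is_derive_cont f (df : R -> R) : (forall x, is_derive x 1 f (df x)) -> continuous f.
Proof. by move=> fd x; apply: is_derive_cts (fd x). Qed.

Lemma is_derive_uniq f x (a b : R) : is_derive x (1 : R) f a -> is_derive x (1 : R) f b -> a = b.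
Proof. by move=> [_ <-] [_ <-]. Qed.

Lemma is_derive_shiftr f x c a : is_derive (x + c) (1 : R) f a ->
  is_derive x (1 : R) (fun y => f (y + c)) a.
Proof.
move=> fa; rewrite -[a]mulr1; apply: (@is_derive1_comp R f (fun y => y + c)).
by apply: is_derive_eq; rewrite addr0.
Qed.

Lemma MVTle f (df : R -> R) x y : (forall z, is_derive z (1:R) f (df z)) -> x <= y ->
  exists2 c, x <= c <= y & f y - f x = df c * (y - x).
Proof.
move=> fd; rewrite le_eqVlt => /predU1P[->|xy].
  by exists y; rewrite ?lexx// !subrr mulr0.
have [|c cxy ->] := @MVT R f df x y xy (fun z _ => fd z).
  by apply: continuous_subspaceT; apply: is_derive_cont fd.
by exists c => //; move: cxy; rewrite in_itv /= => /andP[/ltW -> /ltW ->].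
Qed.

Lemma MVTlt f (df : R -> R) x y : (forall z, is_derive z (1:R) f (df z)) -> x < y ->
  exists2 c, x < c < y & f y - f x = df c * (y - x).
Proof.
move=> fd xy; have [|c cxy ->] := @MVT R f df x y xy (fun z _ => fd z).
  by apply: continuous_subspaceT; apply: is_derive_cont fd.
by exists c => //; move: cxy; rewrite in_itv.
Qed.

Lemma int_le0_ge1 (k : int) : (k%:~R : R) <= 0 \/ (1 : R) <= k%:~R.
Proof. by rewrite lerz0 ler1z; have [|] := leP k 0; [left|right]. Qed.

Lemma periodic_int f x (k : int) : (forall x, f (x + 1) = f x) -> f (x + k%:~R) = f x.
Proof.
move=> fS; have fn y n : f (y + n%:R) = f y.
  elim: n => [|n IH]; first by rewrite addr0.
  by rewrite -natr1 addrA fS.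
case: k => n; first exact: fn.
by rewrite NegzE -[LHS](fn _ n.+1) mulrNz -pmulrn subrK.
Qed.

Lemma periodic_bounded f : continuous f -> (forall x, f (x + 1) = f x) ->
  exists2 B, 0 < B & forall x, `|f x| <= B.
Proof.
move=> fc fS.
have nc : {within `[0, 1], continuous (fun x => `|f x|)}.
  by apply: continuous_subspaceT => x; apply: continuous_comp (fc x) (@norm_continuous _ _ _).
have [c _ cP] := @EVT_max R (fun x => `|f x|) 0 1 ler01 nc.
exists (`|f c| + 1); first by rewrite ltr_wpDl.
move=> x; rewrite -(periodic_int x (- Num.floor x) fS) mulrNz.
apply: le_trans (cP _ _) _; last by rewrite lerDl.
have := floor_itv x; rewrite in_itv /=; lra.
Qed.

Lemma periodic_pos_lb f : continuous f -> (forall x, f (x + 1) = f x) ->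
  (forall x, 0 < f x) -> exists2 B, 0 < B & forall x, B <= f x.
Proof.
move=> fc fS f0.
have nc : {within `[0, 1], continuous f} by apply: continuous_subspaceT.
have [c _ cP] := @EVT_min R f 0 1 ler01 nc.
exists (f c) => // x; rewrite -(periodic_int x (- Num.floor x) fS) mulrNz.
apply: cP; have := floor_itv x; rewrite in_itv /=; lra.
Qed.

End real_line.

(** * Arcs that are disjoint modulo 1 *)

Section disjoint_arcs.
Variables (R : realType) (v : R -> R) (V : R).
Hypothesis v_mono : {homo v : x y / x <= y}.
Hypothesis vS : forall x, v (x + 1) = v x + V.

Lemma quasi_periodic_int x (k : int) : v (x + k%:~R) = v x + k%:~R * V.
Proof.
have /(_ _)/eqP := @periodic_int R (fun x => v x - x * V) x k.
rewrite -subr_eq0 => vk; apply/eqP; rewrite -subr_eq0.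
suff /vk /eqP <- : forall y, v (y + 1) - (y + 1) * V = v y - y * V by apply/eqP; ring.
by move=> y; rewrite vS; ring.
Qed.

(** The intervals come in no particular order. The first one splits the others into those on its
    left and those on its right, hence the induction on a bound [n] of the size. *)
Let line_sum n : forall (s : seq nat) (x y : nat -> R) a b, (size s <= n)%N -> uniq s -> a <= b ->
  (forall i, i \in s -> [/\ a <= x i, x i <= y i & y i <= b]) ->
  (forall i j, i \in s -> j \in s -> i != j -> y i <= x j \/ y j <= x i) ->
  \sum_(i <- s) (v (y i) - v (x i)) <= v b - v a.
Proof.
elim: n => [|n IH] [|i s] x y a b //= sn.
- by move=> _ ab _ _; rewrite big_nil subr_ge0 v_mono.
- by move=> _ ab _ _; rewrite big_nil subr_ge0 v_mono.
move=> /andP[nis us] ab bnd dis.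
have [axi xyi yib] := bnd i (mem_head _ _).
rewrite big_cons (bigID (fun j => y j <= x i)) /= -[X in _ + (X + _)]big_filter
  -[X in _ + (_ + X)]big_filter.
have h1 : \sum_(j <- [seq j <- s | y j <= x i]) (v (y j) - v (x j)) <= v (x i) - v a.
  apply: IH; rewrite ?filter_uniq//.
  - by rewrite size_filter; apply: leq_trans (count_size _ _) sn.
  - move=> j; rewrite mem_filter => /andP[yjxi js].
    by have [] := bnd j; rewrite ?inE ?js ?orbT.
  - move=> j k; rewrite !mem_filter => /andP[_ js] /andP[_ ks].
    by apply: dis; rewrite inE ?js ?ks orbT.
have h2 : \sum_(j <- [seq j <- s | ~~ (y j <= x i)]) (v (y j) - v (x j)) <= v b - v (y i).
  apply: IH; rewrite ?filter_uniq//.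
  - by rewrite size_filter; apply: leq_trans (count_size _ _) sn.
  - move=> j; rewrite mem_filter => /andP[yjxi js].
    have [] := bnd j; rewrite ?inE ?js ?orbT// => _ xyj yjb; split=> //.
    have ij : i != j by apply: contraNneq nis => ->.
    have := dis i j; rewrite mem_head inE js orbT => /(_ isT isT ij) [//|].
    by rewrite (negbTE yjxi).
  - move=> j k; rewrite !mem_filter => /andP[_ js] /andP[_ ks].
    by apply: dis; rewrite inE ?js ?ks orbT.
lra.
Qed.

(** Disjointness is up to end points; the case [i = j], [k != 0] keeps an arc from overlapping its
    own translates. *)
Definition disjoint_arcs n (x y : nat -> R) := forall i j (k : int), (i < n)%N -> (j < n)%N ->
  (i != j) || (k != 0) -> y i <= x j + k%:~R \/ y j + k%:~R <= x i.

(* Translating all left ends into a unit interval starting at one of them puts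
   the arcs in line. *)
Lemma disjoint_arcs_sum n (x y : nat -> R) : (forall i, (i < n)%N -> x i <= y i) ->
  disjoint_arcs n x y -> \sum_(0 <= i < n) (v (y i) - v (x i)) <= V.
Proof.
move=> xy dis; have V0 : 0 <= V.
  have := vS 0; have := @v_mono 0 (0 + 1); rewrite add0r => /(_ ler01); lra.
case: n xy dis => [|n] xy dis; first by rewrite big_geq.
pose k i : int := - Num.floor (x i - x 0%N).
have kb i : x 0%N <= x i + (k i)%:~R < x 0%N + 1.
  have := floor_itv (x i - x 0%N); rewrite /k mulrNz; lra.
have -> : \sum_(0 <= i < n.+1) (v (y i) - v (x i)) =
    \sum_(i <- index_iota 0 n.+1) (v (y i + (k i)%:~R) - v (x i + (k i)%:~R)).
  by apply: eq_bigr => i _; rewrite !quasi_periodic_int; ring.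
have -> : V = v (x 0%N + 1) - v (x 0%N) by rewrite vS; ring.
apply: (@line_sum n.+1); rewrite ?iota_uniq ?size_iota ?subn0 ?lerDl//.
- move=> i; rewrite mem_index_iota /= => ni; have /andP[k1 k2] := kb i.
  have xyi := xy i ni; split => //; first by rewrite lerD2r.
  (* The upper bound [x 0 + 1] comes from disjointness with the translate by one of arc 0, which for
     [i = 0] is a translate of the arc itself. *)
  have [->|i0] := eqVneq i 0%N.
    have k00 : k 0%N = 0 by rewrite /k subrr floor0.
    have := dis 0%N 0%N 1; rewrite eqxx oner_eq0 k00 addr0 => /(_ isT isT isT).
    have := xy 0%N isT; case; lra.
  have := dis i 0%N (1 - k i); rewrite i0 => /(_ ni isT isT).
  rewrite intrB => -[|]; first lra.
  have := xy 0%N isT; lra.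
move=> i j; rewrite !mem_index_iota /= => ni nj ij.
have := dis i j (k j - k i); rewrite ij => /(_ ni nj isT).
by rewrite intrB => -[|] h; [left|right]; lra.
Qed.

End disjoint_arcs.

(** * Lifts and distortion *)

(* [v] plays the role of the total variation of [ln DH] over [[0, x]], and [V]
   that of its variation over the circle. *)
Record BV_lift (R : realType) (d : nat) (H DH v : R -> R) (V : R) : Prop := BVLift {
  lift_deg : (2 <= d)%N;
  liftS : forall x, H (x + 1) = H x + d%:R;
  lift_derive : forall x, is_derive x (1 : R) H (DH x);
  lift_cont : continuous DH;
  lift_gt0 : forall x, 0 < DH x;
  var_mono : {homo v : x y / x <= y};
  varS : forall x, v (x + 1) = v x + V;
  var_le : forall x y, x <= y -> `|ln (DH x) - ln (DH y)| <= v y - v x }.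

Definition iter_deriv (R : realType) (H DH : R -> R) n x := \prod_(i < n) DH (iter i H x).

(** All return times [s] are allowed, not only the minimal period, so that multiples of a period
    need no separate treatment later. *)
Definition repelling (R : realType) (H DH : R -> R) := forall x s (k : int), (0 < s)%N ->
  iter s H x = x + k%:~R -> exists2 dl, 0 < dl &
  forall y, y != x -> `|y - x| < dl -> 1 < iter_deriv H DH s y.

Section lift.
Variables (R : realType) (d : nat) (H DH v : R -> R) (V : R).
Hypothesis L : BV_lift d H DH v V.
Local Notation Dn := (iter_deriv H DH).
Local Notation dR := (d%:R : R).

Lemma dR_ge2 : 2 <= dR. Proof. by rewrite ler_nat (lift_deg L). Qed.
Lemma dR_gt0 : 0 < dR. Proof. by have := dR_ge2; lra. Qed.

Lemma dX_gt0 n : 0 < dR ^+ n. Proof. by rewrite exprn_gt0 // dR_gt0. Qed.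

Lemma dX_ge n : n%:R <= dR ^+ n.
Proof.
elim: n => [|n IH]; first by rewrite expr0.
have X1 : 1 <= dR ^+ n by apply: exprn_ege1; have := dR_ge2; lra.
have := ler_wpM2r (le_trans ler01 X1) dR_ge2.
by rewrite -natr1 exprS; lra.
Qed.

Lemma DHS x : DH (x + 1) = DH x.
Proof.
have d1 := is_derive_shiftr (lift_derive L (x + 1)).
have d2 : is_derive x (1 : R) (fun y => H y + d%:R) (DH x + 0).
  by apply: is_deriveD; exact: lift_derive L x.
rewrite addr0 in d2; apply: is_derive_uniq d2.
by rewrite (_ : (fun y => _) = (fun y => H (y + 1)))//; apply/funext => y; rewrite (liftS L).
Qed.

Lemma iter_add1 n x : iter n H (x + 1) = iter n H x + dR ^+ n.
Proof.
have HSn m y : H (y + m%:R) = H y + dR * m%:R.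
  elim: m => [|m IH]; first by rewrite mulr0 !addr0.
  by rewrite -natr1 addrA (liftS L) IH; ring.
elim: n => [|n IH]; first by rewrite expr0.
by rewrite !iterS IH -natrX HSn natrX exprS.
Qed.

Lemma iter_int n x (k : int) : iter n H (x + k%:~R) = iter n H x + dR ^+ n * k%:~R.
Proof.
rewrite mulrC; have := @quasi_periodic_int R (iter n H) (dR ^+ n).
by move=> /(_ (iter_add1 n)) ->.
Qed.

Lemma dX_int n (k : int) : exists k' : int, dR ^+ n * k%:~R = k'%:~R.
Proof. by exists (d%:Z ^+ n * k); rewrite rmorphM rmorphXn. Qed.

Lemma iter_intE n x (k : int) : exists k' : int, iter n H (x + k%:~R) = iter n H x + k'%:~R.
Proof. by have [k' k'E] := dX_int n k; exists k'; rewrite iter_int k'E. Qed.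

Lemma DnS n x : Dn n.+1 x = Dn n x * DH (iter n H x).
Proof. by rewrite /iter_deriv big_ord_recr. Qed.

Lemma Dn0 x : Dn 0 x = 1. Proof. by rewrite /iter_deriv big_ord0. Qed.

Lemma DnD m n x : Dn (m + n) x = Dn m x * Dn n (iter m H x).
Proof.
rewrite /iter_deriv big_split_ord /=; congr (_ * _).
by apply: eq_bigr => i _; rewrite addnC iterD.
Qed.

Lemma Dn_gt0 n x : 0 < Dn n x.
Proof. by apply: prodr_gt0 => i _; apply: lift_gt0 L _. Qed.

Lemma DH_int x (k : int) : DH (x + k%:~R) = DH x.
Proof. exact: periodic_int DHS. Qed.

Lemma Dn_int n x (k : int) : Dn n (x + k%:~R) = Dn n x.
Proof.
apply: eq_bigr => i _; have [k' ->] := iter_intE i x k; exact: DH_int.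
Qed.

Lemma iter_derive n x : is_derive x (1 : R) (iter n H) (Dn n x).
Proof.
elim: n => [|n IH]; first by rewrite Dn0; exact: is_derive_id.
rewrite DnS mulrC.
by apply: (@is_derive1_comp R H (iter n H)); first exact: lift_derive L _.
Qed.

Lemma iter_cont n : continuous (iter n H).
Proof. exact: is_derive_cont (iter_derive n). Qed.

Lemma Dn_cont n : continuous (Dn n).
Proof.
elim: n => [|n IH] x.
  by rewrite (_ : Dn 0 = cst 1) ?funeqE//; [exact: cst_continuous|exact: Dn0].
rewrite (_ : Dn n.+1 = Dn n \* (DH \o iter n H)); last by apply/funext => y; rewrite DnS.
apply: continuousM; first exact: IH.
by apply: continuous_comp; [exact: iter_cont|exact: (lift_cont L)].
Qed.

Lemma iter_lt n x y : x < y -> iter n H x < iter n H y.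
Proof.
move=> xy; have [c _ E] := MVTle (iter_derive n) (ltW xy).
by rewrite -subr_gt0 E mulr_gt0 ?Dn_gt0// subr_gt0.
Qed.

Lemma iter_ltE n x y : (iter n H x < iter n H y) = (x < y).
Proof.
apply/idP/idP => [|/(iter_lt n)//]; apply: contraLR; rewrite -!leNgt le_eqVlt.
by move=> /predU1P[->//|/(iter_lt n)/ltW].
Qed.

Lemma iter_leE n x y : (iter n H x <= iter n H y) = (x <= y).
Proof. by rewrite !leNgt iter_ltE. Qed.

Lemma iter_surj n y : exists x, iter n H x = y.
Proof.
pose k := Num.ceil (`|y - iter n H 0|).
have k0 : 0 <= (k%:~R : R) by rewrite ler0z ceil_ge0; apply: lt_le_trans (normr_ge0 _); lra.
have kb : `|y - iter n H 0| <= k%:~R by exact: ceil_ge.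
have X1 : 1 <= dR ^+ n by apply: exprn_ege1; have := dR_ge2; lra.
have kX : k%:~R <= dR ^+ n * k%:~R by rewrite ler_peMl.
have ab : - (k%:~R : R) <= k%:~R by lra.
have fc : {within `[- k%:~R, k%:~R], continuous (iter n H)}.
  by apply: continuous_subspaceT; exact: iter_cont.
have := @IVT _ _ _ _ y ab fc.
have := iter_int n 0 k; rewrite add0r => ->.
have := iter_int n 0 (- k); rewrite add0r mulrNz mulrN => ->.
case; last by move=> c _ <-; exists c.
by rewrite ge_min le_max; move: kb; rewrite ler_norml => /andP[? ?]; apply/andP; split; apply/orP; [left|right]; lra.
Qed.

Lemma lift_bound : exists2 B, 0 < B & forall x, `|H x - dR * x| <= B.
Proof.
apply: (@periodic_bounded _ (fun x => H x - dR * x)); last first.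
  by move=> x; rewrite (liftS L); ring.
move=> x; apply: continuousB; first exact: is_derive_cts (lift_derive L x).
by apply: continuousM; [exact: cst_continuous|exact: id].
Qed.

Lemma ln_Dn n x : ln (Dn n x) = \sum_(0 <= i < n) ln (DH (iter i H x)).
Proof.
elim: n => [|n IH]; first by rewrite big_geq // Dn0 ln1.
by rewrite big_nat_recr //= DnS lnM ?posrE ?Dn_gt0 ?(lift_gt0 L) // IH.
Qed.

(** Denjoy's estimate: on the arc, [ln (Dn n)] oscillates by at most the sum of the variations of
    [ln DH] over the first [n] images, and disjoint images have total variation at most [V]. *)
Lemma distortion n x y p q : x <= p <= y -> x <= q <= y ->
  disjoint_arcs n (fun i => iter i H x) (fun i => iter i H y) ->
  Dn n p <= expR V * Dn n q.
Proof.
move=> /andP[xp py] /andP[xq qy] dis.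
have xy : x <= y by lra.
have h : ln (Dn n p) - ln (Dn n q) <= V.
  apply: le_trans (disjoint_arcs_sum (var_mono L) (varS L) _ dis); last first.
    by move=> i _; rewrite iter_leE.
  rewrite !ln_Dn -sumrB; apply: ler_sum => i _.
  apply: le_trans (ler_norm _) _.
  have vi a b : x <= a -> a <= b -> b <= y ->
      `|ln (DH (iter i H a)) - ln (DH (iter i H b))| <= v (iter i H y) - v (iter i H x).
    move=> xa ab yb; have := @var_le _ _ _ _ _ _ L (iter i H a) (iter i H b).
    rewrite iter_leE ab => /(_ isT) h.
    have := @var_mono _ _ _ _ _ _ L (iter i H x) (iter i H a).
    have := @var_mono _ _ _ _ _ _ L (iter i H b) (iter i H y).
    by rewrite !iter_leE xa yb => /(_ isT) ? /(_ isT) ?; lra.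
  by have [pq|/ltW qp] := leP p q; [exact: vi|rewrite distrC; exact: vi].
rewrite -[leLHS]lnK ?posrE ?Dn_gt0// -[Dn n q]lnK ?posrE ?Dn_gt0// -expRD ler_expR.
by move: h; lra.
Qed.

Lemma growth n x y p : x <= p <= y ->
  disjoint_arcs n (fun i => iter i H x) (fun i => iter i H y) ->
  iter n H y - iter n H x <= expR V * Dn n p * (y - x) /\
  Dn n p * (y - x) <= expR V * (iter n H y - iter n H x).
Proof.
move=> xpy dis; have xy : x <= y by lra.
have [c xcy ->] := MVTle (iter_derive n) xy.
have h1 := distortion xpy xcy dis; have h2 := distortion xcy xpy dis.
by split; rewrite ?mulrA ler_wpM2r // subr_ge0.
Qed.

End lift.

Arguments iter_cont {R d H DH v V} L n x _.
Arguments Dn_cont {R d H DH v V} L n x _.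

(** * The linear coordinate *)

Section semiconjugacy.
Variables (R : realType) (d : nat) (H DH v : R -> R) (V : R).
Hypothesis L : BV_lift d H DH v V.
Local Notation Dn := (iter_deriv H DH).
Local Notation dR := (d%:R : R).

Definition semiconj (th : R -> R) := [/\ {homo th : x y / x <= y},
  forall x, th (x + 1) = th x + 1, forall x, th (H x) = d%:R * th x & continuous th].

Lemma semiconj_exists : exists th, semiconj th.
Proof.
have [B B0 HB] := lift_bound L; have dge := dR_ge2 L.
have dX n := dX_gt0 L n.
have HB1 x : H x - dR * x <= B by apply: le_trans (ler_norm _) (HB x).
have HB2 x : - B <= H x - dR * x by have := HB x; rewrite ler_norml => /andP[].
(* Subtracting [B] makes the sequence nondecreasing: a further iterate loses at most [2 * B / d],
   which is at most [B] as [d >= 2]. *)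
pose s x n := (iter n H x - B) / dR ^+ n.
have s_nd x : nondecreasing_seq (s x).
  apply/nondecreasing_seqP => n.
  rewrite /s exprS invfM mulrA ler_pM2r ?invr_gt0 ?dX//.
  rewrite ler_pdivlMr ?(dR_gt0 L)// /=.
  by have := HB2 (iter n H x); move: dge; nra.
have s_ub x n : s x n <= x + B.
  have : (iter n H x + B) / dR ^+ n <= x + B.
    elim: n => [|n IH]; first by rewrite expr0 divr1.
    apply: le_trans IH.
    rewrite exprS invfM mulrA ler_pM2r ?invr_gt0 ?dX//.
    rewrite ler_pdivrMr ?(dR_gt0 L)// /=.
    by have := HB1 (iter n H x); move: dge; nra.
  by apply: le_trans; rewrite ler_pM2r ?invr_gt0 ?dX//; lra.
have s_cv x : cvgn (s x).
  apply: nondecreasing_is_cvgn => //; exists (x + B) => _ [n _ <-]; exact: s_ub.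
pose th x := limn (s x).
have thS x : th (x + 1) = th x + 1.
  have -> : th x + 1 = limn (fun n => s x n + 1).
    by apply/esym/cvg_lim => //; apply: cvgD; [exact: s_cv|exact: cvg_cst].
  rewrite /th; congr (limn _); apply/funext => n.
  rewrite /s (iter_add1 L); field; rewrite gt_eqF ?dX//.
have thH x : th (H x) = dR * th x.
  have -> : th x = limn (fun n => s x n.+1).
    by apply/esym/cvg_lim => //; rewrite (cvg_shiftS (s x)); exact: s_cv.
  have -> : dR * limn (fun n => s x n.+1) = limn (fun n => dR * s x n.+1).
    apply/esym/cvg_lim => //; apply: cvgM; first exact: cvg_cst.
    by apply/cvg_ex; exists (th x); rewrite (cvg_shiftS (s x)); exact: s_cv.
  rewrite /th; congr (limn _); apply/funext => n.
  rewrite /s -iterSr exprS; field; rewrite !gt_eqF ?dX//; exact: dR_gt0 L.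
have th_mono : {homo th : x y / x <= y}.
  move=> x y xy; apply: ler_lim; [exact: s_cv|exact: s_cv|].
  apply: nearW => n; rewrite /s ler_pM2r ?invr_gt0 ?dX// lerD2r.
  by rewrite (iter_leE L).
have th_near x : `|th x - x| <= B.
  rewrite ler_norml; apply/andP; split.
    rewrite lerBrDr; have -> : - B + x = s x 0%N by rewrite /s expr0 divr1 addrC.
    by apply: nondecreasing_cvgn_le => //; exact: s_cv.
  by rewrite lerBlDl; apply: limr_le; [exact: s_cv|apply: nearW => n; exact: s_ub].
exists th; split => //.
apply/continuousE => x e e0.
(* Since [th] is within [B] of the identity and [th (iter n H z) = d^n * th z], points whose [n]-th
   iterates are within 1 have [th]-values within [(2 * B + 1) / d^n]. *)
have [n ne] : exists n, (2 * B + 1) < e * dR ^+ n.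
  exists (Num.truncn ((2 * B + 1) / e)).+1; rewrite [ltRHS]mulrC -ltr_pdivrMr//.
  apply: lt_le_trans (dX_ge L _); exact: truncnS_gt.
have /continuousE /(_ x 1 ltr01) [dl dl0 Hdl] := iter_cont L n.
exists dl => // y yx.
have thn z : th (iter n H z) = dR ^+ n * th z.
  elim: n {ne Hdl} => [|n IH]; first by rewrite expr0 mul1r.
  by rewrite iterS thH IH exprS mulrA.
have : dR ^+ n * `|th y - th x| < e * dR ^+ n.
  rewrite -[dR ^+ n]gtr0_norm ?dX// -normrM mulrBr -!thn [X in _ < _ * X]gtr0_norm ?dX//.
  apply: le_lt_trans ne; have := Hdl y yx.
  have := th_near (iter n H x); have := th_near (iter n H y).
  rewrite !ler_norml ltr_norml => /andP[? ?] /andP[? ?] /andP[? ?].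
  by apply/andP; split; lra.
by rewrite mulrC ltr_pM2r ?dX.
Qed.

End semiconjugacy.

(** The infimum of the points after [a] where [f <= 0] is a zero that is approached from the left
    through positive values. *)
Lemma no_two_upcrossings (R : realType) (f : R -> R) a b : a < b -> continuous f ->
  f a = 0 -> f b = 0 ->
  (forall z, f z = 0 -> exists2 dl, 0 < dl & forall w, `|w - z| < dl ->
    (z < w -> 0 < f w) /\ (w < z -> f w < 0)) -> False.
Proof.
move=> ab /continuousE fc fa fb frep.
pose P := [set z | [/\ a < z, z <= b & f z <= 0]].
have Pb : P b by split => //; lra.
have Pi : has_inf P by split; [exists b | exists a => z [/ltW]].
have [da da0 daP] := frep _ fa.
have alt : a + da <= inf P.
  apply: lb_le_inf; first by exists b.
  move=> z [az zb fz]; rewrite leNgt; apply/negP => h.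
  have [|/(_ az)] := daP z _; last lra.
  by rewrite gtr0_norm; lra.
have ib : inf P <= b by apply: (ge_inf (proj2 Pi)).
have fpos z : a < z -> z < inf P -> 0 < f z.
  move=> az zi; rewrite ltNge; apply/negP => fz.
  have : inf P <= z by apply: (ge_inf (proj2 Pi)); split => //; lra.
  lra.
have fi : f (inf P) = 0.
  apply/eqP; rewrite eq_le; apply/andP; split; rewrite leNgt; apply/negP => h.
    have [dl dl0 dlP] := fc (inf P) _ h.
    have [z [az zb fz] zi] := inf_adherent dl0 Pi.
    have iz : inf P <= z by apply: (ge_inf (proj2 Pi)).
    have := dlP z; rewrite ger0_norm ?subr_ge0// ltrBlDl => /(_ zi).
    by rewrite ltr_norml; lra.
  have h' : 0 < - f (inf P) by lra.
  have [dl dl0 dlP] := fc (inf P) _ h'.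
  pose w := inf P - Num.min (da / 2) (dl / 2).
  have wm : 0 < Num.min (da / 2) (dl / 2) by rewrite lt_min; apply/andP; split; lra.
  have wm1 : Num.min (da / 2) (dl / 2) <= da / 2 by rewrite ge_min lexx.
  have wm2 : Num.min (da / 2) (dl / 2) <= dl / 2 by rewrite ge_min lexx orbT.
  have fw : 0 < f w by apply: fpos; rewrite /w; lra.
  have : `|f w - f (inf P)| < - f (inf P).
    by apply: dlP; rewrite ltr_norml /w; apply/andP; split; lra.
  by rewrite ltr_norml => /andP[_]; move: fw; lra.
have [dl dl0 dlP] := frep _ fi.
pose w := inf P - Num.min (da / 2) (dl / 2).
have wm : 0 < Num.min (da / 2) (dl / 2) by rewrite lt_min; apply/andP; split; lra.
have wm1 : Num.min (da / 2) (dl / 2) <= da / 2 by rewrite ge_min lexx.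
have wm2 : Num.min (da / 2) (dl / 2) <= dl / 2 by rewrite ge_min lexx orbT.
have fw : 0 < f w by apply: fpos; rewrite /w; lra.
have [_ fw'] : (inf P < w -> 0 < f w) /\ (w < inf P -> f w < 0).
  by apply: dlP; rewrite ltr_norml /w; apply/andP; split; lra.
have : f w < 0 by apply: fw'; rewrite /w; lra.
by move: fw; lra.
Qed.

(** * Plateaus of the semiconjugacy are not eventually periodic *)

Section semiconjugacy_theory.
Variables (R : realType) (d : nat) (H DH v : R -> R) (V : R).
Hypothesis L : BV_lift d H DH v V.
Local Notation Dn := (iter_deriv H DH).
Local Notation dR := (d%:R : R).
Variable th : R -> R.
Hypothesis S : semiconj d H th.

Lemma th_mono : {homo th : x y / x <= y}. Proof. by case: S. Qed.

Lemma th_int x (k : int) : th (x + k%:~R) = th x + k%:~R.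
Proof.
by have [_ thS _ _] := S; rewrite (@quasi_periodic_int R th 1 thS) mulr1.
Qed.

Lemma th_iter n x : th (iter n H x) = dR ^+ n * th x.
Proof.
have [_ _ thH _] := S.
elim: n => [|n IH]; first by rewrite expr0 mul1r.
by rewrite iterS thH IH exprS mulrA.
Qed.

Lemma th_fibre x : exists l r, [/\ l <= x, x <= r & forall z, (th z == th x) = (l <= z <= r)].
Proof.
have [_ thS _ /continuousE thc] := S.
pose F := [set z | th z = th x].
have Fx : F x by [].
have Fub z : F z -> z <= x + 1.
  move=> Fz; rewrite leNgt; apply/negP => /ltW/th_mono; rewrite thS Fz; lra.
have Flb z : F z -> x - 1 <= z.
  move=> Fz; rewrite leNgt; apply/negP => h.
  have /th_mono : z + 1 <= x by lra.
  by rewrite thS Fz; lra.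
have Fs : has_sup F by split; [exists x | exists (x + 1) => z /Fub].
have Fi : has_inf F by split; [exists x | exists (x - 1) => z /Flb].
have xs : x <= sup F by apply: (ub_le_sup (proj2 Fs)).
have xi : inf F <= x by apply: (ge_inf (proj2 Fi)).
have ths : th (sup F) = th x.
  apply/eqP; rewrite eq_le (th_mono xs) andbT leNgt; apply/negP => lt.
  have := thc (sup F) (th (sup F) - th x); rewrite subr_gt0 => /(_ lt) [dl dl0 cdl].
  have [z Fz zs] := sup_adherent dl0 Fs.
  have zle : z <= sup F by apply: (ub_le_sup (proj2 Fs)).
  have /cdl : `|z - sup F| < dl by rewrite distrC ger0_norm ?subr_ge0//; lra.
  by rewrite Fz ltr_norml; lra.
have thi : th (inf F) = th x.
  apply/eqP; rewrite eq_le (th_mono xi) /= leNgt; apply/negP => lt.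
  have := thc (inf F) (th x - th (inf F)); rewrite subr_gt0 => /(_ lt) [dl dl0 cdl].
  have [z Fz zs] := inf_adherent dl0 Fi.
  have zle : inf F <= z by apply: (ge_inf (proj2 Fi)).
  have /cdl : `|z - inf F| < dl by rewrite ger0_norm ?subr_ge0//; lra.
  by rewrite Fz ltr_norml; lra.
exists (inf F), (sup F); split => // z; apply/eqP/andP => [Fz|[iz zs]].
  by split; [apply: (ge_inf (proj2 Fi)) | apply: (ub_le_sup (proj2 Fs))].
by apply/eqP; rewrite eq_le -[X in _ <= X]ths (th_mono zs) -thi (th_mono iz).
Qed.

Section plateau.
Variables (t l r : R).
Hypothesis lr : l < r.
Hypothesis fib : forall z, (th z == t) = (l <= z <= r).

Lemma iter_fibre n z : (th z == dR ^+ n * t) = (iter n H l <= z <= iter n H r).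
Proof.
have [w <-] := iter_surj L n z.
rewrite th_iter !(iter_leE L) -fib; apply/eqP/eqP => [|-> //].
by apply: mulfI; rewrite gt_eqF // (dX_gt0 L).
Qed.

Hypothesis Rep : repelling H DH.

(** The map [iter s H - k] would fix both ends of the [n]-th image of the plateau, whereas its graph
    crosses the diagonal upwards at every repelling fixed point. *)
Lemma no_periodic_plateau n s (k : int) : (0 < s)%N -> dR ^+ (n + s) * t != dR ^+ n * t + k%:~R.
Proof.
move=> s0; apply/negP => /eqP coin.
pose a := iter n H l; pose b := iter n H r.
have ab : a < b by rewrite (iter_ltE L).
have fibs z : (iter s H a <= z <= iter s H b) = (a <= z - k%:~R <= b).
  rewrite /a /b -!iterD addnC -!iter_fibre coin.
  by rewrite -mulrNz th_int mulrNz subr_eq.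
have sab : iter s H a < iter s H b by rewrite (iter_ltE L).
have ha : iter s H a = a + k%:~R.
  have /andP[h _] : a <= iter s H a - k%:~R <= b by rewrite -fibs lexx ltW.
  have /andP[h' _] : iter s H a <= a + k%:~R <= iter s H b by rewrite fibs addrK lexx ltW.
  by lra.
have hb : iter s H b = b + k%:~R.
  have /andP[_ h] : a <= iter s H b - k%:~R <= b by rewrite -fibs lexx ltW.
  have /andP[_ h'] : iter s H a <= b + k%:~R <= iter s H b by rewrite fibs addrK lexx ltW.
  by lra.
pose f z := iter s H z - k%:~R - z.
have fd z : is_derive z (1:R) f (Dn s z - 1).
  have -> : Dn s z - 1 = Dn s z - 0 - 1 by lra.
  by apply: is_deriveB; apply: is_deriveB; exact: iter_derive L _ _.
have fc := is_derive_cont fd.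
have frep z : f z = 0 -> exists2 dl, 0 < dl & forall w, `|w - z| < dl ->
    (z < w -> 0 < f w) /\ (w < z -> f w < 0).
  move=> fz; have zk : iter s H z = z + k%:~R by move: fz; rewrite /f; lra.
  have [dl dl0 dlP] := Rep s0 zk; exists dl => // w wz; split => zw.
    have [c /andP[zc cw] fw] := MVTlt fd zw.
    have := dlP c; rewrite gt_eqF // => /(_ isT) h.
    have : 1 < Dn s c by apply: h; move: wz; rewrite !ltr_norml; lra.
    by move: fw; rewrite fz subr0 => -> c1; apply: mulr_gt0; lra.
  have [c /andP[zc cw] fw] := MVTlt fd zw.
  have := dlP c; rewrite lt_eqF // => /(_ isT) h.
  have : 1 < Dn s c by apply: h; move: wz; rewrite !ltr_norml; lra.
  rewrite -oppr_gt0 => c1; have -> : - f w = f z - f w by lra.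
  by rewrite fw; apply: mulr_gt0; lra.
apply: (no_two_upcrossings ab fc _ _ frep); rewrite /f ?ha ?hb; lra.
Qed.

End plateau.
End semiconjugacy_theory.

(** * Absence of wandering plateaus *)

Section wandering.
Variables (R : realType) (d : nat) (H DH v : R -> R) (V : R).
Hypothesis L : BV_lift d H DH v V.
Local Notation Dn := (iter_deriv H DH).
Local Notation dR := (d%:R : R).
Variable th : R -> R.
Hypothesis S : semiconj d H th.
Variables (t l r : R).
Hypothesis lr : l < r.
Hypothesis fib : forall z, (th z == t) = (l <= z <= r).
Hypothesis wand : forall n s (k : int), (0 < s)%N -> dR ^+ (n + s) * t != dR ^+ n * t + k%:~R.

Local Notation ln n := (iter n H l).
Local Notation rn n := (iter n H r).
Local Notation tn n := (dR ^+ n * t).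

Let thl n : th (ln n) = tn n.
Proof. by apply/eqP; rewrite (iter_fibre L S fib) lexx /= (iter_leE L) ltW. Qed.
Let thr n : th (rn n) = tn n.
Proof. by apply/eqP; rewrite (iter_fibre L S fib) lexx /= (iter_leE L) ltW. Qed.

Let tn_neq i j (k : int) : (i != j) || (k != 0) -> tn i != tn j + k%:~R.
Proof.
case: (ltngtP i j) => //= [ij _|ij _|-> k0].
- have := @wand i (j - i)%N (- k); rewrite subn_gt0 subnKC ?(ltnW ij) // => /(_ ij).
  by apply: contra => /eqP ->; rewrite mulrNz addrK.
- by have := @wand j (i - j)%N k; rewrite subn_gt0 subnKC ?(ltnW ij) // => /(_ ij).
- by rewrite -subr_eq0 opprD addNKr oppr_eq0 intr_eq0.
Qed.

Lemma plateau_disjoint i j (k : int) : (i != j) || (k != 0) ->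
  rn i <= ln j + k%:~R \/ rn j + k%:~R <= ln i.
Proof.
move=> /tn_neq; rewrite neq_lt => /orP[] h; [left|right]; rewrite leNgt; apply/negP => /ltW/(th_mono S);
by rewrite (th_int S) thl thr; lra.
Qed.

Lemma plateaus_disjoint n : disjoint_arcs n (fun i => ln i) (fun i => rn i).
Proof. by move=> i j k _ _; exact: plateau_disjoint. Qed.

Local Notation len n := (rn n - ln n).

Let len_gt0 n : 0 < len n. Proof. by rewrite subr_gt0 (iter_ltE L). Qed.

Lemma len_sum n : \sum_(0 <= i < n) len i <= 1.
Proof.
apply: (@disjoint_arcs_sum R id 1) => //; last exact: plateaus_disjoint.
by move=> i _; rewrite (iter_leE L) ltW.
Qed.

(** The lengths are summable, so some of them fall below the minimum of [1 / 2] and of the lengths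
    up to [N]; the first one to do so is a record. *)
Lemma len_record N : exists n, [/\ (N <= n)%N, len n <= 1 / 2 & forall j, (j < n)%N -> len n <= len j].
Proof.
have [m m0 mP] : exists2 m, 0 < m <= 1 / 2 & forall j, (j <= N)%N -> m <= len j.
  elim: N => [|N [m /andP[m0 m1] mP]].
    exists (Num.min (1 / 2) (len 0)).
      by rewrite ge_min lexx lt_min len_gt0 !andbT; lra.
    by move=> j; rewrite leqn0 => /eqP ->; rewrite ge_min lexx orbT.
  exists (Num.min m (len N.+1)); first by rewrite lt_min m0 len_gt0 ge_min m1.
  move=> j; rewrite leq_eqVlt ge_min => /orP[/eqP ->|]; first by rewrite lexx orbT.
  by rewrite ltnS => /mP ->.
move/andP: m0 => [m0 m1].
have ex : exists n, len n < m.
  apply: contrapT => /forallNP nex; pose q := (Num.truncn (1 / m)).+1.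
  have := len_sum q; apply/negP; rewrite -ltNge.
  apply: (@lt_le_trans _ _ (\sum_(0 <= i < q) m)).
    by rewrite sumr_const_nat subn0 -mulr_natl -ltr_pdivrMr// truncnS_gt.
  by apply: ler_sum => i _; rewrite leNgt; apply/negP/nex.
case: (ex_minnP ex) => n nP nmin.
exists n; split.
- by rewrite leqNgt; apply/negP => /ltnW/mP; rewrite leNgt nP.
- by lra.
- move=> j jn; apply: ltW; apply: lt_le_trans nP _; rewrite leNgt; apply/negP => /nmin.
  by rewrite leqNgt jn.
Qed.

Let dX_int_ge1 m (k : int) : (0 < k)%R -> 1 <= dR ^+ m * k%:~R.
Proof.
move=> k0; have k1 : (1 : R) <= k%:~R by rewrite ler1z.
have := dR_ge2 L => dge; have X1 : 1 <= dR ^+ m by apply: exprn_ege1; lra.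
by rewrite -[leLHS]mulr1 ler_pM.
Qed.

(* A pull-back of the arc to the right of the [n]-th plateau meets that arc only
   if it contains the [n]-th plateau, i.e. the orbit moves right in between. *)
Lemma right_overlap n e z : (forall j, (j < n)%N -> len n <= len j) ->
  0 < e < len n -> e < 1 -> iter n H z = rn n + e ->
  ~ disjoint_arcs n (fun i => rn i) (fun i => iter i H z) ->
  exists al s, [/\ 0 < al, (0 < s)%N, dR ^+ s * al <= th (rn n + e) - tn n &
    tn n - th (ln n - e) <= al].
Proof.
move=> rec /andP[e0 eln] e1 zE.
have rz : r < z by rewrite -(iter_ltE L n) zE ltrDl.
(* Applying [n - j] further iterates moves the later arc onto the arc of length [e] adjacent to the
   [n]-th plateau. The [a]-th plateau is longer than [e] by the record, so it does not fit in there
   and lies to the left of the [n]-th one. *)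
have core i j (k : int) : (i < j)%N -> (j < n)%N -> rn j + k%:~R < iter i H z ->
    rn i < iter j H z + k%:~R -> exists al s, [/\ 0 < al, (0 < s)%N,
    dR ^+ s * al <= th (rn n + e) - tn n & tn n - th (ln n - e) <= al].
  move=> ij jn h1 h2; pose a := (i + (n - j))%N; pose s := (j - i)%N.
  have s0 : (0 < s)%N by rewrite subn_gt0.
  have an : (a < n)%N by rewrite /a; lia.
  have san : (s + a = n)%N by rewrite /s /a; lia.
  have [K KE] := dX_int R d (n - j) k.
  have {h1}h1 : rn n + K%:~R < iter a H z.
    move: h1; rewrite -(iter_ltE L (n - j)) (iter_int L) -!iterD KE.
    by rewrite subnK ?(ltnW jn)// /a addnC.
  have {h2}h2 : rn a < rn n + e + K%:~R.
    move: h2; rewrite -(iter_ltE L (n - j)) (iter_int L) -!iterD KE.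
    by rewrite subnK ?(ltnW jn)// zE /a addnC.
  have lena := rec _ an.
  have an0 : (n != a) || (- K != 0) by rewrite gtn_eqF.
  have [h|h] := plateau_disjoint an0; first by rewrite mulrNz in h; lra.
  rewrite mulrNz in h; exists (tn n - tn a + K%:~R), s; split => //.
  - have := th_mono S h; rewrite -mulrNz (th_int S) thl thr.
    by have := tn_neq an0; rewrite mulrNz neq_lt => /orP[]; lra.
  - have : iter s H (rn n + K%:~R) < iter s H (iter a H z) by rewrite (iter_ltE L).
    rewrite (iter_int L) -!iterD san zE => /ltW/(th_mono S).
    have [K' K'E] := dX_int R d s K.
    rewrite K'E (th_int S) thr -K'E => h3.
    have : dR ^+ s * tn a = tn n by rewrite mulrA -exprD san.
    by move: h3; rewrite exprD !mulrDr mulrN; move=> h3 ->; rewrite mulrA; lra.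
  - have : th (ln a - K%:~R) <= th (ln n - e) by apply: (th_mono S); lra.
    by rewrite -mulrNz (th_int S) thl mulrNz; lra.
move=> /existsNP[i /existsNP[j /existsNP[k /not_implyP[ni /not_implyP[nj /not_implyP[ijk]]]]]].
move=> /not_orP[/negP + /negP]; rewrite -!ltNge => h1 h2.
have [ij|ji|ij] := ltngtP i j.
- exact: core ij nj h1 h2.
- by apply: (core j i (- k)) => //; rewrite mulrNz; lra.
move: ijk; rewrite ij eqxx /= in h1 h2 *.
have up (q : int) : (0 < q)%R -> rn j + q%:~R < iter j H z -> False.
  move=> q0; rewrite -(iter_ltE L (n - j)) (iter_int L) -!iterD subnK ?(ltnW nj)// zE.
  by have := dX_int_ge1 (n - j) q0; lra.
rewrite neq_lt => /orP[k0|k0]; last by have := up _ k0 h1.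
by have := @up (- k); rewrite oppr_gt0 mulrNz => /(_ k0); case; lra.
Qed.

(** Mirror image of [right_overlap]. *)
Lemma left_overlap n e z : (forall j, (j < n)%N -> len n <= len j) ->
  0 < e < len n -> e < 1 -> iter n H z = ln n - e ->
  ~ disjoint_arcs n (fun i => iter i H z) (fun i => ln i) ->
  exists al s, [/\ 0 < al, (0 < s)%N, dR ^+ s * al <= tn n - th (ln n - e) &
    th (rn n + e) - tn n <= al].
Proof.
move=> rec /andP[e0 eln] e1 zE.
have zl : z < l by rewrite -(iter_ltE L n) zE ltrBlDr ltrDl.
have core i j (k : int) : (i < j)%N -> (j < n)%N -> iter j H z + k%:~R < ln i ->
    iter i H z < ln j + k%:~R -> exists al s, [/\ 0 < al, (0 < s)%N,
    dR ^+ s * al <= tn n - th (ln n - e) & th (rn n + e) - tn n <= al].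
  move=> ij jn h1 h2; pose a := (i + (n - j))%N; pose s := (j - i)%N.
  have s0 : (0 < s)%N by rewrite subn_gt0.
  have an : (a < n)%N by rewrite /a; lia.
  have san : (s + a = n)%N by rewrite /s /a; lia.
  have [K KE] := dX_int R d (n - j) k.
  have {h1}h1 : ln n - e + K%:~R < ln a.
    move: h1; rewrite -(iter_ltE L (n - j)) (iter_int L) -!iterD KE.
    by rewrite subnK ?(ltnW jn)// zE /a addnC.
  have {h2}h2 : iter a H z < ln n + K%:~R.
    move: h2; rewrite -(iter_ltE L (n - j)) (iter_int L) -!iterD KE.
    by rewrite subnK ?(ltnW jn)// /a addnC.
  have lena := rec _ an.
  have an0 : (a != n) || (K != 0) by rewrite ltn_eqF.
  have [h|h] := plateau_disjoint an0; first by lra.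
  exists (tn a - tn n - K%:~R), s; split => //.
  - have := th_mono S h; rewrite (th_int S) thl thr.
    by have := tn_neq an0; rewrite neq_lt => /orP[]; lra.
  - have : iter s H (iter a H z) < iter s H (ln n + K%:~R) by rewrite (iter_ltE L).
    rewrite (iter_int L) -!iterD san zE => /ltW/(th_mono S).
    have [K' K'E] := dX_int R d s K.
    rewrite K'E (th_int S) thl -K'E => h3.
    have : dR ^+ s * tn a = tn n by rewrite mulrA -exprD san.
    by move: h3; rewrite exprD !mulrDr !mulrN; move=> h3 ->; rewrite mulrA; lra.
  - have : th (rn n + e) <= th (rn a - K%:~R) by apply: (th_mono S); lra.
    by rewrite -mulrNz (th_int S) thr mulrNz; lra.
move=> /existsNP[i /existsNP[j /existsNP[k /not_implyP[ni /not_implyP[nj /not_implyP[ijk]]]]]].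
move=> /not_orP[/negP + /negP]; rewrite -!ltNge => h1 h2.
have [ij|ji|ij] := ltngtP i j.
- exact: core ij nj h1 h2.
- by apply: (core j i (- k)) => //; rewrite mulrNz; lra.
move: ijk; rewrite ij eqxx /= in h1 h2 *.
have up (q : int) : (0 < q)%R -> iter j H z + q%:~R < ln j -> False.
  move=> q0; rewrite -(iter_ltE L (n - j)) (iter_int L) -!iterD subnK ?(ltnW nj)// zE.
  by have := dX_int_ge1 (n - j) q0; lra.
rewrite neq_lt => /orP[k0|k0]; last by have := up _ k0 h1.
by have := @up (- k); rewrite oppr_gt0 mulrNz => /(_ k0); case; lra.
Qed.

Lemma no_wandering_plateau : False.
Proof.
have rl := lr; have tV := expR_gt0 V.
(* A lower bound, independent of [n], for the pull-backs of the arcs adjacent to the [n]-th plateau: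
   one factor [expR V] for the plateau, one for the adjacent arc, and 2 for [e = len n / 2]. *)
pose dl := (r - l) / (expR V * expR V * 2).
have dl0 : 0 < dl by rewrite divr_gt0 ?subr_gt0 // !mulr_gt0.
pose tau := Num.min (th (r + dl) - t) (t - th (l - dl)).
have tau0 : 0 < tau.
  rewrite lt_min !subr_gt0; apply/andP; split; rewrite lt_neqAle.
    rewrite eq_sym fib negb_and -!ltNge ltrDl dl0 orbT /=.
    by have := th_mono S (_ : r <= r + dl); rewrite -[th r]/(th (rn 0)) thr expr0 mul1r lerDl; apply; exact: ltW.
  rewrite fib negb_and -!ltNge ltrBlDr ltrDl dl0 /=.
  by have := th_mono S (_ : l - dl <= l); rewrite -[th l]/(th (ln 0)) thl expr0 mul1r lerBlDr lerDl; apply; exact: ltW.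
(* For this [n] the factor [d^n] stretches the increment [tau] of [th] next to the plateau beyond 1,
   while [e < 1]. *)
have [n [Nn len1 rec]] := len_record (Num.truncn (1 / tau)).+1.
have taun : 1 < tau * dR ^+ n.
  rewrite mulrC -ltr_pdivrMr //; apply: lt_le_trans (dX_ge L n).
  by apply: lt_le_trans (truncnS_gt _) _; rewrite ler_nat.
pose e := len n / 2.
have ln0 := len_gt0 n.
have e0 : 0 < e < len n by rewrite /e; apply/andP; split; lra.
have e1 : e < 1 by rewrite /e; lra.
have [zr zrE] := iter_surj L n (rn n + e).
have [zl zlE] := iter_surj L n (ln n - e).
have rzr : r < zr by rewrite -(iter_ltE L n) zrE; lra.
have zll : zl < l by rewrite -(iter_ltE L n) zlE; lra.
(* Distortion is controlled separately on the plateau and on the arc next to it. *)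
have side p y w : (p = r /\ w = y - r) \/ (p = l /\ w = l - y) -> 0 <= w ->
    e <= expR V * Dn n p * w -> dl <= w.
  move=> pE w0 he.
  have pin : l <= p <= r by case: pE => -[-> _]; rewrite lexx ltW.
  have [_ g] := growth L pin (@plateaus_disjoint n).
  rewrite /dl ler_pdivrMr ?mulr_gt0//.
  have : Dn n p * (r - l) * (expR V * w) <= expR V * len n * (expR V * w).
    by rewrite ler_wpM2r // mulr_ge0 // ltW.
  have := ler_wpM2r (ltW (_ : 0 < r - l)) he; rewrite subr_gt0 => /(_ rl) h1 h2.
  have : e * (r - l) <= e * (w * (expR V * expR V * 2)).
    apply: le_trans h1 _; rewrite (_ : _ * (r - l) = Dn n p * (r - l) * (expR V * w)); last by ring.
    by apply: le_trans h2 _; rewrite le_eqVlt /e; apply/orP; left; apply/eqP; field.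
  by case/andP: e0 => e0 _; rewrite ler_pM2l.
have [gR|bR] := pselect (disjoint_arcs n (fun i => rn i) (fun i => iter i H zr)).
  have rin : r <= r <= zr by rewrite lexx ltW.
  have [g _] := growth L rin gR; rewrite zrE addrAC subrr add0r in g.
  have {}g := side r zr _ (or_introl (conj erefl erefl)) (ltW (_ : 0 < zr - r)) g.
  have : th (r + dl) <= th zr by apply: (th_mono S); rewrite -lerBrDl g // subr_gt0.
  have : tau <= th (r + dl) - t by rewrite ge_min lexx.
  have : dR ^+ n * th zr <= dR ^+ n * t + 1.
    rewrite -(th_iter S) zrE -thr -[_ + 1]/(_ + 1%:~R) -(th_int S); apply: (th_mono S); rewrite lerD2l; lra.
  have := dX_gt0 L n; move: taun; move: (dR ^+ n) (th zr) (th (r + dl)) => X a b; nra.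
have [gL|bL] := pselect (disjoint_arcs n (fun i => iter i H zl) (fun i => ln i)).
  have lin : zl <= l <= l by rewrite lexx ltW.
  have [g _] := growth L lin gL; rewrite zlE opprD addrA subrr add0r opprK in g.
  have {}g := side l zl _ (or_intror (conj erefl erefl)) (ltW (_ : 0 < l - zl)) g.
  have : th zl <= th (l - dl) by apply: (th_mono S); rewrite lerBrDl -lerBrDr g // subr_gt0.
  have : tau <= t - th (l - dl) by rewrite ge_min lexx orbT.
  have : dR ^+ n * t - 1 <= dR ^+ n * th zl.
    rewrite -(th_iter S) zlE -thl -[_ - 1]/(_ + (-1)%:~R) -(th_int S); apply: (th_mono S); rewrite lerD2l lerN2; lra.
  have := dX_gt0 L n; move: taun; move: (dR ^+ n) (th zl) (th (l - dl)) => X a b; nra.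
(* Overlaps on both sides make each one-sided increment of [th] at the [n]-th plateau at least twice
   the other, although they are positive. *)
have [al [s [al0 s0 h1 h2]]] := right_overlap rec e0 e1 zrE bR.
have [be [s' [be0 s'0 h3 h4]]] := left_overlap rec e0 e1 zlE bL.
have X2 m : (0 < m)%N -> 2 <= dR ^+ m.
  case: m => // m _; rewrite exprS; have := dR_ge2 L.
  have : 1 <= dR ^+ m by apply: exprn_ege1; have := dR_ge2 L; lra.
  by move: (dR ^+ m) => X; nra.
have := ler_wpM2r (ltW al0) (X2 _ s0); have := ler_wpM2r (ltW be0) (X2 _ s'0); lra.
Qed.

End wandering.

Lemma semiconj_inj (R : realType) (d : nat) (H DH v : R -> R) (V : R) (th : R -> R) :
  BV_lift d H DH v V -> repelling H DH -> semiconj d H th -> {homo th : x y / x < y}.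
Proof.
move=> L Rep S x y xy; rewrite lt_neqAle (th_mono S (ltW xy)) andbT; apply/negP => /eqP thxy.
have [l [r [lx xr fib]]] := th_fibre S x.
have yr : y <= r by have := fib y; rewrite thxy eqxx => /esym/andP[].
have lr : l < r by lra.
apply: (no_wandering_plateau L S lr fib) => n s k; exact: (no_periodic_plateau L S lr fib Rep).
Qed.

(** [X] is the inverse of [th] once the latter is injective. Orbits are computed in the parameter,
    where [H] is multiplication by [d]; lengths and derivatives are measured through [X]. *)
Record linear_coord (R : realType) (d : nat) (H X : R -> R) : Prop := LinearCoord {
  coord_lt : {homo X : u w / u < w};
  coord_S : forall u, X (u + 1) = X u + 1;
  coord_H : forall u, X (d%:R * u) = H (X u);
  coord_surj : forall x, exists u, X u = x;
  coord_unif : forall e, 0 < e -> exists2 dl, 0 < dl & forall u, X (u + dl) - X u <= e }.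

Lemma linear_coord_exists (R : realType) (d : nat) (H DH v : R -> R) (V : R) :
  BV_lift d H DH v V -> repelling H DH -> exists X, linear_coord d H X.
Proof.
move=> L Rep; have [th S] := semiconj_exists L.
have [_ thS thH thc] := S; have inj := semiconj_inj L Rep S.
have le_th x y : (th x <= th y) = (x <= y).
  apply/idP/idP; last exact: th_mono S x y.
  by rewrite leNgt => h; rewrite leNgt; apply: contra h => /inj.
have lt_th x y : (th x < th y) = (x < y) by rewrite !ltNge le_th.
have surj u : exists x, th x = u.
  pose k := Num.ceil (`|u - th 0|).
  have kb : `|u - th 0| <= k%:~R by exact: ceil_ge.
  have k0 : 0 <= (k%:~R : R) by apply: le_trans kb.
  have ab : - (k%:~R : R) <= k%:~R by lra.
  have fc : {within `[- k%:~R, k%:~R], continuous th} by apply: continuous_subspaceT.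
  have := @IVT _ _ _ _ u ab fc.
  have := th_int S 0 k; rewrite add0r => ->.
  have := th_int S 0 (- k); rewrite add0r mulrNz => ->.
  case; last by move=> c _ <-; exists c.
  rewrite ge_min le_max; move: kb; rewrite ler_norml => /andP[? ?].
  by apply/andP; split; apply/orP; [left|right]; lra.
have [X XK] := choice surj; exists X.
have KX x : X (th x) = x.
  by apply/eqP; rewrite eq_le -(le_th _ x) XK lexx -(le_th x) XK lexx.
split.
- by move=> u w uw; rewrite -lt_th !XK.
- by move=> u; rewrite -{1}(XK u) -thS KX.
- by move=> u; rewrite -{1}(XK u) -thH KX.
- by move=> x; exists (th x).
move=> e e0; have [|||dl dl0 dlP] := @periodic_pos_lb _ (fun x => th (x + e) - th x).
- move=> x; apply: continuousB; last exact: thc.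
  apply: continuous_comp; last exact: thc.
  by apply: continuousD; [exact: id|exact: cst_continuous].
- by move=> x; rewrite addrAC !thS; lra.
- by move=> x; rewrite subr_gt0 lt_th ltrDl.
exists dl => // u; rewrite lerBlDl leNgt -lt_th XK; apply/negP => h.
by have := dlP (X u); rewrite XK; lra.
Qed.

Section coord_theory.
Variables (R : realType) (d : nat) (H DH v : R -> R) (V : R).
Hypothesis L : BV_lift d H DH v V.
Local Notation Dn := (iter_deriv H DH).
Local Notation dR := (d%:R : R).
Variable X : R -> R.
Hypothesis C : linear_coord d H X.

Lemma coord_int u (k : int) : X (u + k%:~R) = X u + k%:~R.
Proof. by rewrite (@quasi_periodic_int R X 1 (coord_S C)) mulr1. Qed.

Lemma coord_iter n u : iter n H (X u) = X (dR ^+ n * u).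
Proof.
elim: n => [|n IH]; first by rewrite expr0 mul1r.
by rewrite iterS IH -(coord_H C) exprS mulrA.
Qed.

Lemma coord_leE u w : (X u <= X w) = (u <= w).
Proof.
apply/idP/idP => [|]; last by rewrite le_eqVlt => /predU1P[->//|/(coord_lt C)/ltW].
by rewrite leNgt => h; rewrite leNgt; apply: contra h => /(coord_lt C).
Qed.

Lemma coord_ltE u w : (X u < X w) = (u < w).
Proof. by rewrite !ltNge coord_leE. Qed.

Lemma Dn_coord_int n u (k : int) : Dn n (X (u + k%:~R)) = Dn n (X u).
Proof. by rewrite coord_int (Dn_int L). Qed.

Definition disjoint_orbit n c f := disjoint_arcs n (fun i => dR ^+ i * c) (fun i => dR ^+ i * f).

Lemma disjoint_orbit_coord n c f : disjoint_orbit n c f ->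
  disjoint_arcs n (fun i => iter i H (X c)) (fun i => iter i H (X f)).
Proof.
move=> dis i j k ni nj ijk; have := dis i j k ni nj ijk.
by rewrite !coord_iter -!coord_int !coord_leE.
Qed.

Lemma coord_growth n c f u : c <= u <= f -> disjoint_orbit n c f ->
  X (dR ^+ n * f) - X (dR ^+ n * c) <= expR V * Dn n (X u) * (X f - X c) /\
  Dn n (X u) * (X f - X c) <= expR V * (X (dR ^+ n * f) - X (dR ^+ n * c)).
Proof.
move=> /andP[cu uf] /disjoint_orbit_coord dis; rewrite -!coord_iter; apply: (growth L _ dis).
by rewrite !coord_leE cu.
Qed.

End coord_theory.

(** * Backward orbits of bounded growth *)

Section returns.
Variables (R : realType) (d : nat) (H DH v : R -> R) (V : R).
Hypothesis L : BV_lift d H DH v V.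
Local Notation Dn := (iter_deriv H DH).
Local Notation dR := (d%:R : R).
Variable X : R -> R.
Hypothesis C : linear_coord d H X.

Definition in_arc (c f u : R) := exists k : int, c < u + k%:~R < f.

(** The nice intervals of one-dimensional dynamics: as no iterate of an end point falls inside, a
    pull-back of the arc cannot straddle an end of the arc, so it is inside the arc or disjoint from
    it modulo 1. *)
Definition nice_arc (c f : R) := forall n (k : int), (0 < n)%N ->
  ~~ (c < dR ^+ n * c + k%:~R < f) /\ ~~ (c < dR ^+ n * f + k%:~R < f).

Definition backward_orbit (u : nat -> R) := forall m, exists k : int, dR * u m.+1 = u m + k%:~R.

Lemma in_arc_int c f u (k : int) : in_arc c f (u + k%:~R) <-> in_arc c f u.
Proof.
split=> -[j cuf]; first by exists (k + j); rewrite intrD addrA.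
by exists (j - k); rewrite (_ : u + k%:~R + _ = u + j%:~R) // intrB; ring.
Qed.

Lemma backward_orbitD u l r : backward_orbit u -> exists k : int, dR ^+ r * u (l + r)%N = u l + k%:~R.
Proof.
move=> bu; elim: r => [|r [k IH]]; first by exists 0; rewrite expr0 mul1r addn0 addr0.
have [j jE] := bu (l + r)%N; have [j' j'E] := dX_int R d r j; exists (j' + k).
by rewrite addnS exprSr -mulrA jE mulrDr IH j'E intrD; ring.
Qed.

Lemma backward_orbit_Dn u l r : backward_orbit u ->
  Dn (l + r) (X (u (l + r)%N)) = Dn r (X (u (l + r)%N)) * Dn l (X (u l)).
Proof.
move=> bu; have [k kE] := backward_orbitD l r bu.
by rewrite addnC DnD (coord_iter C) addnC kE (Dn_coord_int L C).
Qed.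

Let dX n : 0 < dR ^+ n := dX_gt0 L n.

(** If two iterates of the pull-back overlap, pushing the later one onto the arc gives an iterate
    that meets the arc at a time [a] when the orbit of [w] is outside. That iterate contains an end
    of the arc, whose image after [r - a] more steps falls inside, against niceness. *)
Lemma pull_back_disjoint c f c' f' w r (k : int) : f <= c + 1 -> nice_arc c f ->
  dR ^+ r * c' = c + k%:~R -> dR ^+ r * f' = f + k%:~R -> c' < w < f' ->
  (forall a, (0 < a < r)%N -> ~ in_arc c f (dR ^+ a * w)) ->
  disjoint_orbit d r c' f'.
Proof.
move=> fc1 nice cE fE /andP[cw wf] out.
have X1 m : 1 <= dR ^+ m by apply: exprn_ege1; have := dR_ge2 L; lra.
have short i : (i < r)%N -> dR ^+ i * f' - dR ^+ i * c' <= 1.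
  move=> ir; have -> : dR ^+ i * f' - dR ^+ i * c' = dR ^+ i * (f' - c') by ring.
  have h : dR ^+ (r - i) * (dR ^+ i * (f' - c')) <= 1.
    by rewrite mulrA -exprD subnK ?(ltnW ir)// mulrBr cE fE; lra.
  apply: le_trans h; rewrite ler_peMl // mulr_ge0 ?subr_ge0 ?(ltW (dX _))//; lra.
have core i j (q : int) : (i < j)%N -> (j < r)%N -> dR ^+ j * c' + q%:~R < dR ^+ i * f' ->
    dR ^+ i * c' < dR ^+ j * f' + q%:~R -> False.
  move=> ij jr h1 h2; pose a := (i + (r - j))%N; pose s := (j - i)%N.
  have aR : (0 < a < r)%N by rewrite /a; lia.
  have sa : (s + a = r)%N by rewrite /s /a; lia.
  have ra : (r - j + i = a)%N by rewrite /a addnC.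
  have rj : (r - j + j = r)%N by rewrite subnK // ltnW.
  have [K KE] := dX_int R d (r - j) q; pose K' := k + K.
  have {h1}h1 : c < dR ^+ a * f' - K'%:~R.
    move: h1; rewrite -(ltr_pM2l (dX (r - j))) mulrDr KE !mulrA -!exprD rj ra cE intrD; lra.
  have {h2}h2 : dR ^+ a * c' - K'%:~R < f.
    move: h2; rewrite -(ltr_pM2l (dX (r - j))) mulrDr KE !mulrA -!exprD rj ra fE intrD; lra.
  have [K2 K2E] := dX_int R d s K'.
  have scale x : dR ^+ s * (dR ^+ a * x - K'%:~R) = dR ^+ r * x - K2%:~R.
    by rewrite mulrBr K2E mulrA -exprD sa.
  have w1 : dR ^+ a * c' < dR ^+ a * w by rewrite ltr_pM2l.
  have w2 : dR ^+ a * w < dR ^+ a * f' by rewrite ltr_pM2l.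
  have s0 : (0 < s)%N by rewrite subn_gt0.
  have [n1 n2] := nice s (K2 - k) s0.
  have : ~~ (c < dR ^+ a * w + (- K')%:~R < f).
    by apply/negP => h; apply: (out a aR); exists (- K').
  rewrite negb_and -!leNgt mulrNz => /orP[] pc.
    have g1 : dR ^+ s * (dR ^+ a * c' - K'%:~R) < dR ^+ s * c by rewrite ltr_pM2l //; lra.
    have g2 : dR ^+ s * c < dR ^+ s * (dR ^+ a * f' - K'%:~R) by rewrite ltr_pM2l.
    move: g1 g2; rewrite !scale cE fE => g1 g2.
    by move/negP: n1; apply; rewrite intrB; apply/andP; split; lra.
  have g1 : dR ^+ s * (dR ^+ a * c' - K'%:~R) < dR ^+ s * f by rewrite ltr_pM2l.
  have g2 : dR ^+ s * f < dR ^+ s * (dR ^+ a * f' - K'%:~R) by rewrite ltr_pM2l //; lra.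
  move: g1 g2; rewrite !scale cE fE => g1 g2.
  by move/negP: n2; apply; rewrite intrB; apply/andP; split; lra.
move=> i j q ir jr ijq; apply: contrapT => /not_orP[/negP + /negP]; rewrite -!ltNge => h1 h2.
have [ij|ji|ij] := ltngtP i j.
- exact: core ij jr h1 h2.
- by apply: (core j i (- q)) => //; rewrite mulrNz; lra.
move: ijq; rewrite ij eqxx /= in h1 h2 *; have := short _ jr.
rewrite neq_lt => sh /orP[q0|q0].
  have : (q%:~R : R) <= -1 by rewrite -[-1]/((-1)%:~R) ler_int; lia.
  by lra.
have : 1 <= (q%:~R : R) by rewrite ler1z; lia.
by lra.
Qed.

Definition bounded_growth (u : nat -> R) (B : R) := forall m, Dn m (X (u m)) <= B.

(* If all returns of the backward orbit to the arc took a long time, each of them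
   would double the derivative. *)
Lemma short_return c f t Lb r0 u B l0 :
  c < f -> f <= c + 1 -> nice_arc c f -> disjoint_orbit d t c f -> dR ^+ t * (f - c) <= 1 ->
  0 < Lb -> Lb <= X (dR ^+ t * f) - X (dR ^+ t * c) ->
  (forall w, X (w + dR ^- r0) - X w <= Lb / (expR V * expR V * 2)) ->
  backward_orbit u -> bounded_growth u B -> in_arc c f (u l0) ->
  exists l r, [/\ (l0 <= l)%N, (0 < r < r0)%N, in_arc c f (u l) & in_arc c f (u (l + r)%N)].
Proof.
move=> cf fc1 nice dis tlen Lb0 LbX Xr0 bu bB inl0; apply: contrapT => nolr.
have eV : 0 < expR V by exact: expR_gt0.
have Xcf : 0 < X f - X c by rewrite subr_gt0 (coord_ltE C).
have far l r : (l0 <= l)%N -> in_arc c f (u l) -> (0 < r)%N -> in_arc c f (u (l + r)%N) -> (r0 <= r)%N.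
  move=> ll il r_gt0 ilr; rewrite leqNgt; apply/negP => rr0; apply: nolr.
  by exists l, r; rewrite r_gt0.
pose pc r (k : int) : R := (c + k%:~R) / dR ^+ r; pose pf r (k : int) : R := (f + k%:~R) / dR ^+ r.
have pcE r k : dR ^+ r * pc r k = c + k%:~R by rewrite mulrC divfK // gt_eqF.
have pfE r k : dR ^+ r * pf r k = f + k%:~R by rewrite mulrC divfK // gt_eqF.
(* Used for a first return and, when there is none, for arbitrarily long times: in both cases the
   arc is pulled back with distortion at most [expR V]. *)
have ret l r : in_arc c f (u l) -> (forall s, (0 < s < r)%N -> ~ in_arc c f (u (l + s)%N)) ->
    exists k, pc r k < u (l + r)%N < pf r k /\
    X f - X c <= expR V * Dn r (X (u (l + r)%N)) * (X (pf r k) - X (pc r k)).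
  move=> [k1 kin] out; have [k2 k2E] := backward_orbitD l r bu.
  pose k := k2 - k1; exists k.
  have wr : pc r k < u (l + r)%N < pf r k.
    by rewrite -(ltr_pM2l (dX r)) pcE -[X in _ && X](ltr_pM2l (dX r)) pfE k2E /k intrB; lra.
  split => //; have wr' : pc r k <= u (l + r)%N <= pf r k by case/andP: wr => /ltW -> /ltW ->.
  have dis' : disjoint_orbit d r (pc r k) (pf r k).
    apply: (pull_back_disjoint fc1 nice (pcE r k) (pfE r k) wr) => a /andP[a0 ar].
    have [k3 k3E] := backward_orbitD (l + (r - a)) a bu.
    have E : (l + (r - a) + a = l + r)%N by rewrite -addnA subnK // ltnW.
    rewrite E in k3E; rewrite k3E in_arc_int; apply: out.
    by rewrite subn_gt0 ar ltn_subrL a0 (ltn_trans a0 ar).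
  have [g _] := coord_growth L C wr' dis'.
  by move: g; rewrite pcE pfE !(coord_int C) opprD addrACA subrr addr0.
have step l : (l0 <= l)%N -> in_arc c f (u l) ->
    exists2 l', (l < l')%N /\ in_arc c f (u l') & 2 * Dn l (X (u l)) <= Dn l' (X (u l')).
  move=> ll il; have Dl := Dn_gt0 L l (X (u l)).
  have [ex|nex] := pselect (exists r, (0 < r)%N && `[< in_arc c f (u (l + r)%N) >]).
    case: (ex_minnP ex) => r /andP[r_gt0 /asboolP ir] rmin.
    have out s : (0 < s < r)%N -> ~ in_arc c f (u (l + s)%N).
      move=> /andP[s0 sr] is_; have := rmin s.
      by rewrite s0 (asboolT is_) leqNgt sr => /(_ isT).
    have [k [/andP[kw1 kw2] g]] := ret l r il out.
    have rr := far l r ll il r_gt0 ir.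
    exists (l + r)%N; first by rewrite -[X in (X < _)%N]addn0 ltn_add2l.
    rewrite (backward_orbit_Dn _ _ bu) ler_pM2r //.
    case: ir => j /andP[j1 j2].
    have [J JE] := dX_int R d r j.
    
    (* The pull-back contains a point of the arc, hence by niceness lies inside it. *)
    have cle : c <= pc r k + j%:~R.
      rewrite leNgt; apply/negP => h; have := nice r (- (k + J)) r_gt0 => -[/negP + _]; apply.
      have h1 : dR ^+ r * (pc r k + j%:~R) < dR ^+ r * c by rewrite ltr_pM2l.
      have h2 : dR ^+ r * c < dR ^+ r * (pf r k + j%:~R) by rewrite ltr_pM2l //; lra.
      move: h1 h2; rewrite !mulrDr pcE pfE JE mulrNz intrD => h1 h2.
      by apply/andP; split; lra.
    have fge : pf r k + j%:~R <= f.
      rewrite leNgt; apply/negP => h; have := nice r (- (k + J)) r_gt0 => -[_ /negP]; apply.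
      have h1 : dR ^+ r * (pc r k + j%:~R) < dR ^+ r * f by rewrite ltr_pM2l //; lra.
      have h2 : dR ^+ r * f < dR ^+ r * (pf r k + j%:~R) by rewrite ltr_pM2l.
      move: h1 h2; rewrite !mulrDr pcE pfE JE mulrNz intrD => h1 h2.
      by apply/andP; split; lra.
    have pp : X (pf r k) - X (pc r k) = X (pf r k + j%:~R) - X (pc r k + j%:~R).
      by rewrite !(coord_int C); lra.
    move: cle fge pp; set c2 := pc r k + _; set f2 := pf r k + _ => cle fge pp.
    have cf2 : c2 < f2 by rewrite /c2 /f2; lra.
    have Xcf2 : X c2 <= X f2 by rewrite (coord_leE C) ltW.
    have [p /andP[p1 p2] pE] := MVTle (iter_derive L t) Xcf2.
    have {p1 p2}pin : X c <= p <= X f.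
      have cX : X c <= X c2 by rewrite (coord_leE C).
      have fX : X f2 <= X f by rewrite (coord_leE C).
      by apply/andP; split; [exact: le_trans cX p1|exact: le_trans p2 fX].
    have [g2 _] := growth L pin (disjoint_orbit_coord C dis).
    move: pE g2; rewrite !(coord_iter C) => pE g2.
    (* The image of the pull-back after [t] steps has parameter length at most [d^-r0]. In the
       bound, one [expR V] is the distortion of the [t] steps, the other that of the return, and 2
       is the gain. *)
    have small : X (dR ^+ t * f2) - X (dR ^+ t * c2) <= Lb / (expR V * expR V * 2).
      apply: le_trans (Xr0 (dR ^+ t * c2)); rewrite lerD2r (coord_leE C) -lerBlDl -mulrBr.
      have -> : f2 - c2 = (f - c) / dR ^+ r by rewrite /f2 /c2 /pf /pc; field; rewrite gt_eqF.
      rewrite mulrA; apply: (@le_trans _ _ (1 / dR ^+ r)); first by rewrite ler_pM2r ?invr_gt0.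
      by rewrite mul1r lef_pV2 ?posrE // ler_eXn2l //; have := dR_ge2 L; lra.
    have DP := Dn_gt0 L t p.
    rewrite pp in g; move: g g2 small pE; set E := expR V; set A := X f2 - X c2; set P := Dn t p.
    set G := X f - X c; set D := Dn r _ => g g2 small pE; rewrite pE in small.
    have D0 : 0 < D by exact: Dn_gt0 L _ _.
    rewrite ler_pdivlMr ?mulr_gt0// in small.
    have h1 : A * (2 * E) <= G.
      rewrite -(ler_pM2l (mulr_gt0 DP eV)) -/E.
      have -> : P * E * (A * (2 * E)) = P * A * (E * E * 2) by ring.
      by apply: le_trans small _; apply: le_trans LbX _; rewrite [P * E]mulrC.
    rewrite -(ler_pM2r Xcf) -/G; have := ler_wpM2l (ltW D0) h1.
    by move: g; clear; nra.
  (* Without a further return the pull-backs shrink to points while their images keep the length of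
     the arc, so the derivatives exceed [B]. *)
  exfalso; set Dl0 := Dn l (X (u l)) in Dl.
  pose M := (`|B| + 1) / Dl0.
  have M0 : 0 < M by rewrite divr_gt0 // ltr_wpDl.
  have [dl dl0 dlP] := coord_unif C (divr_gt0 Xcf (mulr_gt0 eV M0)).
  pose r := (Num.truncn (1 / dl)).+1.
  have rdl : (f - c) / dR ^+ r <= dl.
    rewrite ler_pdivrMr // [leRHS]mulrC -ler_pdivrMr //.
    apply: le_trans (dX_ge L r); apply: le_trans (ltW (truncnS_gt _)).
    by rewrite ler_pM2r ?invr_gt0 // lerBlDl.
  have out s : (0 < s < r)%N -> ~ in_arc c f (u (l + s)%N).
    by move=> /andP[s0 _] is_; apply: nex; exists s; rewrite s0; apply/asboolP.
  have [k [_ g]] := ret l r il out.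
  have := bB (l + r)%N; rewrite (backward_orbit_Dn _ _ bu) -/Dl0.
  have D0 : 0 < Dn r (X (u (l + r)%N)) by exact: Dn_gt0 L _ _.
  have := dlP (pc r k); have : X (pf r k) <= X (pc r k + dl).
    rewrite (coord_leE C) -lerBlDl (_ : pf r k - pc r k = (f - c) / dR ^+ r) //.
    by rewrite /pf /pc; field; rewrite gt_eqF.
  move: g D0; set D := Dn r _; set G := X f - X c; move: (X (pf r k)) (X (pc r k)) (X _) => a b a' g D0 h1 h2 h3.
  have h4 : G <= expR V * D * (G / (expR V * M)).
    by apply: le_trans g _; rewrite ler_pM2l ?mulr_gt0//; lra.
  have h5 : M <= D.
    move: h4; rewrite (_ : _ * (G / _) = G * (D / M)); last by field; rewrite !gt_eqF.
    by rewrite ler_pMr // ler_pdivlMr // mul1r.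
  have := ler_wpM2r (ltW Dl) h5; rewrite /M divfK ?gt_eqF // => h6.
  by have := ler_norm B; lra.
have A0 := Dn_gt0 L l0 (X (u l0)).
have grow n : exists2 l, (l0 <= l)%N /\ in_arc c f (u l) & 2 ^+ n * Dn l0 (X (u l0)) <= Dn l (X (u l)).
  elim: n => [|n [l [ll il] IH]]; first by exists l0; rewrite ?expr0 ?mul1r.
  have [l' [ll' il'] h] := step l ll il; exists l'; first by split => //; exact: leq_trans ll (ltnW ll').
  by apply: le_trans h; rewrite exprS -mulrA ler_pM2l.
have [l _] := grow (Num.truncn (B / Dn l0 (X (u l0)))).+1.
apply/negP; rewrite -ltNge; apply: le_lt_trans (bB l) _; rewrite -ltr_pdivrMr //.
apply: lt_le_trans (truncnS_gt _) _.
move: (_.+1) => n; elim: n => [|n IH]; first by rewrite expr0.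
have : 1 <= (2 : R) ^+ n by apply: exprn_ege1; lra.
by rewrite -natr1 exprS; lra.
Qed.

End returns.

(** * An arc avoided by a backward orbit of bounded growth *)

Section gaps.
Variables (R : realType) (d : nat) (H DH v : R -> R) (V : R).
Hypothesis L : BV_lift d H DH v V.
Local Notation Dn := (iter_deriv H DH).
Local Notation dR := (d%:R : R).
Variable X : R -> R.
Hypothesis C : linear_coord d H X.
Variables (u : nat -> R) (B : R).
Hypothesis bu : backward_orbit d u.
Hypothesis bB : bounded_growth H DH X u B.

Let dX n : 0 < dR ^+ n := dX_gt0 L n.

Lemma coord_unif_exp e : 0 < e -> exists r0, forall w, X (w + dR ^- r0) - X w <= e.
Proof.
move=> e0; have [dl dl0 dlP] := coord_unif C e0; exists (Num.truncn (1 / dl)).+1 => w.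
apply: le_trans (dlP w); rewrite lerD2r (coord_leE C) lerD2l.
rewrite -[leLHS]mul1r ler_pdivrMr // [leRHS]mulrC -ler_pdivrMr //.
by apply: le_trans (dX_ge L _); exact: ltW (truncnS_gt _).
Qed.

Let not_in_arc c f y (k : int) : dR^-1 <= c -> f <= 1 -> 0 <= y <= dR^-1 -> ~~ (c < y + k%:~R < f).
Proof.
move=> dc f1 /andP[y0 yd]; rewrite negb_and -!leNgt.
by apply/orP; have [] := int_le0_ge1 R k; [left|right]; lra.
Qed.

Let dX_pred n : (0 < n)%N -> dR ^+ n * dR^-1 = (d%:Z ^+ n.-1)%:~R.
Proof. by case: n => // n _; rewrite rmorphXn exprSr mulfK ?gt_eqF ?(dR_gt0 L). Qed.

Let expand n i : exists (k : int) y, [/\ dR ^+ n * dR ^- i = k%:~R + y, 0 <= y, y <= dR ^+ n * dR ^- i &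
   y <= dR^-1].
Proof.
have d0 := dR_gt0 L.
have [ni|ni] := leqP i n.
  exists (d%:Z ^+ (n - i)), 0; split => //; rewrite ?addr0 ?invr_ge0 ?(ltW d0) //.
  by rewrite rmorphXn /= -exprB // unitfE gt_eqF.
have h : 0 < dR ^+ n * dR ^- i by rewrite mulr_gt0 ?invr_gt0.
exists 0, (dR ^+ n * dR ^- i); split; [by rewrite add0r|exact: ltW|by []|].
rewrite ler_pdivrMr // -(ler_pM2l d0) mulrA divff ?gt_eqF // mul1r -exprS.
by rewrite ler_eXn2l //; have := dR_ge2 L; lra.
Qed.

(* Near the nonperiodic preimage [1/d] of the fixed point [0], the arcs below are
   mapped to the fixed arc [(d^-2, d^-1)] with bounded distortion, and they return
   to themselves only after a long time. *)
Lemma avoided_arc : exists c f, c < f /\ forall m, ~ in_arc c f (u m).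
Proof.
have d0 := dR_gt0 L; have dge := dR_ge2 L.
have i1 : dR^-1 <= 1 / 2 by rewrite -[_^-1]mul1r ler_pM2l // lef_pV2 ?posrE.
have i0 : 0 < dR^-1 by rewrite invr_gt0.
have i2 : dR ^- 2 = dR^-1 * dR^-1 by rewrite expr2 invfM.
pose Lb := X dR^-1 - X (dR ^- 2).
have Lb0 : 0 < Lb by rewrite subr_gt0 (coord_ltE C) i2 gtr_pMl //; lra.
have E0 : 0 < expR V * expR V * 2 by rewrite !mulr_gt0 ?expR_gt0.
have [j jP] := coord_unif_exp (divr_gt0 Lb0 E0).
(* Modulo 1, the image of the arc after [a] steps lies in [(0, d^-2]] for [0 < a <= j], to the left
   of the arc, and is exactly [(d^-2, d^-1)] for [a = j.+1]. So a return takes more than [j] steps,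
   whereas the large size [Lb] is the same for all [j]. *)
pose c := dR^-1 + dR ^- j.+3; pose f := dR^-1 + dR ^- j.+2.
have dinv n : dR ^- n.+1 = dR^-1 * dR ^- n by rewrite exprS invfM.
have ji0 : 0 < dR ^- j by rewrite invr_gt0.
have ji1 : dR ^- j <= 1 by rewrite invf_le1 // exprn_ege1; lra.
have cf : c < f by rewrite ltrD2l [ltLHS]dinv gtr_pMl ?invr_gt0 //; lra.
exists c, f; split => // m inm.
have c1 : dR^-1 <= c by rewrite lerDl ltW // invr_gt0.
have J2 : dR ^- j.+2 <= 1 / 4.
  by rewrite !dinv mulrA; have := mulr_ge0 (ltW i0) (ltW i0); nra.
have f1 : f <= 1 by rewrite /f; lra.
have orb n i : (0 < n)%N -> exists (k : int) y, [/\ dR ^+ n * (dR^-1 + dR ^- i) = k%:~R + y,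
    0 <= y, y <= dR ^+ n * dR ^- i & y <= dR^-1].
  case: n => // n _; have [k [y [E y0 y1 y2]]] := expand n.+1 i.
  exists (d%:Z ^+ n + k), y; split=> //; rewrite mulrDr E intrD rmorphXn /= addrA.
  by rewrite exprSr mulfK ?gt_eqF.
have nice : nice_arc d c f.
  move=> n k n0; split.
    have [k' [y [-> y0 _ y1]]] := orb n j.+3 n0; rewrite addrC addrA -intrD addrC.
    by apply: not_in_arc => //; rewrite y0.
  have [k' [y [-> y0 _ y1]]] := orb n j.+2 n0; rewrite addrC addrA -intrD addrC.
  by apply: not_in_arc => //; rewrite y0.
have tE n : dR ^+ j.+1 * (dR^-1 + dR ^- (j.+1 + n)) = dR ^- n + (d%:Z ^+ j)%:~R.
  rewrite mulrDr rmorphXn /= addrC; congr (_ + _); last by rewrite exprSr mulfK ?gt_eqF.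
  by rewrite exprD invfM mulrA divff ?mul1r ?gt_eqF.
have tc : dR ^+ j.+1 * c = dR ^- 2 + (d%:Z ^+ j)%:~R by rewrite -tE addn2.
have tf : dR ^+ j.+1 * f = dR ^- 1 + (d%:Z ^+ j)%:~R by rewrite -tE addn1.
have dis : disjoint_orbit d j.+1 c f.
  have wcf : c < (c + f) / 2 < f by apply/andP; split; lra.
  have niceM : nice_arc d (dR ^- 2) (dR ^- 1).
    move=> n k n0; rewrite expr1.
    have nm y : dR^-1 <= y -> (exists q : int, y = q%:~R) \/ y = dR^-1 -> ~~ (dR ^- 2 < y + k%:~R < dR^-1).
      move=> yd yE; apply/negP => /andP[h1 h2].
      have i20 : 0 < dR ^- 2 by rewrite invr_gt0.
      case: yE => [[q yE]|yE].
        by have := int_le0_ge1 R (q + k); rewrite intrD -yE; lra.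
      by have := int_le0_ge1 R (k + 1); rewrite intrD -[1%:~R]/(1 : R); lra.
    have dn1 : dR ^+ n * dR^-1 = dR ^+ n.-1 by case: n n0 => // n _; rewrite exprSr mulfK ?gt_eqF.
    have pge1 i : 1 <= dR ^+ i by apply: exprn_ege1; lra.
    have pint i : exists q : int, dR ^+ i = q%:~R by exists (d%:Z ^+ i); rewrite rmorphXn.
    split; apply: nm; rewrite ?i2 ?mulrA ?dn1; last 1 first.
    - by left.
    - by case: n.-1 => [|n']; rewrite ?mul1r // exprSr mulfK ?gt_eqF //; have := pge1 n'; lra.
    - case: n.-1 => [|n']; rewrite ?mul1r; [by right|left].
      by rewrite exprSr mulfK ?gt_eqF.
    - by have := pge1 n.-1; lra.
  apply: (pull_back_disjoint L _ niceM tc tf wcf); first by rewrite expr1 i2; nra.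
  move=> a /andP[a0 aj] [k].
  apply/negP; have wa1 : dR ^+ a * c < dR ^+ a * ((c + f) / 2) by rewrite ltr_pM2l //; lra.
  have wa2 : dR ^+ a * ((c + f) / 2) < dR ^+ a * f by rewrite ltr_pM2l //; lra.
  have ap := dX_pred a0.
  have a3 : 0 < dR ^+ a * dR ^- j.+3 by rewrite mulr_gt0 ?invr_gt0.
  have a2 : dR ^+ a * dR ^- j.+2 <= dR ^- 2.
    rewrite -addn2 exprD invfM mulrA ler_piMl ?invr_ge0 ?(ltW (dX 2)) //.
    rewrite ler_pdivrMr // mul1r ler_eXn2l //; lra.
  move: wa1 wa2; rewrite !mulrDr ap; set w := _ * (_ / _); set K := (d%:Z ^+ a.-1).
  move=> wa1 wa2; rewrite expr1 negb_and -!leNgt.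
  have kK := int_le0_ge1 R (k + K); rewrite intrD in kK.
  by apply/orP; case: kK => kK; [left|right]; lra.
have tlen : dR ^+ j.+1 * (f - c) <= 1 by rewrite mulrBr tc tf expr1 i2; nra.
have LbX : Lb <= X (dR ^+ j.+1 * f) - X (dR ^+ j.+1 * c).
  by rewrite tc tf !(coord_int C) expr1 /Lb; lra.
have fc1 : f <= c + 1 by lra.
have [l [r [_ /andP[r0 rj] [k1 in1] [k2 in2]]]] :=
  short_return L C cf fc1 nice dis tlen Lb0 LbX jP bu bB inm.
have [k3 k3E] := backward_orbitD l r bu.
(* The point [u l] is, modulo 1, the image after [r < j] steps of a later point of the arc; hence it
   lies in [[0, d^-1]], off the arc. *)
move: in1; apply/negP; rewrite (_ : u l = dR ^+ r * (u (l + r)%N + k2%:~R) - dR ^+ r * k2%:~R - k3%:~R); last first.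
  by rewrite mulrDr k3E; lra.
move: in2; move: (_ + k2%:~R) => w /andP[w1 w2].
have wa1 : dR ^+ r * c < dR ^+ r * w by rewrite ltr_pM2l.
have wa2 : dR ^+ r * w < dR ^+ r * f by rewrite ltr_pM2l.
have rp := dX_pred r0.
have a3 : 0 < dR ^+ r * dR ^- j.+3 by rewrite mulr_gt0 ?invr_gt0.
have rj' := ltnW rj.
have d1 : 1 < dR by lra.
have a2 : dR ^+ r * dR ^- j.+2 <= dR ^- 2.
  rewrite -addn2 exprD invfM mulrA ler_piMl ?invr_ge0 ?(ltW (dX 2)) //.
  by rewrite ler_pdivrMr // mul1r ler_eXn2l.
have [K2 K2E] := dX_int R d r k2.
move: wa1 wa2; rewrite !mulrDr rp K2E; move: (_ * w) => z; set K := (d%:Z ^+ r.-1) => wa1 wa2.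
have -> : z - K2%:~R - k3%:~R + k1%:~R = (z - K%:~R) + (K - K2 - k3 + k1)%:~R.
  by rewrite !(intrD, mulrNz); ring.
apply: not_in_arc => //; apply/andP; split; first by lra.
by rewrite i2 in a2; nra.
Qed.

End gaps.

(** * Forward invariant sets that avoid an orbit *)

Section lattice.
Variable R : realType.

(** Discreteness makes the supremum attained. This provides the points of a set that are nearest to
    a given point. *)
Lemma lattice_max (q : R) (A : set R) : 0 < q -> (forall a, A a -> exists k : int, q * a = k%:~R) ->
  A !=set0 -> has_ubound A -> exists2 a, A a & forall b, A b -> b <= a.
Proof.
move=> q0 AZ An Au; have As : has_sup A by [].
have qi : 0 < q^-1 by rewrite invr_gt0.
have [a Aa ha] := sup_adherent qi As.
exists a => // b Ab; rewrite leNgt; apply/negP => ab.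
have [ka kaE] := AZ a Aa; have [kb kbE] := AZ b Ab.
have bs : b <= sup A by exact: ub_le_sup.
have := int_le0_ge1 R (kb - ka); rewrite intrB -kbE -kaE -mulrBr => -[].
  by rewrite pmulr_rle0 //; lra.
by rewrite mulrC -ler_pdivrMr // mul1r; lra.
Qed.

(* Finite forward invariant sets modulo integers, used for the end points of nice
   arcs: a point eventually mapped into [{0}] is not mapped into
   [{1/(d+1), -1/(d+1)}]. *)
Variable d : nat.
Hypothesis d2 : (2 <= d)%N.
Local Notation dR := (d%:R : R).

Record forward_set (P : R -> Prop) : Prop := ForwardSet {
  fwd_d : forall x, P x -> P (dR * x);
  fwd_int : forall x (k : int), P x -> P (x + k%:~R);
  fwd_N : forall x, P x -> P (- x);
  fwd_lattice : forall x, P x -> exists k : int, (dR + 1) * x = k%:~R;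
  fwd_dense : forall x, exists2 y, P y & x - 1 <= y < x }.

Lemma forward_set_avoiding e : exists2 P, forward_set P & forall n, ~ P (dR ^+ n * e).
Proof.
have dge : 2 <= dR by rewrite ler_nat.
have dZ : dR = d%:Z%:~R by [].
have dense (a : R) x : exists2 y, (exists k : int, y = a + k%:~R) & x - 1 <= y < x.
  exists (a + (- Num.floor (a - x) - 1)%:~R); first by exists (- Num.floor (a - x) - 1).
  by have := floor_itv (a - x); rewrite intrB mulrNz; lra.
have scale (x : R) (k : int) n : x = k%:~R -> dR ^+ n * x = (d%:Z ^+ n * k)%:~R.
  by move=> ->; rewrite rmorphM rmorphXn.
have [[n [k nk]]|no] := pselect (exists n (k : int), dR ^+ n * e = k%:~R); last first.
  exists (fun x => exists k : int, x = k%:~R); last by move=> n [k kE]; apply: no; exists n, k.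
  split.
  - by move=> x [k ->]; exists (d%:Z * k); rewrite intrM.
  - by move=> x k [j ->]; exists (j + k); rewrite intrD.
  - by move=> x [k ->]; exists (- k); rewrite mulrNz.
  - by move=> x [k ->]; exists ((d%:Z + 1) * k); rewrite intrM intrD.
  - by move=> x; have [y [k ->] h] := dense 0 x; exists (0 + k%:~R) => //; exists k; rewrite add0r.
(* Since [d] is [-1] modulo [d + 1], multiplication by [d] exchanges the classes of [1 / (d + 1)]
   and [- 1 / (d + 1)]. *)
exists (fun x => exists k : int, (dR + 1) * x = (dR + 1) * k%:~R + 1 \/ (dR + 1) * x = (dR + 1) * k%:~R - 1).
  split.
  - move=> x [z [] h].
      by exists (d%:Z * z + 1); right; rewrite intrD intrM mulrCA h; ring.
    by exists (d%:Z * z - 1); left; rewrite intrB intrM mulrCA h; ring.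
  - by move=> x y [z [] h]; exists (z + y); [left|right]; rewrite mulrDr h intrD; ring.
  - by move=> x [z [] h]; exists (- z); [right|left]; rewrite mulrN h mulrNz; ring.
  - by move=> x [z [] h]; [exists ((d%:Z + 1) * z + 1)|exists ((d%:Z + 1) * z - 1)];
       rewrite h (intrD, intrB) intrM intrD.
  - move=> x; have [y [z zE] h] := dense (dR + 1)^-1 x; exists y => //; exists z; left.
    by rewrite zE mulrDr divff ?gt_eqF //; lra.
(* Multiplying the relation for [d^m * e] by [d^n] would make [d + 1] a divisor of [d^n], to which
   it is coprime. *)
move=> m [j mj]; have e1 := scale _ _ m nk; rewrite mulrA -exprD in e1.
have dX1 : dR ^+ n = (d%:Z ^+ n)%:~R by rewrite rmorphXn.
have {mj}: exists q : int, (dR + 1) * q%:~R = dR ^+ n \/ (dR + 1) * q%:~R = - dR ^+ n.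
  exists (d%:Z ^+ m * k - d%:Z ^+ n * j); rewrite intrB -e1 intrM -dX1 addnC exprD -mulrA.
  by case: mj => mj; [left|right]; rewrite mulrBr mulrCA mj; ring.
move=> [q qE]; have {}qE : ((d.+1)%:Z %| d%:Z ^+ n)%Z.
  have E : (dR + 1) * q%:~R = (d.+1%:Z * q)%:~R by rewrite intrM -[d.+1%:~R]/(d.+1%:R) -natr1.
  rewrite E dX1 -mulrNz in qE; case: qE => /eqP; rewrite eqr_int => /eqP qE.
    by apply/dvdzP; exists q; rewrite mulrC.
  by apply/dvdzP; exists (- q); rewrite mulNr mulrC qE opprK.
have : coprimez d.+1%:Z (d%:Z ^+ n) by rewrite coprimezXr // /coprimez /gcdz /= (eqP (coprimeSn d)).
rewrite coprimezE => cop; move: qE; rewrite dvdzE => dv.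
have := coprime_dvdr dv cop; rewrite /coprime gcdnn => /eqP h.
by move: h d2; case: d.
Qed.

End lattice.

(** * Ends of gaps are periodic *)

Section gap_ends.
Variables (R : realType) (d : nat) (H DH v : R -> R) (V : R).
Hypothesis L : BV_lift d H DH v V.
Local Notation Dn := (iter_deriv H DH).
Local Notation dR := (d%:R : R).
Variable X : R -> R.
Hypothesis C : linear_coord d H X.
Variables (u : nat -> R) (B : R).
Hypothesis bu : backward_orbit d u.
Hypothesis bB : bounded_growth H DH X u B.

Let dX n : 0 < dR ^+ n := dX_gt0 L n.

(* [e] is the right end of a gap of the set of limit points of [u]. *)
Definition gap_end (e : R) := exists g, [/\ 0 < g,
  forall ep, 0 < ep -> exists m0, forall m, (m0 <= m)%N -> ~ in_arc (e - g) (e - ep) (u m) &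
  forall ep m0, 0 < ep -> exists2 m, (m0 <= m)%N & in_arc (e - ep) (e + ep) (u m)].

(** The avoided arc is extended to the right as long as it is eventually avoided; this stops because
    an arc longer than 1 contains a representative of every point. *)
Lemma gap_end_exists : exists e, gap_end e.
Proof.
have [c [f [cf avoid]]] := avoided_arc L C bu bB.
pose S := [set q | exists m0, forall m, (m0 <= m)%N -> ~ in_arc c q (u m)].
have Sf : S f by exists 0%N => m _; exact: avoid.
have Sub q : S q -> q <= c + 2.
  move=> [m0 m0P]; rewrite leNgt; apply/negP => h; apply: (m0P m0 (leqnn _)).
  exists (- Num.floor (u m0 - c - 1)).
  by have := floor_itv (u m0 - c - 1); rewrite mulrNz; lra.
have Ss : has_sup S by split; [exists f|exists (c + 2) => q /Sub].
have fs : f <= sup S by apply: (ub_le_sup (proj2 Ss)).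
have near ep : 0 < ep -> exists m0, forall m, (m0 <= m)%N -> ~ in_arc c (sup S - ep) (u m).
  move=> ep0; have [q [m0 m0P] qs] := sup_adherent ep0 Ss.
  exists m0 => m /m0P; apply: contra_not => -[k h]; exists k; lra.
exists (sup S), (sup S - c); split; first by rewrite subr_gt0; lra.
  by move=> ep ep0; rewrite subKr; exact: near.
move=> ep m0 ep0; apply: contrapT => no.
have e2 : 0 < ep / 2 by lra.
have [m1 m1P] := near _ e2.
have : S (sup S + ep).
  exists (maxn m0 m1) => m; rewrite geq_max => /andP[m0m m1m] [k /andP[k1 k2]].
  have [h|h] := ltP (u m + k%:~R) (sup S - ep / 2); first by apply: (m1P m m1m); exists k; lra.
  by apply: no; exists m => //; exists k; lra.
by move/(ub_le_sup (proj2 Ss)); lra.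
Qed.

(** Around a nonperiodic [e] there is a nice arc [(c, f)] with [c] in the gap and [f] very close to
    [e], so that late visits to the arc are all close to [e]. A short return then moves [e] only
    slightly in a bounded time, less than nonperiodicity allows. *)
Lemma gap_end_periodic e : gap_end e -> exists2 r, (0 < r)%N & exists k : int, dR ^+ r * e = e + k%:~R.
Proof.
move=> [g [g0 avoid visit]]; apply: contrapT => nper.
have dge := dR_ge2 L; have d2 := lift_deg L.
have [P [Pd Pint PN Plat Pdense] Pe] := forward_set_avoiding d2 e.
have PdX n x : P x -> P (dR ^+ n * x).
  by move=> Px; elim: n => [|n IH]; rewrite ?mul1r // exprS -mulrA; apply: Pd.
(* The increasing sets [d^-n P] have points within [d^-n] on each side of [e] and never contain [e];
   the nearest ones serve as ends of the arc. *)
pose Q n := [set x | P (dR ^+ n * x)].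
have QS m n : (m <= n)%N -> Q m `<=` Q n.
  by move=> mn x; rewrite /Q /= -(subnK mn) exprD -mulrA; exact: PdX.
have dd n : 0 < (dR + 1) * dR ^+ n by rewrite mulr_gt0 //; lra.
have Qlat n a : Q n a -> exists k : int, (dR + 1) * dR ^+ n * a = k%:~R.
  by move=> /Plat; rewrite mulrA.
have Qbelow n : exists2 c, Q n c /\ e - dR ^- n <= c < e & forall y, Q n y -> y < e -> y <= c.
  have [y Py ye] := Pdense (dR ^+ n * e).
  have [|||c [Qc ce] cmax] := @lattice_max R _ [set x | Q n x /\ x < e] (dd n).
  - by move=> a [/Qlat].
  - exists (y / dR ^+ n); split; first by rewrite /Q /= mulrC divfK ?gt_eqF.
    by rewrite /= ltr_pdivrMr // mulrC; lra.
  - by exists e => x [_ /ltW].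
  exists c; last by move=> z Qz ze; exact: cmax.
  split=> //; rewrite ce andbT; apply: le_trans (cmax (y / dR ^+ n) _).
    by rewrite lerBlDr -[X in _ + X]mul1r -mulrDl ler_pdivlMr // mulrC; lra.
  split; first by rewrite /Q /= mulrC divfK ?gt_eqF.
  by rewrite /= ltr_pdivrMr // mulrC; lra.
have Qabove n : exists2 f, Q n f /\ e < f <= e + dR ^- n & forall y, Q n y -> e < y -> f <= y.
  have [y Py ye] := Pdense (- (dR ^+ n * e)).
  have Qy : Q n (- (y / dR ^+ n)) by rewrite /Q /= mulrN mulrC divfK ?gt_eqF //; exact: PN.
  have ey : e < - (y / dR ^+ n) by rewrite ltrNr ltr_pdivrMr // mulNr mulrC; lra.
  have [|||c [Qc ce] cmax] := @lattice_max R _ [set x | Q n (- x) /\ e < - x] (dd n).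
  - by move=> a [/Qlat[k kE] _]; exists (- k); rewrite mulrNz -kE mulrN opprK.
  - by exists (y / dR ^+ n).
  - by exists (- e) => x [_]; rewrite ltrNr => /ltW.
  exists (- c); last by move=> z Qz ez; rewrite lerNl; apply: cmax; rewrite /= !opprK.
  split=> //; rewrite ce /= lerNl; apply: le_trans (cmax (y / dR ^+ n) _); last by [].
  by rewrite opprD lerBlDr -[X in _ + X]mul1r -mulrDl ler_pdivlMr // mulNr mulrC; lra.
have small ep : 0 < ep -> exists K, forall n, (K <= n)%N -> dR ^- n <= ep.
  move=> ep0; exists (Num.truncn (1 / ep)).+1 => n Kn.
  rewrite -[leLHS]mul1r ler_pdivrMr // [leRHS]mulrC -ler_pdivrMr //.
  apply: le_trans (dX_ge L _); apply: le_trans (ltW (truncnS_gt _)) _.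
  by rewrite ler_nat.
have [|K KP] := small (Num.min (g / 2) (1 / 2)).
  by rewrite lt_min; apply/andP; split; lra.
have := KP K (leqnn K); rewrite le_min => /andP[Kg Kh].
have [c [Qc /andP[c1 ce]] cmax] := Qbelow K.
(* The size of [(c, e)] is used instead of that of [(c, f)]: [r0] has to be fixed before [f], whose
   distance to [e] depends on [r0]. *)
have Lb0 : 0 < X e - X c by rewrite subr_gt0 (coord_ltE C).
have E0 : 0 < expR V * expR V * 2 by rewrite !mulr_gt0 ?expR_gt0.
have [r0 r0P] := coord_unif_exp L C (divr_gt0 Lb0 E0).
have [eta eta0 etaP] : exists2 eta, 0 < eta &
    forall r (k : int), (0 < r < r0)%N -> eta <= `|dR ^+ r * e - e - k%:~R|.
  elim: r0 {r0P} => [|n [eta eta0 etaP]]; first by exists 1 => // r k; rewrite andbC.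
  have [n0|n0] := posnP n.
    by exists eta => // r k; rewrite n0 ltnS leqn0 lt0n andNb.
  pose y := dR ^+ n * e - e.
  have yf : (Num.floor y)%:~R != y.
    by apply/eqP => yf; apply: nper; exists n => //; exists (Num.floor y); rewrite yf /y; ring.
  have := floor_itv y => /andP[y1 y2]; have {}y1 : (Num.floor y)%:~R < y by rewrite lt_neqAle yf.
  rewrite intrD in y2; exists (Num.min eta (Num.min (y - (Num.floor y)%:~R) ((Num.floor y)%:~R + 1 - y))).
    by rewrite !lt_min eta0 /=; apply/andP; split; lra.
  move=> r k /andP[r_gt0]; rewrite ltnS leq_eqVlt => /orP[/eqP ->|rn]; last first.
    by rewrite ge_min etaP // r_gt0.
  rewrite -/y ge_min; apply/orP; right; rewrite ge_min.
  have := int_le0_ge1 R (k - Num.floor y); rewrite intrB => -[h|h].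
    by apply/orP; left; apply: le_trans (ler_norm _); lra.
  by apply/orP; right; rewrite distrC; apply: le_trans (ler_norm _); lra.
have d1 : 1 < dR by lra.
(* Two orbit points within [ep] of [e] and [r < r0] steps apart show that [d^r] moves [e] modulo 1
   by at most [ep * (d^r0 + 1)], which must stay below [eta]. *)
pose ep := Num.min (eta / (2 * (dR ^+ r0 + 1))) (g / 2).
have d01 : 0 < 2 * (dR ^+ r0 + 1) by have := dX r0; lra.
have ep0 : 0 < ep by rewrite lt_min divr_gt0 //=; lra.
have epeta : ep * (dR ^+ r0 + 1) < eta.
  have : ep <= eta / (2 * (dR ^+ r0 + 1)) by rewrite ge_min lexx.
  by rewrite ler_pdivlMr //; lra.
have [K2 K2P] := small _ ep0; pose K' := maxn K K2.
have K'ep : dR ^- K' <= ep by apply: K2P; rewrite leq_maxr.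
have KK' : (K <= K')%N by rewrite leq_maxl.
have := KP _ KK'; rewrite le_min => /andP[_ K'h].
have [f [Qf /andP[ef f1]] fmin] := Qabove K'.
have cf : c < f by lra.
have fc1 : f <= c + 1 by lra.
have Qorb n y m (k : int) : (m <= K + n)%N -> Q m y -> Q K (dR ^+ n * y + k%:~R).
  move=> mn Qy; rewrite /Q /= mulrDr mulrA -exprD.
  have [k' ->] := dX_int R d K k; apply: Pint.
  by rewrite -(subnK mn) exprD -mulrA; exact: PdX.
have Qorb' n y m (k : int) : (m <= K')%N -> Q m y -> Q K' (dR ^+ n * y + k%:~R).
  move=> mn Qy; rewrite /Q /= mulrDr mulrA -exprD.
  have [k' ->] := dX_int R d K' k; apply: Pint.
  by rewrite addnC -(subnK mn) addnA exprD -mulrA; exact: PdX.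
have nQe m : ~ Q m e by exact: Pe.
have noQ y : Q K' y -> c < y < f -> y < e /\ ~ Q K y.
  move=> Qy /andP[cy yf]; have [ye|ey|ye] := ltgtP y e.
  - by split=> // QKy; have := cmax y QKy ye; lra.
  - by have := fmin y Qy ey; lra.
  - by rewrite ye in Qy; have := nQe _ Qy.
(* The limit points of a backward orbit form a forward invariant set, so the orbit of [e] does not
   enter the gap. *)
have ebar n (k : int) : dR ^+ n * e + k%:~R < e -> dR ^+ n * e + k%:~R <= e - g.
  move=> ze; rewrite leNgt; apply/negP => gz; set z := _ + _ in ze gz.
  pose rho := Num.min (z - (e - g)) (e - z).
  have rho0 : 0 < rho by rewrite lt_min; apply/andP; split; lra.
  have r1 : rho <= z - (e - g) by rewrite ge_min lexx.
  have r2 : rho <= e - z by rewrite ge_min lexx orbT.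
  have [|m0 m0P] := avoid ((e - z - rho / 2)); first by lra.
  have [|m mm [j /andP[j1 j2]]] := visit (rho / 2 / dR ^+ n) (m0 + n)%N; first by rewrite divr_gt0 //; lra.
  apply: (m0P (m - n)%N); first by rewrite leq_subRL ?(leq_trans (leq_addl _ _) mm) // addnC.
  have nm : (n <= m)%N by exact: leq_trans (leq_addl _ _) mm.
  have [k3 k3E] := backward_orbitD (m - n) n bu; rewrite subnK // in k3E.
  have [J JE] := dX_int R d n j.
  have E : u (m - n)%N + (k3 + J + k)%:~R = dR ^+ n * (u m + j%:~R) + k%:~R.
    by rewrite mulrDr JE k3E !intrD; ring.
  exists (k3 + J + k); rewrite E.
  have s1 : dR ^+ n * (e - rho / 2 / dR ^+ n) < dR ^+ n * (u m + j%:~R) by rewrite ltr_pM2l.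
  have s2 : dR ^+ n * (u m + j%:~R) < dR ^+ n * (e + rho / 2 / dR ^+ n) by rewrite ltr_pM2l.
  have cancel : dR ^+ n * (rho / 2 / dR ^+ n) = rho / 2 by rewrite mulrC divfK ?gt_eqF.
  by move: s1 s2; rewrite mulrBr mulrDr cancel; rewrite /z in r1 r2 *; lra.
have nice : nice_arc d c f.
  move=> n k n0; split; apply/negP => in_.
    have [_] := noQ _ (Qorb' n c K k KK' Qc) in_.
    by apply; apply: Qorb Qc; rewrite leq_addr.
  (* An iterate of [f] inside the arc would be to the left of [e] and occur at a time [n < K' - K].
     It would then be within [d^-K <= g / 2] of the iterate of [e], which is beyond the gap, hence
     to the left of [c]. *)
  have [ye nQ] := noQ _ (Qorb' n f K' k (leqnn _) Qf) in_.
  apply: nQ; apply: (Qorb n f K') => //; rewrite leqNgt; apply/negP => nK.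
  have fe : dR ^+ n * e + k%:~R < dR ^+ n * f + k%:~R by rewrite ltrD2r ltr_pM2l.
  have := ebar n k (lt_trans fe ye) => h.
  have : dR ^+ n * (f - e) <= dR ^- K.
    apply: (@le_trans _ _ (dR ^+ n * dR ^- K')); first by rewrite ler_pM2l //; lra.
    rewrite ler_pdivrMr // mulrC ler_pdivlMr // -exprD ler_eXn2l // addnC.
    exact: ltnW.
  by rewrite mulrBr; case/andP: in_; lra.
have [m0 m0P] := avoid _ ep0.
have near m : (m0 <= m)%N -> in_arc c f (u m) -> exists k : int, `|u m + k%:~R - e| <= ep.
  move=> mm [k /andP[k1 k2]]; exists k; rewrite ler_norml; apply/andP; split; last by lra.
  by rewrite leNgt; apply/negP => h; apply: (m0P m mm); exists k; lra.
have [|l0 ml0 [k0 k0P]] := visit (Num.min (e - c) (f - e)) m0.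
  by rewrite lt_min; apply/andP; split; lra.
have inl0 : in_arc c f (u l0).
  have h1 : Num.min (e - c) (f - e) <= e - c by rewrite ge_min lexx.
  have h2 : Num.min (e - c) (f - e) <= f - e by rewrite ge_min lexx orbT.
  by exists k0; lra.
have dis : disjoint_orbit d 0 c f by move=> i j k; rewrite ltn0.
have tlen : dR ^+ 0 * (f - c) <= 1 by rewrite mul1r; lra.
have LbX : X e - X c <= X (dR ^+ 0 * f) - X (dR ^+ 0 * c).
  by rewrite !mul1r lerD2r (coord_leE C) ltW.
have [l [r [ll /andP[r_gt0 rr0] in1 in2]]] :=
  short_return L C cf fc1 nice dis tlen Lb0 LbX r0P bu bB inl0.
have [k1 k1P] := near l (leq_trans ml0 ll) in1.
have [k2 k2P] := near (l + r)%N (leq_trans ml0 (leq_trans ll (leq_addr _ _))) in2.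
have [k3 k3E] := backward_orbitD l r bu; have [J JE] := dX_int R d r k2.
have := etaP r (k3 + J - k1); rewrite r_gt0 rr0 => /(_ isT).
apply/negP; rewrite -ltNge; apply: le_lt_trans epeta.
have -> : dR ^+ r * e - e - (k3 + J - k1)%:~R =
    (u l + k1%:~R - e) - dR ^+ r * (u (l + r)%N + k2%:~R - e).
  by rewrite mulrBr mulrDr k3E JE intrB intrD; ring.
apply: le_trans (ler_normB _ _) _; rewrite normrM gtr0_norm // mulrDr mulr1 addrC.
rewrite lerD // [leRHS]mulrC; apply: ler_pM => //.
by rewrite ler_eXn2l // ltnW.
Qed.

End gap_ends.

Lemma le_expR_mul (R : realType) (a b t : R) : 0 < a -> 0 < b -> ln a - ln b <= t ->
  a <= expR t * b.
Proof.
move=> a0 b0 h; rewrite -[leLHS]lnK ?posrE // -[b]lnK ?posrE // -expRD ler_expR; lra.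
Qed.

(** * Backward orbits converging to a periodic point *)

Section nested.
Variables (R : realType) (d : nat) (H DH v : R -> R) (V : R).
Hypothesis L : BV_lift d H DH v V.
Local Notation Dn := (iter_deriv H DH).

Let W r x := \sum_(0 <= p < r) v (iter p H x).

Let W_le r x y : x <= y -> `|ln (Dn r x) - ln (Dn r y)| <= W r y - W r x.
Proof.
move=> xy; rewrite !(ln_Dn L) -!sumrB; apply: le_trans (ler_norm_sum _ _ _) _.
by apply: ler_sum => i _; apply: var_le L _ _ _; rewrite (iter_leE L).
Qed.

(** [W r] dominates the variation of [ln (Dn r)], so [Wt] bounds the distortion of all the iterates
    [j * r] at once, along the successive preimages [[a j, b j]] of the first arc. *)
Lemma nested_growth (a b : nat -> R) r (k : int) Wt :
  (forall j, a j <= b j) -> (forall j, iter r H (a j.+1) = a j + k%:~R) ->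
  (forall j, iter r H (b j.+1) = b j + k%:~R) ->
  (forall j, \sum_(0 <= i < j) (W r (b i.+1) - W r (a i.+1)) <= Wt) ->
  forall j p, a j <= p <= b j -> b 0%N - a 0%N <= expR Wt * Dn (j * r) p * (b j - a j).
Proof.
move=> ab aE bE Wsum.
have dist j y z : a j <= y <= b j -> a j <= z <= b j ->
    ln (Dn (j * r) y) - ln (Dn (j * r) z) <= \sum_(0 <= i < j) (W r (b i.+1) - W r (a i.+1)).
  elim: j y z => [|j IH] y z /andP[ay yb] /andP[az zb].
    by rewrite big_geq // !Dn0 subrr.
  have down x : a j.+1 <= x -> x <= b j.+1 -> a j <= iter r H x - k%:~R <= b j.
    by rewrite lerBrDr lerBlDr -aE -bE !(iter_leE L) => -> ->.
  have dn x : Dn (j * r) (iter r H x) = Dn (j * r) (iter r H x - k%:~R).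
    by rewrite -mulrNz (Dn_int L).
  rewrite mulSn !DnD !lnM ?posrE ?(Dn_gt0 L) // big_nat_recr //= !dn.
  have := IH _ _ (down _ ay yb) (down _ az zb).
  suff : ln (Dn r y) - ln (Dn r z) <= W r (b j.+1) - W r (a j.+1) by lra.
  have [yz|/ltW zy] := leP y z.
    have := W_le r yz; have := W_le r zb; have := W_le r ay; rewrite !ler_norml.
    move=> /andP[? ?] /andP[? ?] /andP[? ?]; lra.
  have := W_le r zy; have := W_le r yb; have := W_le r az; rewrite !ler_norml.
  move=> /andP[? ?] /andP[? ?] /andP[? ?]; lra.
have back j : exists K : int, iter (j * r) H (a j) = a 0%N + K%:~R /\ iter (j * r) H (b j) = b 0%N + K%:~R.
  elim: j => [|j [K [aK bK]]]; first by exists 0; rewrite !addr0.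
  have [k' k'E] := dX_int R d (j * r) k.
  exists (K + k'); rewrite mulSn addnC !iterD aE bE !(iter_int L) aK bK k'E intrD.
  by split; ring.
move=> j p apb; have [K [aK bK]] := back j.
have [c acb] := MVTle (iter_derive L (j * r)) (ab j); rewrite aK bK => E.
have -> : b 0%N - a 0%N = b 0%N + K%:~R - (a 0%N + K%:~R) by ring.
rewrite E ler_wpM2r ?subr_ge0 //.
by apply: le_expR_mul (le_trans (dist j c p acb apb) (Wsum j)); exact: Dn_gt0 L _ _.
Qed.

Variable X : R -> R.
Hypothesis C : linear_coord d H X.
Local Notation dR := (d%:R : R).

Let dX n : 0 < dR ^+ n := dX_gt0 L n.

Lemma coord_inj : injective X.
Proof. by move=> a b Xab; apply/eqP; have [/(coord_lt C)|/(coord_lt C)|//] := ltgtP a b; rewrite Xab ltxx. Qed.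

(** The points tend to [e] from one side, so the arcs between consecutive ones lie side by side:
    their variations telescope and distortion is bounded, even when the multiplier at [e] is 1.
    These arcs shrink to zero but are mapped onto the first one. *)
Lemma growth_to_periodic e r (k : int) s : (0 < r)%N -> dR ^+ r * e = e + k%:~R -> s != 0 ->
  forall M, exists j, M < Dn (j * r) (X (e + s / dR ^+ (j * r))).
Proof.
move=> r_gt0 ek s0 M; have dge := dR_ge2 L.
pose x j := X (e + s / dR ^+ (j * r)).
have xE j : iter r H (x j.+1) = x j + k%:~R.
  rewrite /x (coord_iter C) -(coord_int C); congr X.
  rewrite mulrDr ek mulSn exprD; field; rewrite !gt_eqF //.
have xlim : forall ep, 0 < ep -> exists j, `|x j - x j.+1| <= ep.
  move=> ep ep0; have [dl dl0 dlP] := coord_unif C ep0.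
  have [N NP] : exists N, `|s| < dl * dR ^+ (N * r).
    exists (Num.truncn (`|s| / dl)).+1; rewrite mulrC -ltr_pdivrMr //.
    apply: lt_le_trans (truncnS_gt _) _; apply: le_trans (dX_ge L _).
    by rewrite ler_nat leq_pmulr.
  exists N; have close t : `|t| <= dl -> `|X (e + s / dR ^+ (N * r)) - X (e + s / dR ^+ (N * r) + t)| <= ep.
    move=> tdl; set y := _ + s / _.
    have [t0|/ltW t0] := leP 0 t.
      rewrite distrC ger0_norm ?subr_ge0 ?(coord_leE C) ?lerDl //.
      apply: le_trans (dlP y); rewrite lerD2r (coord_leE C) lerD2l.
      by apply: le_trans tdl; exact: ler_norm.
    rewrite ger0_norm ?subr_ge0 ?(coord_leE C) ?gerDl //.
    apply: le_trans (dlP (y + t)); rewrite lerD2r (coord_leE C).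
    by rewrite -addrA lerDl; move: tdl; rewrite ler0_norm //; lra.
  rewrite /x (_ : e + s / dR ^+ (N.+1 * r) = e + s / dR ^+ (N * r) +
     (s / dR ^+ (N.+1 * r) - s / dR ^+ (N * r))); last by ring.
  apply: close; rewrite -mulrBr normrM.
  have : `|(dR ^+ (N.+1 * r))^-1 - (dR ^+ (N * r))^-1| <= (dR ^+ (N * r))^-1.
    have i1 : 0 < (dR ^+ (N.+1 * r))^-1 by rewrite invr_gt0.
    have : (dR ^+ (N.+1 * r))^-1 <= (dR ^+ (N * r))^-1.
      by rewrite lef_pV2 ?posrE // ler_eXn2l; [rewrite leq_mul2r leqnSn orbT|lra].
    by rewrite ler_norml => ?; apply/andP; split; lra.
  move=> h; apply: le_trans (ler_wpM2l (normr_ge0 s) h) _.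
  by rewrite ler_pdivrMr // ltW.
have sj j : (0 < s / dR ^+ (j * r)) = (0 < s) by rewrite pmulr_lgt0 ?invr_gt0.
have sj' j : (s / dR ^+ (j * r) < 0) = (s < 0) by rewrite pmulr_llt0 ?invr_gt0.
have dr : 1 < dR ^+ r by rewrite exprn_egt1 ?gtn_eqF //; lra.
have step j : s / dR ^+ (j * r) = dR ^+ r * (s / dR ^+ (j.+1 * r)).
  by rewrite mulSn exprD; field; rewrite !gt_eqF.
have x10 : x 0%N != x 1%N.
  apply/eqP => h; have := step 0%N; have : s / dR ^+ (0 * r) = s / dR ^+ (1 * r).
    by apply: (addrI e); exact: coord_inj h.
  move=> -> /eqP; rewrite -subr_eq0 -[X in X - _]mul1r -mulrBl mulf_eq0 => /orP[]; first by lra.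
  by rewrite mulf_eq0 (negbTE s0) invr_eq0 gt_eqF.
have x10g : 0 < `|x 0%N - x 1%N| by rewrite normr_gt0 subr_eq0.
suff [Wt WtP] : exists Wt, forall j, `|x 0%N - x 1%N| <= expR Wt * Dn (j * r) (x j) * `|x j - x j.+1|.
  have M1 : 0 < `|M| + 1 by rewrite ltr_wpDl.
  have [j jP] := xlim (`|x 0%N - x 1%N| / (expR Wt * (`|M| + 1))) (divr_gt0 x10g (mulr_gt0 (expR_gt0 _) M1)).
  exists j; apply: (@lt_le_trans _ _ (`|M| + 1)); first by have := ler_norm M; lra.
  have D0 : 0 < Dn (j * r) (x j) by exact: Dn_gt0 L _ _.
  have := le_trans (WtP j) (ler_wpM2l (ltW (mulr_gt0 (expR_gt0 _) D0)) jP).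
  rewrite (_ : _ * Dn _ _ * _ = `|x 0%N - x 1%N| * (Dn (j * r) (x j) / (`|M| + 1))); last first.
    by field; rewrite !gt_eqF ?expR_gt0.
  by rewrite ler_pMr // ler_pdivlMr // mul1r.
have Xe j : 0 < s -> X e <= x j by move=> sp; rewrite (coord_leE C) lerDl ltW // sj.
have eX j : s < 0 -> x j <= X e by move=> sn; rewrite (coord_leE C) gerDl ltW // sj'.
have Wle y z : y <= z -> W r y <= W r z.
  by move=> yz; have h := W_le r yz; rewrite -subr_ge0; exact: le_trans (normr_ge0 _) h.
have [sn|sp] := ltP s 0.
  have xx j : x j <= x j.+1.
    rewrite (coord_leE C) lerD2l step; have := sj' j.+1; rewrite sn; move: (s / _) => z; nra.
  exists (W r (X e) - W r (x 1%N)) => j.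
  rewrite (distrC (x 0%N)) (distrC (x j)) !ger0_norm ?subr_ge0 //.
  apply: (@nested_growth x (x \o S) r k _ xx xE (fun j => xE j.+1)); last by rewrite lexx xx.
  move=> n; rewrite (telescope_sumr (fun i => W r (x i.+1))) // lerD2r; exact: Wle (eX _ sn).
have {sp}sp : 0 < s by rewrite lt_neqAle eq_sym s0.
have xx j : x j.+1 <= x j.
  rewrite (coord_leE C) lerD2l [leRHS]step; have := sj j.+1; rewrite sp; move: (s / _) => z; nra.
exists (W r (x 1%N) - W r (X e)) => j.
rewrite !ger0_norm ?subr_ge0 //.
apply: (@nested_growth (x \o S) x r k _ xx (fun j => xE j.+1) xE); last by rewrite lexx xx.
move=> n; apply: (@le_trans _ _ (W r (x 1%N) - W r (x n.+1))).
  elim: n => [|n IH]; first by rewrite big_geq // subrr.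
  by rewrite big_nat_recr //=; lra.
by rewrite lerD2l lerN2; exact: Wle (Xe _ sp).
Qed.

End nested.

(** * Backward orbits of bounded growth are parabolic cycles *)

Section bounded_growth.
Variables (R : realType) (d : nat) (H DH v : R -> R) (V : R).
Hypothesis L : BV_lift d H DH v V.
Hypothesis Rep : repelling H DH.
Local Notation Dn := (iter_deriv H DH).
Local Notation dR := (d%:R : R).
Variable X : R -> R.
Hypothesis C : linear_coord d H X.
Variables (u : nat -> R) (B : R).
Hypothesis bu : backward_orbit d u.
Hypothesis bB : bounded_growth H DH X u B.

Let dX n : 0 < dR ^+ n := dX_gt0 L n.

Lemma repelling_ge1 x s (k : int) : (0 < s)%N -> iter s H x = x + k%:~R -> 1 <= Dn s x.
Proof.
move=> s0 xk; have [dl dl0 dlP] := Rep s0 xk.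
rewrite leNgt; apply/negP => lt1; have e0 : 0 < 1 - Dn s x by lra.
have /continuousE /(_ x _ e0) [dl' dl'0 dl'P] := Dn_cont L s.
pose t := Num.min dl dl' / 2.
have m0 : 0 < Num.min dl dl' by rewrite lt_min dl0.
have m1 : Num.min dl dl' <= dl by rewrite ge_min lexx.
have m2 : Num.min dl dl' <= dl' by rewrite ge_min lexx orbT.
have t0 : 0 < t by rewrite /t; lra.
have xt : `|x + t - x| = t by rewrite addrAC subrr add0r gtr0_norm.
have := dlP (x + t); have := dl'P (x + t); rewrite xt => h1 h2.
have {}h1 : `|Dn s (x + t) - Dn s x| < 1 - Dn s x by apply: h1; rewrite /t; lra.
have : 1 < Dn s (x + t).
  apply: h2; last by rewrite /t; lra.
  by rewrite -subr_eq0 addrAC subrr add0r gt_eqF.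
by move: h1; rewrite ltr_norml; lra.
Qed.

(* The other preimages of a gap end under its period are not gap ends, since they
   are not periodic. *)
Lemma gap_end_isolated e r (k : int) : gap_end u e -> (0 < r)%N -> dR ^+ r * e = e + k%:~R ->
  exists2 eta, 0 < eta & exists m0, forall m i, (m0 <= m)%N -> (0 < i < d ^ r)%N ->
    ~ in_arc (e + i%:R / dR ^+ r - eta) (e + i%:R / dR ^+ r + eta) (u m).
Proof.
move=> [g [g0 avoid visit]] r0 ek.
have dr0 := dX r.
have one i : (0 < i < d ^ r)%N -> exists2 eta, 0 < eta & exists m0, forall m, (m0 <= m)%N ->
    ~ in_arc (e + i%:R / dR ^+ r - eta) (e + i%:R / dR ^+ r + eta) (u m).
  move=> ir; set e' := e + i%:R / dR ^+ r; apply: contrapT => no.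
  have e'E : dR ^+ r * e' = e + (k + i%:Z)%:~R by rewrite /e' mulrDr mulrCA divff ?gt_eqF // mulr1 ek intrD; ring.
  (* If visits near [e'] never ceased, the gap at [e] pulled back under [d^r] would make [e'] a gap
     end, hence periodic. But [e] and [e'] have the same image under [d^r] modulo 1, and two
     periodic points with the same image coincide. *)
  have ge : gap_end u e'.
    exists (g / dR ^+ r); split; first by rewrite divr_gt0.
    - move=> ep ep0; have [m0 m0P] := avoid (dR ^+ r * ep) (mulr_gt0 dr0 ep0).
      exists (m0 + r)%N => m mr [j /andP[j1 j2]]; have rm : (r <= m)%N := leq_trans (leq_addl _ _) mr.
      apply: (m0P (m - r)%N); first by rewrite leq_subRL // addnC.
      have [k3 k3E] := backward_orbitD (m - r) r bu; rewrite subnK // in k3E.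
      have [J JE] := dX_int R d r j.
      have E : u (m - r)%N + (k3 + J - (k + i%:Z))%:~R = dR ^+ r * (u m + j%:~R) - (k + i%:Z)%:~R.
        by rewrite mulrDr JE k3E !(intrD, mulrNz); ring.
      exists (k3 + J - (k + i%:Z)); rewrite E.
      have s1 : dR ^+ r * (e' - g / dR ^+ r) < dR ^+ r * (u m + j%:~R) by rewrite ltr_pM2l.
      have s2 : dR ^+ r * (u m + j%:~R) < dR ^+ r * (e' - ep) by rewrite ltr_pM2l.
      move: s1 s2; rewrite !mulrBr e'E (mulrC _ (g / _)) divfK ?gt_eqF // => s1 s2.
      by apply/andP; split; lra.
    - move=> ep m0 ep0; apply: contrapT => no'; apply: no; exists ep => //; exists m0 => m mm in_.
      by apply: no'; exists m.
  have [r' r'0 [k' k'E]] := gap_end_periodic L C bu bB ge.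
  have per (x : R) n (q : int) p : dR ^+ n * x = x + q%:~R -> exists q' : int, dR ^+ (p * n) * x = x + q'%:~R.
    move=> xq; elim: p => [|p [q' IH]]; first by exists 0; rewrite mul1r addr0.
    have [q2 q2E] := dX_int R d (p * n) q.
    exists (q' + q2); rewrite mulSn addnC exprD -mulrA xq mulrDr IH q2E intrD; ring.
  have [q1 q1E] := per _ _ _ r k'E.
  have [q2 q2E] := per _ _ _ r'.-1 ek.
  have [q3 q3E] := dX_int R d (r'.-1 * r) (k + i%:Z).
  have E : (i%:R : R) = dR ^+ r * (q2 + q3 - q1)%:~R.
    have : e' + q1%:~R = e + (q2 + q3)%:~R.
      rewrite -q1E mulnC -{1}(prednK r'0) mulSn addnC exprD -mulrA e'E mulrDr q2E q3E intrD; ring.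
    rewrite /e' intrB; set z := q1%:~R; set y := (q2 + q3)%:~R => h.
    have -> : y - z = i%:R / dR ^+ r by lra.
    by rewrite mulrC divfK ?gt_eqF.
  case/andP: ir => i0 ir; have dE : (dR ^+ r = (d ^ r)%:R) by rewrite natrX.
  have ir' : (i%:R : R) < dR ^+ r by rewrite dE ltr_nat.
  have i0' : 0 < (i%:R : R) by rewrite ltr0n.
  have [h|h] := int_le0_ge1 R (q2 + q3 - q1).
    by have := ler_wpM2l (ltW dr0) h; rewrite -E mulr0; lra.
  by have := ler_wpM2l (ltW dr0) h; rewrite -E mulr1; lra.
have : forall n, (n <= d ^ r)%N -> exists2 eta, 0 < eta & exists m0, forall m i, (m0 <= m)%N -> (0 < i < n)%N ->
    ~ in_arc (e + i%:R / dR ^+ r - eta) (e + i%:R / dR ^+ r + eta) (u m).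
  elim=> [|n IH] nd; first by exists 1 => //; exists 0%N => m i; rewrite ltn0 andbF.
  have [eta eta0 [m0 m0P]] := IH (ltnW nd).
  have [n0|n0] := posnP n.
    by exists 1 => //; exists 0%N => m i; rewrite n0 ltnS leqn0 lt0n andNb.
  have [eta' eta'0 [m1 m1P]] := one n (introT andP (conj n0 nd)).
  exists (Num.min eta eta'); first by rewrite lt_min eta0.
  have t1 : Num.min eta eta' <= eta by rewrite ge_min lexx.
  have t2 : Num.min eta eta' <= eta' by rewrite ge_min lexx orbT.
  exists (maxn m0 m1) => m i; rewrite geq_max => /andP[mm0 mm1] /andP[i0].
  rewrite ltnS leq_eqVlt => /orP[/eqP ->|i_n] [q qP].
    by apply: (m1P m mm1); exists q; lra.
  by apply: (m0P m i mm0); [rewrite i0|exists q; lra].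
by apply.
Qed.

(** After a visit close to [e] the orbit has to follow, every [r] steps, the inverse branch that
    fixes [e]. It thus converges to [e], and bounded growth forces it to be equal to [e] and the
    multiplier to be 1. *)
Theorem bounded_growth_parabolic : exists2 r, (0 < r)%N & forall m,
  (exists k : int, dR ^+ r * u m = u m + k%:~R) /\ Dn r (X (u m)) = 1.
Proof.
have [e ge] := gap_end_exists L C bu bB.
have [r r0 [k ek]] := gap_end_periodic L C bu bB ge.
have [eta1 eta10 [m0 m0P]] := gap_end_isolated ge r0 ek.
have dr0 := dX r; have dr1 : 1 <= dR ^+ r by apply: exprn_ege1; have := dR_ge2 L; lra.
pose eta := Num.min eta1 (1 / 2).
have t0 : 0 < eta by rewrite lt_min eta10; lra.
have t1 : eta <= eta1 by rewrite ge_min lexx.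
have t2 : eta <= 1 / 2 by rewrite ge_min lexx orbT.
have follow m (j : int) s : (m0 <= m)%N -> u m + j%:~R = e + s -> `|s| < eta ->
    exists j' : int, u (m + r)%N + j'%:~R = e + s / dR ^+ r.
  move=> mm jE seta; have [k3 k3E] := backward_orbitD m r bu.
  have E : u (m + r)%N = e + s / dR ^+ r + (k3 - j - k)%:~R / dR ^+ r.
    apply: (mulfI (negbT (gt_eqF dr0))); rewrite k3E !mulrDr ek !(mulrC (dR ^+ r) (_ / _)) !divfK ?gt_eqF //.
    by rewrite !intrB; lra.
  (* The remainder of [q] modulo [d^r] tells which preimage of [e] the point is close to;
     [gap_end_isolated] leaves only the remainder 0. *)
  pose q := (k3 - j - k); pose dz := (d%:Z ^+ r).
  have dzE : (dz%:~R : R) = dR ^+ r by rewrite rmorphXn.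
  have dz0 : dz != 0 by rewrite -(intr_eq0 R) dzE gt_eqF.
  have qE : (q%:~R : R) / dR ^+ r = (q %/ dz)%Z%:~R + (q %% dz)%Z%:~R / dR ^+ r.
    by rewrite {1}(divz_eq q dz) intrD intrM dzE mulrDl mulfK ?gt_eqF.
  have [i iE] : exists i : nat, (q %% dz)%Z = i%:Z.
    by exists `|(q %% dz)%Z|%N; rewrite gez0_abs // modz_ge0.
  have id : (i < d ^ r)%N.
    have := ltz_mod q dz0; rewrite iE /dz; rewrite -(ltr_int R) -[`|_|%R]ger0_norm //.
    by rewrite normr_id ger0_norm ?exprn_ge0 // rmorphXn /= -natrX ltr_nat.
  exists (- (q %/ dz)%Z); rewrite E -/q qE iE mulrNz.
  have [i0|i0] := posnP i; first by rewrite i0 mul0r; lra.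
  exfalso; apply: (m0P (m + r)%N i); [exact: leq_trans mm (leq_addr _ _)|by rewrite i0|].
  exists (- (q %/ dz)%Z); rewrite E -/q qE iE mulrNz.
  have sr : `|s / dR ^+ r| < eta1.
    rewrite normrM normfV (gtr0_norm dr0) ltr_pdivrMr //; apply: lt_le_trans seta _.
    by apply: le_trans t1 _; rewrite ler_peMr // ltW.
  by move: sr; rewrite ltr_norml; lra.
have [m1 mm1 [j1 j1P]] : exists2 m, (m0 <= m)%N & in_arc (e - eta) (e + eta) (u m).
  by case: ge => g [_ _]; apply.
pose s := u m1 + j1%:~R - e.
have seta : `|s| < eta by rewrite ltr_norml /s; lra.
have conv q : exists j : int, u (m1 + q * r)%N + j%:~R = e + s / dR ^+ (q * r).
  elim: q => [|q [j IH]]; first by exists j1; rewrite addn0 divr1 /s; lra.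
  have [||j' E] := follow (m1 + q * r)%N j _ _ IH.
  - exact: leq_trans mm1 (leq_addr _ _).
  - rewrite normrM normfV (gtr0_norm (dX _)); apply: le_lt_trans seta.
    by rewrite ler_pdivrMr // ler_peMr // exprn_ege1; have := dR_ge2 L; lra.
  - exists j'; rewrite mulSn (addnC r) addnA E; congr (_ + _).
    by rewrite exprD invfM mulrA.
have Dconv q : Dn (q * r) (X (e + s / dR ^+ (q * r))) <= B / Dn m1 (X (u m1)).
  have [j E] := conv q; rewrite -E (Dn_coord_int L C) ler_pdivlMr ?(Dn_gt0 L) //.
  by rewrite -(backward_orbit_Dn L C _ _ bu).
have [s0|s0] := eqVneq s 0; last first.
  have [q] := growth_to_periodic L C r0 ek s0 (B / Dn m1 (X (u m1))).
  by rewrite ltNge Dconv.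
have Xek : iter r H (X e) = X e + k%:~R by rewrite (coord_iter C) ek (coord_int C).
have De1 : Dn r (X e) = 1.
  apply/eqP; rewrite eq_le (repelling_ge1 r0 Xek) andbT leNgt; apply/negP => gt1.
  have pw q : Dn (q * r) (X e) = Dn r (X e) ^+ q.
    elim: q => [|q IH]; first by rewrite mul0n Dn0.
    by rewrite mulSn DnD Xek (Dn_int L) IH exprS.
  have lin q : 1 + q%:R * (Dn r (X e) - 1) <= Dn r (X e) ^+ q.
    elim: q => [|q IH]; first by rewrite mul0r addr0.
    rewrite exprS -natr1; have q0 : 0 <= (q%:R : R) by rewrite ler0n.
    have h1 := mulr_ge0 q0 (sqr_ge0 (Dn r (X e) - 1)).
    have h2 := ler_wpM2l (ltW (Dn_gt0 L r (X e))) IH.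
    by apply: le_trans h2; rewrite -subr_ge0; apply: le_trans h1 _; rewrite le_eqVlt; apply/orP; left; apply/eqP; ring.
  pose M := B / Dn m1 (X (u m1)); pose q := (Num.truncn (M / (Dn r (X e) - 1))).+1.
  have : M < q%:R * (Dn r (X e) - 1) by rewrite -ltr_pdivrMr ?subr_gt0 // truncnS_gt.
  by have := lin q; rewrite -pw; have := Dconv q; rewrite s0 mul0r addr0 -/M; lra.
exists r => // m.
(* Each [u m] is a forward image of a later point that equals [e] modulo 1, hence lies on the cycle
   of [e]. *)
have [j E] := conv m; rewrite s0 mul0r addr0 in E.
have mq : (m <= m1 + m * r)%N by apply: leq_trans (leq_addl _ _); rewrite leq_pmulr.
pose n := (m1 + m * r - m)%N.
have [k3 k3E] := backward_orbitD m n bu; rewrite subnKC // in k3E.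
have [J JE] := dX_int R d n j.
have um : u m = dR ^+ n * e + (- J - k3)%:~R.
  by rewrite -E mulrDr k3E JE intrB mulrNz; lra.
have [k4 k4E] := dX_int R d r (- J - k3); have [k5 k5E] := dX_int R d n k.
split.
  exists (k5 + k4 - (- J - k3)); rewrite um mulrDr k4E mulrA -exprD addnC exprD -mulrA ek mulrDr k5E intrB intrD.
  by ring.
rewrite um (Dn_coord_int L C) -(coord_iter C).
apply: (mulfI (negbT (gt_eqF (Dn_gt0 L n (X e))))).
by rewrite -DnD addnC DnD Xek De1 (Dn_int L) mul1r mulr1.
Qed.

End bounded_growth.

(** * Parabolic points and the expanding density *)

Section diagonal.
Variable R : realType.

Lemma near_int (x : R) : (forall e, 0 < e -> exists k : int, `|x - k%:~R| < e) -> exists k : int, x = k%:~R.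
Proof.
move=> xk; have /andP[f1 f2] := floor_itv x; exists (Num.floor x).
apply: contrapT => /eqP xf; rewrite intrD in f2.
have f1' : (Num.floor x)%:~R < x by rewrite lt_neqAle eq_sym xf.
pose e := Num.min (x - (Num.floor x)%:~R) ((Num.floor x)%:~R + 1 - x).
have e0 : 0 < e by rewrite lt_min; apply/andP; split; lra.
have e1 : e <= x - (Num.floor x)%:~R by rewrite ge_min lexx.
have e2 : e <= (Num.floor x)%:~R + 1 - x by rewrite ge_min lexx orbT.
have [k] := xk e e0; rewrite ltr_norml => kx.
by have := int_le0_ge1 R (k - Num.floor x); rewrite intrB; case; lra.
Qed.

Lemma diagonal_limit (s : nat -> nat -> R) : (forall n m, 0 <= s n m <= 1) ->
  exists y : nat -> R, forall M e n0, 0 < e ->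
    exists2 n, (n0 <= n)%N & forall m, (m <= M)%N -> `|s n m - y m| < e.
Proof.
(* Limits along a single ultrafilter replace the extraction of a diagonal subsequence: [sup (S m)]
   is the limit of [s n m] in [n] along [G]. *)
move=> s01; have [G [GU subG]] := @ultraFilterLemma nat \oo _.
pose S m := [set t | G [set n | t <= s n m]].
have S0 m : S m 0 by rewrite /S /= (_ : [set n | _] = setT); [exact: filterT|apply/seteqP; split => // n _ /=; case/andP: (s01 n m)].
have Sub m t : S m t -> t <= 1.
  move=> St; have [n /= tn] := filter_ex St.
  by apply: le_trans tn _; case/andP: (s01 n m).
have Ss m : has_sup (S m) by split; [exists 0|exists 1 => t; exact: Sub].
exists (fun m => sup (S m)) => M e n0 e0.
have near m : G [set n | `|s n m - sup (S m)| < e].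
  have e2 : 0 < e / 2 by lra.
  have [t St ts] := sup_adherent e2 (Ss m).
  have nS : ~ S m (sup (S m) + e / 2).
    by move=> /(ub_le_sup (proj2 (Ss m))); lra.
  have [//|nS'] := in_ultra_setVsetC [set n | sup (S m) + e / 2 <= s n m] GU.
  apply: filterS (filterI St nS') => n /= [h1 /negP]; rewrite -ltNge => h2.
  by rewrite ltr_norml; lra.
have : G ([set n | (n0 <= n)%N] `&` [set n | forall m, (m <= M)%N -> `|s n m - sup (S m)| < e]).
  apply: filterI; first by apply: subG; exists n0.
  elim: M => [|M IH].
    by apply: filterS (near 0%N) => n /= h m; rewrite leqn0 => /eqP ->.
  apply: filterS (filterI IH (near M.+1)) => n /= [h1 h2] m.
  by rewrite leq_eqVlt ltnS => /orP[/eqP -> //|/h1].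
by move=> /filter_ex[n [/= n1 n2]]; exists n.
Qed.

End diagonal.

Section compactness.
Variables (R : realType) (d : nat) (H DH v : R -> R) (V : R).
Hypothesis L : BV_lift d H DH v V.
Hypothesis Rep : repelling H DH.
Local Notation Dn := (iter_deriv H DH).
Local Notation dR := (d%:R : R).

Definition parabolic (x : R) := exists2 r, (0 < r)%N &
  (exists k : int, iter r H x = x + k%:~R) /\ Dn r x = 1.

Lemma bounded_backward_parabolic (y : nat -> R) B :
  (forall m, exists k : int, H (y m.+1) = y m + k%:~R) -> (forall m, Dn m (y m) <= B) ->
  exists2 r, (0 < r)%N & forall m, (exists k : int, iter r H (y m) = y m + k%:~R) /\ Dn r (y m) = 1.
Proof.
move=> yb yB; have [X C] := linear_coord_exists L Rep.
have [u uE] := choice (fun m => coord_surj C (y m)).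
have bu : backward_orbit d u.
  move=> m; have [k kE] := yb m; exists k; apply: (coord_inj C).
  by rewrite (coord_H C) (coord_int C) !uE.
have bB : bounded_growth H DH X u B by move=> m; rewrite uE.
have [r r0 rP] := bounded_growth_parabolic L Rep C bu bB.
exists r => // m; have [[k kE] De] := rP m; rewrite -uE; split => //.
by exists k; rewrite (coord_iter C) kE (coord_int C).
Qed.

Definition frac (x : R) := x - (Num.floor x)%:~R.

Lemma frac01 x : 0 <= frac x <= 1.
Proof. by rewrite /frac; have := floor_itv x; lra. Qed.

(** Longer and longer backward segments, represented in [[0, 1]], accumulate on an infinite backward
    orbit; the bound on each [Dn m] passes to the limit by continuity. *)
Lemma backward_limit (s : nat -> nat -> R) B : (forall n m, 0 <= s n m <= 1) ->
  (forall n m, (m < n)%N -> exists k : int, H (s n m.+1) = s n m + k%:~R) ->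
  (forall n m, (m <= n)%N -> Dn m (s n m) <= B) ->
  exists y : nat -> R, [/\ forall M e n0, 0 < e ->
      exists2 n, (n0 <= n)%N & forall m, (m <= M)%N -> `|s n m - y m| < e &
    exists2 r, (0 < r)%N & forall m, (exists k : int, iter r H (y m) = y m + k%:~R) /\ Dn r (y m) = 1].
Proof.
move=> s01 sb sB; have [y yP] := diagonal_limit s01; exists y; split => //.
apply: (@bounded_backward_parabolic y B) => m.
  suff [k kE] : exists k : int, H (y m.+1) - y m = k%:~R by exists k; lra.
  apply: near_int => e e0; have e2 : 0 < e / 2 by lra.
  have /continuousE /(_ (y m.+1) _ e2) [dl dl0 dlP] := iter_cont L 1.
  have [|n mn nP] := yP m.+1 (Num.min dl (e / 2)) m.+1; first by rewrite lt_min dl0.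
  have [k kE] := sb n m mn; exists k.
  have h1 := nP m.+1 (leqnn _); have h2 := nP m (leqnSn _).
  have /dlP /= h3 : `|s n m.+1 - y m.+1| < dl by apply: lt_le_trans h1 _; rewrite ge_min lexx.
  have h4 : `|s n m - y m| < e / 2 by apply: lt_le_trans h2 _; rewrite ge_min lexx orbT.
  by move: h3 h4; rewrite kE !ltr_norml; lra.
rewrite leNgt; apply/negP => lt; have e0 : 0 < Dn m (y m) - B by lra.
have /continuousE /(_ (y m) _ e0) [dl dl0 dlP] := Dn_cont L m.
have [n mn nP] := yP m dl m dl0.
have := dlP _ (nP m (leqnn _)); have := sB n m mn.
by rewrite ltr_norml; lra.
Qed.

Lemma iter_mod_int n x y (k : int) : x = y + k%:~R -> exists k' : int, iter n H x = iter n H y + k'%:~R.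
Proof. by move=> ->; exact: iter_intE L _ _ _. Qed.

Lemma iter_mul_periodic x r (k : int) p : iter r H x = x + k%:~R ->
  exists k' : int, iter (p * r) H x = x + k'%:~R.
Proof.
move=> xk; elim: p => [|p [k' IH]]; first by exists 0; rewrite addr0.
have [k2 k2E] := iter_mod_int r IH.
by exists (k + k2); rewrite mulSn iterD k2E xk intrD addrA.
Qed.

Lemma Dn_mul_periodic x r (k : int) p : iter r H x = x + k%:~R -> Dn (p * r) x = Dn r x ^+ p.
Proof.
move=> xk; elim: p => [|p IH]; first by rewrite mul0n Dn0.
by rewrite mulSn DnD xk (Dn_int L) IH exprS.
Qed.

(* Parabolic cycles of unbounded periods, read backwards from the point where the
   derivative along the cycle is the least, would converge to a parabolic cycle,
   but the latter is repelling nearby. *)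
Lemma parabolic_period_bounded : exists N, forall x, parabolic x ->
  exists2 r, (0 < r <= N)%N & exists k : int, iter r H x = x + k%:~R.
Proof.
apply: contrapT => /forallNP no.
have xs n : exists x, parabolic x /\ forall r, (0 < r <= n)%N -> forall k : int, iter r H x <> x + k%:~R.
  have /existsNP[x /not_implyP[px nx]] := no n; exists x; split=> // r rn k xk.
  by apply: nx; exists r => //; exists k.
have seq n : exists s : nat -> R, [/\ forall m, 0 <= s m <= 1,
   forall m, exists k : int, H (s m.+1) = s m + k%:~R, forall m, Dn m (s m) <= 1 &
   forall m r (k : int), (0 < r <= n)%N -> iter r H (s m) <> s m + k%:~R].
  have [x [[S S0 [[K KE] DS]] nper]] := xs n.
  have [j _ jmin] : exists2 j, (j < S)%N & forall i, (i < S)%N -> Dn j x <= Dn i x.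
    have [j _ jP] := @arg_minP _ _ _ (Ordinal S0) xpredT (fun i : 'I_S => Dn i x) isT.
    by exists j => // i iS; have := jP (Ordinal iS) isT.
  have Dmod i : Dn i x = Dn (i %% S) x.
    rewrite {1}(divn_eq i S) DnD (Dn_mul_periodic _ KE) DS expr1n mul1r.
    by have [k ->] := iter_mul_periodic (i %/ S) KE; rewrite (Dn_int L).
  have fracE z : exists k : int, frac z = z + k%:~R by exists (- Num.floor z); rewrite mulrNz.
  (* On a cycle of length [S], moving [S.-1] steps forward is one step backward. As the derivative
     is least at time [j], the derivatives from any earlier point up to it are at most 1. *)
  pose t m := (j + S.-1 * m)%N.
  exists (fun m => frac (iter (t m) H x)); split.
  - by move=> m; exact: frac01.
  - move=> m; have [k1 ->] := fracE (iter (t m.+1) H x); have [k2 ->] := fracE (iter (t m) H x).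
    have [k3] := iter_intE L 1 (iter (t m.+1) H x) k1; rewrite /= => ->.
    rewrite -iterS (_ : (t m.+1).+1 = t m + S)%N; last by rewrite /t mulnS -{3}(prednK S0); lia.
    rewrite iterD KE; have [k4 ->] := iter_intE L (t m) x K.
    by exists (k4 + k3 - k2); rewrite intrB intrD; ring.
  - move=> m; have [k ->] := fracE (iter (t m) H x); rewrite (Dn_int L).
    rewrite -(ler_pM2l (Dn_gt0 L (t m) x)) mulr1 -DnD.
    rewrite (_ : t m + m = m * S + j)%N; last by rewrite /t -{2}(prednK S0); lia.
    by rewrite Dmod modnMDl -Dmod (Dmod (t m)); apply: jmin; rewrite ltn_mod.
  - move=> m r k rn; have [k1 ->] := fracE (iter (t m) H x).
    have [k2 ->] := iter_intE L r (iter (t m) H x) k1.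
    move=> h; have {h}h : iter r H (iter (t m) H x) = iter (t m) H x + (k1 + k - k2)%:~R.
      by rewrite intrB intrD; lra.
    pose p := (t m * S - t m)%N; have tS : (p + t m = t m * S)%N by rewrite /p subnK // leq_pmulr.
    have [k3 k3E] := iter_mul_periodic (t m) KE.
    have xp : iter p H (iter (t m) H x) = x + k3%:~R by rewrite -iterD tS.
    have [k4 k4E] := iter_mod_int p h.
    have [k5 k5E] := dX_int R d r k3.
    apply: (nper r rn (k3 + k4 - k5)); move: k4E.
    by rewrite xp -iterD addnC iterD xp (iter_int L) k5E intrB intrD; lra.
have [s sP] := choice seq.
have [||| y [yP [r r0 rP]]] := @backward_limit s 1.
- by move=> n m; have [] := sP n.
- by move=> n m _; have [] := sP n.
- by move=> n m _; have [] := sP n.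
have [[k kE] Dy] := rP r; have [dl dl0 dlP] := Rep r0 kE.
have [n rn nP] := yP r dl r dl0.
have [_ _ sD snper] := sP n.
have [E|/eqP ne] := pselect (s n r = y r).
  by apply: (snper r r k); [rewrite r0|rewrite E].
by have := dlP (s n r) ne (nP r (leqnn _)); have := sD r; lra.
Qed.

End compactness.

(** * Finiteness of the parabolic points and uniform expansion elsewhere *)

Section density.
Variables (R : realType) (d : nat) (H DH v : R -> R) (V : R).
Hypothesis L : BV_lift d H DH v V.
Hypothesis Rep : repelling H DH.
Local Notation Dn := (iter_deriv H DH).
Local Notation dR := (d%:R : R).

(** A factorial is a common multiple of the bounded periods, and the multiplier for it is 1 because
    it is positive and one of its powers is 1. *)
Lemma parabolic_common_period : exists2 s, (0 < s)%N & forall x, parabolic H DH x ->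
  (exists k : int, iter s H x = x + k%:~R) /\ Dn s x = 1.
Proof.
have [N NP] := parabolic_period_bounded L Rep; exists N`!; first exact: fact_gt0.
move=> x px; have [r rN [k kE]] := NP x px.
have [k' k'E] : exists k : int, iter N`! H x = x + k%:~R.
  by rewrite -(divnK (dvdn_fact rN)); exact: iter_mul_periodic L _ _ _ _ kE.
split; first by exists k'.
case: px => S S0 [[K KE] DS].
have : Dn (S * N`!) x = 1 by rewrite mulnC (Dn_mul_periodic L _ KE) DS expr1n.
rewrite (Dn_mul_periodic L _ k'E) => /eqP.
by rewrite pexpr_eq1 ?(ltW (Dn_gt0 L _ _)) // => /eqP.
Qed.

Lemma parabolic_int x (k : int) : parabolic H DH x -> parabolic H DH (x + k%:~R).
Proof.
move=> [r r0 [[j jE] De]]; exists r => //; split; last by rewrite (Dn_int L).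
have [q qE] := dX_int R d r k.
by exists (j + q - k); rewrite (iter_int L) jE qE intrB intrD; ring.
Qed.

Lemma parabolic_H x : parabolic H DH x -> parabolic H DH (H x).
Proof.
move=> [r r0 [[k kE] De]]; exists r => //; split.
  rewrite -iterSr iterS kE; have [k' E] := iter_intE L 1 x k; exists k'; exact: E.
apply: (mulfI (negbT (gt_eqF (lift_gt0 L x)))).
have Dn1 z : DH z = Dn 1 z by rewrite DnS Dn0 mul1r.
rewrite mulr1 [DH x in LHS]Dn1 -[H x]/(iter 1 H x) -DnD addnC DnD kE (Dn_int L) De mul1r.
by rewrite -Dn1.
Qed.

(** In the parameter, the points fixed by the [s]-th iterate modulo 1 are the multiples of
    [1 / (d^s - 1)]. *)
Lemma parabolic_finite : exists ps : seq R, (forall p, p \in ps -> parabolic H DH p) /\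
  forall x, parabolic H DH x -> exists2 p, p \in ps & exists k : int, x = p + k%:~R.
Proof.
have [s s0 sP] := parabolic_common_period; have [X C] := linear_coord_exists L Rep.
pose q := (d ^ s - 1)%N.
have ds1 : (1 < d ^ s)%N by rewrite -(exp1n s) ltn_exp2r // (lift_deg L).
have q0 : (0 < q)%N by rewrite subn_gt0.
have qE : (q%:R : R) = dR ^+ s - 1 by rewrite /q natrB ?(ltnW ds1) // natrX.
have q0R : 0 < (q%:R : R) by rewrite ltr0n.
exists [seq x <- [seq X (i%:R / q%:R) | i <- iota 0 q] | `[< parabolic H DH x >]]; split.
  by move=> p; rewrite mem_filter => /andP[/asboolP].
move=> x px; have [[k kE] _] := sP x px.
have [u uE] := coord_surj C x.
have uq : u = k%:~R / q%:R.
  have : dR ^+ s * u = u + k%:~R by apply: (coord_inj C); rewrite -(coord_iter C) (coord_int C) uE.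
  by move=> h; apply: (mulIf (lt0r_neq0 q0R)); rewrite divfK ?lt0r_neq0 // qE; lra.
pose i := `|(k %% q%:Z)%Z|%N.
have qz : (q%:Z != 0) by rewrite eqz_nat -lt0n.
have iE : (k %% q%:Z)%Z = i%:Z by rewrite /i gez0_abs // modz_ge0.
have iq : (i < q)%N by have := ltz_mod k qz; rewrite iE /= ltz_nat.
have xE : x = X (i%:R / q%:R) + (k %/ q%:Z)%Z%:~R.
  rewrite -(coord_int C) -uE uq {1}(divz_eq k q%:Z) iE intrD intrM mulrDl mulfK ?gt_eqF //.
  by rewrite addrC.
exists (X (i%:R / q%:R)); last by exists (k %/ q%:Z)%Z.
rewrite mem_filter; apply/andP; split; last by apply/mapP; exists i => //; rewrite mem_iota.
by apply/asboolP; have := @parabolic_int x (- (k %/ q%:Z)%Z) px; rewrite {1}xE mulrNz addrK.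
Qed.

Lemma periodic_bounds (f : R -> R) : continuous f -> (forall x, f (x + 1) = f x) -> (forall x, 0 < f x) ->
  exists m M, [/\ 0 < m, 0 < M & forall x, m <= f x <= M].
Proof.
move=> fc fS f0; have [M M0 MP] := periodic_bounded fc fS; have [m m0 mP] := periodic_pos_lb fc fS f0.
by exists m, M; split => // x; rewrite mP (le_trans (ler_norm _) (MP x)).
Qed.

(** Otherwise the backward segments starting at [iter n.+1 H x] would have bounded derivatives, and
    a limit of them would be a parabolic cycle through a point with [c <= g]. The factor
    [expR (m / n.+1)] is at most [expR 1], which keeps the bounds uniform in [n]; it pays later for
    [m] factors [expR (- 1 / n.+1)]. *)
Lemma uniform_expansion (rho g : R -> R) c : continuous rho -> (forall x, rho (x + 1) = rho x) ->
  (forall x, 0 < rho x) -> continuous g -> (forall x, g (x + 1) = g x) ->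
  (forall x, c <= g x -> ~ parabolic H DH x) ->
  exists n, forall x, c <= g (iter n H x) -> exists2 m, (0 < m <= n.+1)%N &
    rho (iter (n.+1 - m) H x) * expR (m%:R / n.+1%:R) <=
    rho (iter n.+1 H x) * Dn m (iter (n.+1 - m) H x).
Proof.
move=> rc rS r0 gc gS cg; apply: contrapT => /forallNP no.
have [a [A [a0 A0 aA]]] := periodic_bounds rc rS r0.
have seq n : exists s : nat -> R, [/\ forall m, 0 <= s m <= 1,
    forall m, (m < n)%N -> exists k : int, H (s m.+1) = s m + k%:~R,
    forall m, (m <= n)%N -> Dn m (s m) <= 1 + A / a * expR 1 & c <= g (s 1%N)].
  have /existsNP[x /not_implyP[cx nx]] := no n.
  have fracE (z : R) : exists k : int, frac z = z + k%:~R by exists (- Num.floor z); rewrite mulrNz.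
  exists (fun m => frac (iter (n.+1 - m) H x)); split.
  - by move=> m; exact: frac01.
  - move=> m mn; have [k1 ->] := fracE (iter (n.+1 - m.+1) H x); have [k2 ->] := fracE (iter (n.+1 - m) H x).
    have [k3] := iter_intE L 1 (iter (n.+1 - m.+1) H x) k1; rewrite /= => ->.
    rewrite -iterS subSS -subSn ?(ltnW mn) //.
    by exists (k3 - k2); rewrite intrB; ring.
  - move=> m mn; have [k ->] := fracE (iter (n.+1 - m) H x); rewrite (Dn_int L).
    have [->|m0] := posnP m; first by rewrite Dn0 lerDl mulr_ge0 ?divr_ge0 ?expR_ge0 ?ltW.
    have : ~ (rho (iter (n.+1 - m) H x) * expR (m%:R / n.+1%:R) <=
        rho (iter n.+1 H x) * Dn m (iter (n.+1 - m) H x)).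
      by move=> h; apply: nx; exists m => //; rewrite m0 /=; exact: leq_trans mn (leqnSn _).
    move/negP; rewrite -ltNge; set z := iter (n.+1 - m) H x => h.
    have D0 := Dn_gt0 L m z; have /andP[h1 _] := aA (iter n.+1 H x); have /andP[_ h2] := aA z.
    have e1 : expR (m%:R / n.+1%:R) <= expR (1 : R).
      by rewrite ler_expR ler_pdivrMr ?ltr0n // mul1r ler_nat; exact: leq_trans mn (leqnSn _).
    have h3 : a * Dn m z <= rho (iter n.+1 H x) * Dn m z by rewrite ler_pM2r.
    have h4 : rho z * expR (m%:R / n.+1%:R) <= A * expR 1.
      by apply: ler_pM; rewrite ?expR_ge0 ?(ltW (r0 _)).
    have : Dn m z <= A / a * expR 1 by rewrite mulrAC ler_pdivlMr // mulrC; lra.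
    by lra.
  - have [k ->] := fracE (iter (n.+1 - 1) H x).
    by rewrite (periodic_int _ _ gS) subn1.
have [s sP] := choice seq.
have [||| y [yP [r r_gt0 rP]]] := @backward_limit _ _ _ _ _ _ L Rep s (1 + A / a * expR 1).
- by move=> n m; have [] := sP n.
- by move=> n m; have [_ + _ _] := sP n; apply.
- by move=> n m; have [_ _ + _] := sP n; apply.
apply: (cg (y 1%N)); last by have [k1 D1] := rP 1%N; exists r.
rewrite leNgt; apply/negP => lt; have e0 : 0 < c - g (y 1%N) by lra.
have /continuousE /(_ (y 1%N) _ e0) [dl dl0 dlP] := gc.
have [n _ nP] := yP 1%N dl 0%N dl0; have [_ _ _ cn] := sP n.
by have := dlP _ (nP 1%N (leqnn _)); rewrite ltr_norml; lra.
Qed.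

(** By compactness: points violating [Q] with [q] tending to 0 would accumulate at a zero of [q]. *)
Lemma near_zero (q : R -> R) (Q : R -> Prop) : continuous q -> (forall x, q (x + 1) = q x) ->
  (forall x, 0 <= q x) -> (forall x (k : int), Q (x + k%:~R) -> Q x) ->
  (forall y, q y = 0 -> exists2 dl, 0 < dl & forall x, `|x - y| < dl -> Q x) ->
  exists2 eta, 0 < eta & forall x, q x < eta -> Q x.
Proof.
move=> qc qS q0 QS near; apply: contrapT => no.
have seq n : exists x, [/\ 0 <= x <= 1, q x < n.+1%:R^-1 & ~ Q x].
  apply: contrapT => nox; apply: no; exists n.+1%:R^-1; first by rewrite invr_gt0 ltr0n.
  move=> x qx; apply: contrapT => nQ; apply: nox; exists (frac x); split; first exact: frac01.
    by rewrite /frac -mulrNz (periodic_int _ _ qS).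
  by rewrite /frac -mulrNz => /QS.
have [s sP] := choice seq.
have [|y' y'P] := @diagonal_limit R (fun n _ => s n); first by move=> n _; have [] := sP n.
pose y := y' 0%N.
have yP e n0 (e0 : 0 < e) : exists2 n, (n0 <= n)%N & `|s n - y| < e.
  by have [n nn nP] := y'P 0%N e n0 e0; exists n => //; exact: nP.
have qy : q y = 0.
  apply/eqP; rewrite eq_le q0 andbT leNgt; apply/negP => qy.
  have e2 : 0 < q y / 2 by lra.
  have /continuousE /(_ y _ e2) [dl dl0 dlP] := qc.
  have [n nN nP] := yP dl (Num.truncn (2 / q y)) dl0.
  have [_ qn _] := sP n; have := dlP _ nP; rewrite ltr_norml.
  suff h : n.+1%:R^-1 <= q y / 2 by have := lt_le_trans qn h => h1 /andP[h2 h3]; lra.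
  rewrite -[X in _ <= X]invrK lef_pV2 ?posrE ?ltr0n ?invr_gt0 // invf_div.
  by apply: le_trans (ltW (truncnS_gt _)) _; rewrite ler_nat.
have [dl dl0 dlP] := near y qy.
have [n _ nP] := yP dl 0%N dl0.
by have [_ _] := sP n; apply; exact: dlP nP.
Qed.

End density.

Fixpoint running_min (R : realType) (B : nat -> R -> R) i x :=
  if i is i'.+1 then Num.min (running_min B i' x) (B i x) else B 0%N x.

(** * The averaged density and a continuous expanded density *)

Section averaged_density.
Variables (R : realType) (d : nat) (H DH v : R -> R) (V : R).
Hypothesis L : BV_lift d H DH v V.
Hypothesis Rep : repelling H DH.
Local Notation Dn := (iter_deriv H DH).
Local Notation dR := (d%:R : R).

Definition avg_density s x : R := \sum_(i < s) Dn i x.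

Lemma avg_density_H s x : avg_density s (H x) * DH x = avg_density s x + Dn s x - 1.
Proof.
have DS i : Dn i.+1 x = Dn i (H x) * DH x.
  by rewrite /iter_deriv big_ord_recl mulrC /=; congr (_ * _); apply: eq_bigr => j _; rewrite -iterSr.
rewrite /avg_density; elim: s => [|s IH]; first by rewrite !big_ord0 Dn0; ring.
by rewrite !big_ord_recr /= mulrDl IH -DS; ring.
Qed.

Lemma avg_density_gt0 s x : (0 < s)%N -> 0 < avg_density s x.
Proof.
case: s => // s _; rewrite /avg_density big_ord_recl ltr_pwDl ?(Dn_gt0 L) //.
by apply: sumr_ge0 => i _; exact: ltW (Dn_gt0 L _ _).
Qed.

Lemma avg_density_cont s : continuous (avg_density s).
Proof.
elim: s => [|s IH] x.
  rewrite (_ : avg_density 0 = cst 0); first exact: cst_continuous.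
  by apply/funext => y; rewrite /avg_density big_ord0.
rewrite (_ : avg_density s.+1 = avg_density s \+ Dn s).
  by apply: continuousD; [exact: IH|exact: Dn_cont L _ _].
by apply/funext => y; rewrite /avg_density big_ord_recr.
Qed.

Lemma Dn_1 n x : Dn n (x + 1) = Dn n x.
Proof. exact: (Dn_int L n x 1). Qed.

Lemma avg_density_1 s x : avg_density s (x + 1) = avg_density s x.
Proof. by apply: eq_bigr => i _; rewrite Dn_1. Qed.

Variables (q : R -> R) (s : nat).
Hypothesis s0 : (0 < s)%N.
Hypothesis sP : forall x, parabolic H DH x -> (exists k : int, iter s H x = x + k%:~R) /\ Dn s x = 1.
Hypothesis qc : continuous q.
Hypothesis qS : forall x, q (x + 1) = q x.
Hypothesis q_ge0 : forall x, 0 <= q x.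
Hypothesis qP : forall x, q x = 0 <-> parabolic H DH x.

Local Notation rho0 := (avg_density s).

Lemma q_near_repelling : exists2 eta, 0 < eta & forall x, 0 < q x -> q x < eta -> 1 < Dn s x.
Proof.
have [||eta eta0 etaP] := near_zero (Q := fun x => 0 < q x -> 1 < Dn s x) qc qS q_ge0.
- by move=> x k; rewrite (periodic_int _ _ qS) (Dn_int L).
- move=> y /qP py; have [[k kE] _] := sP py; have [dl dl0 dlP] := Rep s0 kE.
  exists dl => // x xy q0; apply: dlP => //; apply: contraTneq q0 => ->.
  by rewrite -leNgt (proj2 (qP y) py).
by exists eta => // x q0 qe; exact: etaP.
Qed.

Lemma q_near_invariant n e : 0 < e -> exists2 eta, 0 < eta & forall x, q x < eta ->
  forall j, (j < n)%N -> q (iter j H x) < e.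
Proof.
move=> e0; apply: (near_zero (Q := fun x => forall j, (j < n)%N -> q (iter j H x) < e)) => //.
  move=> x k h j jn; have := h j jn; have [k' ->] := iter_intE L j x k.
  by rewrite (periodic_int _ _ qS).
move=> y /qP py; elim: n => [|n [dl dl0 dlP]]; first by exists 1.
have qn : q (iter n H y) = 0.
  by apply/qP; elim: {dlP} n => //= n; exact: parabolic_H L _.
have /continuousE /(_ y e e0) [dl' dl'0 dl'P] : continuous (q \o iter n H).
  by move=> x; apply: continuous_comp; [exact: iter_cont L _ _|exact: qc].
exists (Num.min dl dl'); first by rewrite lt_min dl0.
move=> x; rewrite lt_min => /andP[x1 x2] j; rewrite ltnS leq_eqVlt => /orP[/eqP ->|jn].
  by have := dl'P x x2; rewrite /= qn subr0; apply: le_lt_trans; exact: ler_norm.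
exact: dlP.
Qed.

(** Since [Bn i (H x) * DH x * kap x = Bn i.+1 x], the minimum over [i <= n] is expanded by
    [kap^-1], except that the index [n.+1] leaves the range; [last_step] shows that this last term
    is above one of the others. *)
Theorem expanding_density : exists rho : R -> R, [/\ continuous rho, forall x, rho (x + 1) = rho x,
  forall x, 0 < rho x, forall x, q x != 0 -> rho x < rho (H x) * DH x &
  exists2 eta, 0 < eta & forall x, q x < eta -> rho x = rho0 x].
Proof.
have [eta eta0 etaP] := q_near_repelling.
have r0c : continuous rho0 by exact: avg_density_cont.
have r0S := avg_density_1 s.
have r0_gt0 x : 0 < rho0 x by exact: avg_density_gt0.
have nonpar x : eta / 2 <= q x -> ~ parabolic H DH x.
  by move=> h /qP qx; rewrite qx in h; lra.
have [n nP] := uniform_expansion L Rep r0c r0S r0_gt0 qc qS nonpar.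
pose k0 : R := expR (- (1 / n.+1%:R)).
have k00 : 0 < k0 by exact: expR_gt0.
have n1 : 0 < (n.+1%:R : R)^-1 by rewrite invr_gt0 ltr0n.
have k01 : k0 < 1 by rewrite expR_lt1 oppr_lt0 mul1r.
pose E x := rho0 (H x) * DH x / rho0 x.
have E_gt0 x : 0 < E x by rewrite divr_gt0 // mulr_gt0 // (lift_gt0 L).
(* The cutoff [xi (q x)] is 1 for [q x <= eta / 2] and 0 for [eta <= q x]. Near the parabolic points
   [kap * E >= 1], so [Bn i] does not decrease with [i]; everywhere [kap >= k0], so [m] steps lose
   at most [expR (- m / n.+1)], the gain of [uniform_expansion]. *)
pose xi t : R := Num.max 0 (Num.min 1 (2 - 2 / eta * t)).
pose kap x := Num.max k0 (Num.min (E x)^-1 (xi (q x))).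
pose Bn i x := rho0 (iter i H x) * Dn i x * \prod_(j < i) kap (iter j H x).
pose mn := running_min Bn.
have HS x : E (x + 1) = E x.
  by rewrite /E r0S (DHS L) (liftS L) -[d%:R]/((d%:Z)%:~R) (periodic_int _ _ r0S).
have kS x : kap (x + 1) = kap x by rewrite /kap HS qS.
have kap_gt0 x : 0 < kap x by rewrite lt_max k00.
have kap_le1 x : kap x <= 1.
  by rewrite ge_max (ltW k01) /= ge_min /xi ge_max ler01 /= ge_min lexx orbT.
have kap_ge x : k0 <= kap x by rewrite le_max lexx.
have E1 x : q x < eta -> 1 <= E x /\ (q x != 0 -> 1 < E x).
  move=> qx; rewrite /E ler_pdivlMr // ltr_pdivlMr // !mul1r avg_density_H.
  have [qz|/eqP qz] := pselect (q x = 0).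
    by have [_ ->] := sP (proj1 (qP x) qz); rewrite qz eqxx; split => //; lra.
  have : 1 < Dn s x by apply: etaP => //; rewrite lt_neqAle eq_sym qz q_ge0.
  by split; lra.
have kap_lt1 x : q x != 0 -> kap x < 1.
  move=> qx; rewrite gt_max k01 /= gt_min; have [qe|eq] := ltP (q x) eta.
    by rewrite invf_lt1 // (proj2 (E1 x qe)).
  apply/orP; right; rewrite gt_max ltr01 gt_min; apply/orP; right.
  by have : 2 / eta * eta <= 2 / eta * q x; [rewrite ler_pM2l // divr_gt0|rewrite divfK ?gt_eqF //; lra].
have kapE x : q x < eta / 2 -> 1 <= kap x * E x.
  move=> qx; have qe : q x < eta by lra.
  have [e1 _] := E1 x qe.
  have x1 : 1 <= 2 - 2 / eta * q x.
    have : 2 / eta * q x <= 2 / eta * (eta / 2) by rewrite ler_pM2l ?divr_gt0 // ltW.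
    by rewrite (_ : 2 / eta * (eta / 2) = 1); [lra|field; rewrite gt_eqF].
  have : (E x)^-1 <= kap x.
    by rewrite le_max le_min lexx le_max le_min (invf_le1 (E_gt0 x)) e1 (le_trans _ x1) ?orbT // invf_le1.
  by move=> h; rewrite -[leLHS](mulVf (lt0r_neq0 (E_gt0 x))) ler_pM2r.
have DnH i x : Dn i.+1 x = Dn i (H x) * DH x.
  by rewrite /iter_deriv big_ord_recl mulrC /=; congr (_ * _); apply: eq_bigr => j _; rewrite -iterSr.
have BnH i x : Bn i.+1 x = Bn i (H x) * DH x * kap x.
  rewrite /Bn -iterSr DnH big_ord_recl /=.
  have -> : \prod_(j < i) kap (iter (bump 0 j) H x) = \prod_(j < i) kap (iter j H (H x)).
    by apply: eq_bigr => j _; rewrite -iterSr.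
  by ring.
have BnS i x : Bn i.+1 x = Bn i x * (E (iter i H x) * kap (iter i H x)).
  rewrite /Bn (DnS) big_ord_recr /= /E; field; rewrite gt_eqF //.
have mn_le m i x : (i <= m)%N -> mn m x <= Bn i x.
  elim: m i => [|m IH] i; first by rewrite leqn0 => /eqP ->.
  rewrite leq_eqVlt ltnS /= ge_min => /orP[/eqP ->|/IH ->//]; by rewrite lexx orbT.
have mn_ex m x : exists2 i, (i <= m)%N & mn m x = Bn i x.
  elim: m => [|m [i im IH]]; first by exists 0%N.
  have mnS : mn m.+1 x = Num.min (mn m x) (Bn m.+1 x) by [].
  have [h|/ltW h] := lerP (mn m x) (Bn m.+1 x); last by exists m.+1; rewrite // mnS min_r.
  by exists i; [exact: leq_trans im (leqnSn _)|rewrite mnS min_l].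
have Bn_gt0 i x : 0 < Bn i x.
  by rewrite !mulr_gt0 ?(Dn_gt0 L) // prodr_gt0.
have last_step x : exists2 i, (i <= n)%N & Bn i x <= Bn n.+1 x.
  have [qx|qx] := ltP (q (iter n H x)) (eta / 2).
    exists n => //; rewrite BnS ler_peMr ?(ltW (Bn_gt0 _ _)) // mulrC; exact: kapE.
  have [m /andP[m0 mn1] mP] := nP x qx; exists (n.+1 - m)%N; first by rewrite leq_subLR -(addn1 n) addnC leq_add2r.
  rewrite /Bn; set z := iter (n.+1 - m) H x in mP *.
  have Ez : Dn n.+1 x = Dn (n.+1 - m) x * Dn m z by rewrite -DnD subnK.
  have -> : \prod_(j < n.+1) kap (iter j H x) =
     \prod_(j < n.+1 - m) kap (iter j H x) * \prod_(j < m) kap (iter j H z).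
    have kapD a b : \prod_(j < a + b) kap (iter j H x) =
        \prod_(j < a) kap (iter j H x) * \prod_(j < b) kap (iter j H (iter a H x)).
      by rewrite big_split_ord /=; congr (_ * _); apply: eq_bigr => j _; rewrite addnC iterD.
    by rewrite -kapD subnK.
  have kk : k0 ^+ m <= \prod_(j < m) kap (iter j H z).
    rewrite -[in leLHS](card_ord m) -prodr_const; apply: ler_prod => j _.
    by rewrite kap_ge ltW.
  have k0e : expR (m%:R / n.+1%:R) * k0 ^+ m = 1.
    rewrite /k0 -expRM_natl -expRD -mulr_natl mulrN.
    by rewrite (_ : _ - _ = 0) ?expR0 //; field.
  have P0 : 0 < \prod_(j < n.+1 - m) kap (iter j H x) by rewrite prodr_gt0.
  have Dx := Dn_gt0 L (n.+1 - m) x.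
  have k0m : 0 < k0 ^+ m by rewrite exprn_gt0.
  have h1 : rho0 z <= rho0 (iter n.+1 H x) * Dn m z * \prod_(j < m) kap (iter j H z).
    have -> : rho0 z = rho0 z * expR (m%:R / n.+1%:R) * k0 ^+ m by rewrite -mulrA k0e mulr1.
    by apply: ler_pM; rewrite ?mulr_ge0 ?expR_ge0 ?(ltW (r0_gt0 _)) ?(ltW k0m).
  rewrite Ez; have := ler_wpM2r (ltW (mulr_gt0 Dx P0)) h1.
  by congr (_ <= _); ring.
have main x : mn n x <= mn n (H x) * DH x * kap x.
  have [i im ->] := mn_ex n (H x); rewrite -BnH.
  move: im; rewrite leq_eqVlt => /orP[/eqP ->|im]; last exact: mn_le.
  by have [j jn] := last_step x; apply: le_trans; exact: mn_le.
have mn_gt0 m x : 0 < mn m x by have [i _ ->] := mn_ex m x.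
have BnP i x : Bn i (x + 1) = Bn i x.
  rewrite /Bn Dn_1; have [k kE] := iter_intE L i x 1; rewrite kE (periodic_int _ _ r0S).
  congr (_ * _); apply: eq_bigr => j _; have [k' k'E] := iter_intE L j x 1.
  by rewrite k'E (periodic_int _ _ kS).
have Ec : continuous E.
  move=> x; apply: (@continuousM _ _ (fun x => rho0 (H x) * DH x) (fun x => (rho0 x)^-1)).
    apply: (@continuousM _ _ (rho0 \o H) DH); last exact: (lift_cont L).
    by apply: continuous_comp; [exact: is_derive_cts (lift_derive L x)|exact: r0c].
  by apply: continuousV; [rewrite gt_eqF|exact: r0c].
have kapc : continuous kap.
  move=> x; have xic : {for x, continuous (fun y => xi (q y))}.
    apply: (@continuous_max R R (cst 0) (fun y => Num.min 1 (2 - 2 / eta * q y))); first exact: cst_continuous.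
    apply: (@continuous_min R R (cst 1) (fun y => 2 - 2 / eta * q y)); first exact: cst_continuous.
    apply: continuousB; first exact: cst_continuous.
    by apply: continuousM; [exact: cst_continuous|exact: qc].
  apply: (@continuous_max R R (cst k0) (fun y => Num.min (E y)^-1 (xi (q y)))); first exact: cst_continuous.
  apply: (@continuous_min R R (fun y => (E y)^-1) (fun y => xi (q y))) => //.
  by apply: continuousV; [rewrite gt_eqF|exact: Ec].
have Bnc i : continuous (Bn i).
  move=> x; apply: (@continuousM _ _ (fun x => rho0 (iter i H x) * Dn i x)
      (fun x => \prod_(j < i) kap (iter j H x))).
    apply: (@continuousM _ _ (rho0 \o iter i H) (Dn i)); last exact: Dn_cont L _ _.
    by apply: continuous_comp; [exact: iter_cont L _ _|exact: r0c].
  elim: i => [|i IH].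
    by rewrite (_ : (fun y => _) = cst 1); [exact: cst_continuous|apply/funext => y; rewrite big_ord0].
  rewrite (_ : (fun y => _) = (fun y => \prod_(j < i) kap (iter j H y)) \* (kap \o iter i H)).
    by apply: continuousM => //; apply: continuous_comp; [exact: iter_cont L _ _|exact: kapc].
  by apply/funext => y; rewrite big_ord_recr.
exists (mn n); split.
- elim: (n) => [|m IH]; first exact: Bnc.
  by move=> x; apply: (@continuous_min _ _ (running_min Bn m) (Bn m.+1)); [exact: IH|exact: Bnc].
- by move=> x; rewrite /mn; elim: (n) => [|m IH] /=; rewrite BnP ?IH.
- by move=> x.
- move=> x qx; apply: le_lt_trans (main x) _; rewrite gtr_pMr ?mulr_gt0 ?(lift_gt0 L) //.
  exact: kap_lt1.
have e2 : 0 < eta / 2 by lra.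
have [e e0 eP] := q_near_invariant n e2.
exists e => // x qx; have B0 : Bn 0%N x = rho0 x by rewrite /Bn Dn0 big_ord0 !mulr1.
(* While the orbit stays near the parabolic points, the terms do not decrease and the minimum is the
   term [i = 0], that is [rho0]. *)
have incr i : (i <= n)%N -> rho0 x <= Bn i x.
  elim: i => [|i IH] iN; first by rewrite B0.
  apply: le_trans (IH (ltnW iN)) _; rewrite BnS ler_peMr ?(ltW (Bn_gt0 _ _)) // mulrC.
  by apply: kapE; exact: eP.
apply/eqP; rewrite eq_le -{1}B0 mn_le //=.
by have [i im ->] := mn_ex n x; exact: incr.
Qed.

End averaged_density.

(** * Passing to the circle *)

Section circle_basics.
Local Open Scope quotient_scope.
Variable R : realType.
Local Notation S1 := (circle R).
Implicit Types (x y : R) (p : S1).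

Lemma toS_eq x y : toS x = toS y <-> exists k : int, x = y + k%:~R.
Proof.
split=> [/eqmodP /intrP[k kE]|[k kE]]; first by exists k; rewrite -kE addrC subrK.
by apply/eqmodP/intrP; exists k; rewrite kE addrAC subrr add0r.
Qed.

Lemma toS_int x (k : int) : toS (x + k%:~R) = toS x.
Proof. by apply/toS_eq; exists k. Qed.

Lemma toS_surj p : exists x, toS x = p.
Proof. by exists (repr p); exact: reprK. Qed.

Lemma toS_continuous : continuous (@toS R).
Proof. exact: pi_continuous. Qed.

Lemma toS_open (U : set R) : open U -> open (@toS R @` U).
Proof.
move=> Uo; change (open (@toS R @^-1` (@toS R @` U))).
have -> : @toS R @^-1` (@toS R @` U) = \bigcup_(k in [set: int]) [set x | U (x + k%:~R)].
  apply/seteqP; split => [x [y Uy /toS_eq[k kE]]|x [k _ /= Uk]].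
    by exists k => //=; rewrite -kE.
  by exists (x + k%:~R) => //; exact: toS_int.
apply: bigcup_open => k _; apply: (@open_comp _ _ (fun x => x + k%:~R)) Uo => x _.
by apply: continuousD; [exact: id|exact: cst_continuous].
Qed.

Lemma nbhs_toS x (A : set S1) : nbhs (toS x) A <-> nbhs x (@toS R @^-1` A).
Proof.
split; first by move=> h; exact: toS_continuous h.
rewrite !nbhsE => -[U [Uo Ux] UA]; exists (@toS R @` U); last by move=> _ [y Uy <-]; exact: UA.
by split; [exact: toS_open|exists x].
Qed.

Lemma continuous_at_toS (T : topologicalType) (f : S1 -> T) x :
  {for x, continuous (f \o @toS R)} -> {for (toS x), continuous f}.
Proof. by move=> h A /h hA; apply/nbhs_toS; exact: hA. Qed.

Lemma int_valued_locally_const (f : R -> R) x : {for x, continuous f} ->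
  (\forall t \near x, exists k : int, f t = k%:~R) -> \forall t \near x, f t = f x.
Proof.
move=> fc fZ; have /nbhs_singleton[k kE] := fZ.
have e0 : 0 < (1 : R) by [].
have /cvgrPdist_lt /(_ _ e0) near1 := fc.
near=> t; have [j jE] : exists j : int, f t = j%:~R by near: t.
have : `|f x - f t| < 1 by near: t.
rewrite kE jE ltr_norml => /andP[h1 h2].
have := int_le0_ge1 R (k - j); have := int_le0_ge1 R (j - k); rewrite !intrB.
by case=> ?; case=> ?; lra.
Unshelve. all: by end_near. Qed.

Implicit Types (f g h : S1 -> S1) (F G H : R -> R).

Lemma local_lift_int f x F (k : int) : local_lift f x F ->
  local_lift f (x + k%:~R) (fun t : R => F (t - k%:~R)).
Proof.
rewrite /local_lift => Ff.
have sc : {for x + k%:~R, continuous (fun t : R => t - k%:~R)}.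
  by apply: continuousB; [exact: id|exact: cst_continuous].
have near1 : \forall t \near x + k%:~R, toS (F (t - k%:~R)) = f (toS (t - k%:~R)).
  by move: sc; rewrite /prop_for /continuous_at addrK => /(_ _ Ff).
near=> t; have -> : toS (F (t - k%:~R)) = f (toS (t - k%:~R)) by near: t.
by rewrite -mulrNz toS_int.
Unshelve. all: by end_near.
Qed.

Lemma local_lift_diff f x F G : local_lift f x F -> local_lift f x G ->
  {for x, continuous F} -> {for x, continuous G} ->
  \forall t \near x, F t = G t + (F x - G x).
Proof.
move=> Ff Gf Fc Gc.
have := @int_valued_locally_const (fun t => F t - G t) x (continuousB Fc Gc) _.
case=> [|e /= e0 eP]; last first.
  by exists e => // t /eP /= E; rewrite -E; ring.
near=> t; have FG : toS (F t) = toS (G t).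
  have -> : toS (F t) = f (toS t) by near: t.
  by apply/esym; near: t.
by have /toS_eq[k ->] := FG; exists k; ring.
Unshelve. all: by end_near. Qed.

Lemma is_derive_near F G x a : (\forall t \near x, F t = G t) -> is_derive x (1 : R) G a ->
  is_derive x (1 : R) F a.
Proof. by move=> FG; apply: near_eq_is_derive; rewrite ?oner_eq0 //; apply: filterS FG. Qed.

Lemma is_derive_lift f x F G a : local_lift f x F -> {for x, continuous F} -> local_lift f x G ->
  is_derive x (1 : R) G a -> is_derive x (1 : R) F a.
Proof.
move=> Ff Fc Gf Gd; have FG := local_lift_diff Ff Gf Fc (is_derive_cts Gd).
by apply: is_derive_near FG _; rewrite -[a]addr0; apply: is_deriveD.
Qed.

(** Two continuous local lifts differ by a locally constant function, and two representatives of a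
    point by an integer. This is what makes [cderive] well defined and computable from any lift. *)
Lemma is_cderive_lift f x F a : local_lift f x F -> {for x, continuous F} ->
  is_cderive f (toS x) a -> is_derive x (1 : R) F a.
Proof.
move=> Ff Fc [y [G [yx Gf Gd]]].
have [k xE] := proj1 (toS_eq x y) (esym yx).
have G'f := local_lift_int k Gf; rewrite -xE in G'f.
apply: is_derive_lift Ff Fc G'f _.
have := @is_derive_shiftr R G x (- k%:~R) a; apply; by rewrite xE addrK.
Qed.

Lemma is_cderive_uniq f p a b : is_cderive f p a -> is_cderive f p b -> a = b.
Proof.
move=> [x [F [<- Ff Fd]]] /(is_cderive_lift Ff (is_derive_cts Fd)) Fd'.
exact: is_derive_uniq Fd Fd'.
Qed.

Lemma is_cderiveE f p a : is_cderive f p a -> cderive f p = a.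
Proof. by move=> fa; rewrite /cderive; case: xgetP => [b _ /= fb|/(_ a)//]; exact: is_cderive_uniq fb fa. Qed.

Lemma cderivableP f p : cderivable f p -> is_cderive f p (cderive f p).
Proof. by move=> [a fa]; rewrite (is_cderiveE fa). Qed.

Lemma is_cderive_comp f g p a b : is_cderive f p a -> is_cderive g (f p) b -> is_cderive (g \o f) p (b * a).
Proof.
move=> [x [F [xp Ff Fd]]] [y [G [yfp Gf Gd]]].
have Fx : toS (F x) = f p by rewrite -xp; exact: nbhs_singleton Ff.
have [k FxE] := proj1 (toS_eq (F x) y) (etrans Fx (esym yfp)).
have G'f := local_lift_int k Gf; rewrite -FxE in G'f.
exists x, (fun t : R => G (F t - k%:~R)); split => //.
  have Fc := is_derive_cts Fd; have near1 := Fc _ G'f.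
  near=> t; have -> : toS (G (F t - k%:~R)) = g (toS (F t)) by near: t.
  by congr g; near: t.
apply: (@is_derive1_comp R (fun t : R => G (t - k%:~R)) F).
by apply: is_derive_shiftr; rewrite FxE addrK.
Unshelve. all: by end_near. Qed.

Lemma is_cderive_continuous f p a : is_cderive f p a -> {for p, continuous f}.
Proof.
move=> [x [F [<- Ff Fd]]]; apply: continuous_at_toS.
have Fc := is_derive_cts Fd; move=> A /=.
rewrite /= -(nbhs_singleton Ff) => /toS_continuous /Fc h.
have {}h : \forall t \near x, A (toS (F t)) by exact: h.
change (\forall t \near x, A (f (toS t))); near=> t.
by have <- : toS (F t) = f (toS t) by [near: t]; near: t.
Unshelve. all: by end_near. Qed.

Lemma cderive_comp f g p : cderivable f p -> cderivable g (f p) ->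
  cderivable (g \o f) p /\ cderive (g \o f) p = cderive g (f p) * cderive f p.
Proof.
move=> /cderivableP fa /cderivableP gb; have := is_cderive_comp fa gb => gf.
by split; [exists (cderive g (f p) * cderive f p)|exact: is_cderiveE].
Qed.

Lemma C1_on_comp (U W : set S1) f g : open U -> (forall p, U p -> W (f p)) ->
  C1_on U f -> C1_on W g -> C1_on U (g \o f).
Proof.
move=> Uo UW f1 g1 p Up; have [fd fc] := f1 p Up; have [gd gc] := g1 _ (UW p Up).
have [gfd gfE] := cderive_comp fd gd; split => //.
have Un : nbhs p U by apply: open_nbhs_nbhs.
have fcont := is_cderive_continuous (cderivableP fd).
have mc : {for p, continuous (fun q => cderive g (f q) * cderive f q)}.
  by apply: continuousM => //; apply: continuous_comp.
move=> A; rewrite /= gfE => /mc h.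
have {}h : \forall q \near p, A (cderive g (f q) * cderive f q) by exact: h.
change (\forall q \near p, A (cderive (g \o f) q)); near=> q; have Uq : U q by near: q.
have [fdq _] := f1 q Uq; have [gdq _] := g1 _ (UW q Uq).
have [_ ->] := cderive_comp fdq gdq; by near: q.
Unshelve. all: by end_near. Qed.

End circle_basics.

(** * Total variation of periodic functions *)

Section domination.
Variable R : realType.
Implicit Types (f v : R -> R).

Definition dominated f v V := [/\ {homo v : x y / x <= y}, forall x, v (x + 1) = v x + V &
  forall x y, x <= y -> `|f x - f y| <= v y - v x].

Lemma floorD1 (x : R) : Num.floor (x + 1) = Num.floor x + 1.
Proof.
apply: floor_def; have := floor_itv x; rewrite !intrD -[1%:~R]/(1 : R); lra.
Qed.

Lemma bounded_variation_dominated f : (forall x, f (x + 1) = f x) -> bounded_variation 0 1 f ->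
  exists v V, dominated f v V.
Proof.
move=> fS fbv; pose T t := fine (total_variation 0 t f).
have TD a b : 0 <= a -> a <= b -> b <= 1 -> `|f b - f a| <= T b - T a.
  move=> a0 ab b1.
  have b0 : 0 <= b by lra.
  have bv0b : bounded_variation 0 b f by exact: bounded_variationl fbv.
  have bv0a : bounded_variation 0 a f by exact: bounded_variationl bv0b.
  have bvab : bounded_variation a b f by exact: bounded_variationr bv0b.
  have fa := proj1 (bounded_variationP f a0) bv0a.
  have fab := proj1 (bounded_variationP f ab) bvab.
  have := total_variation_ge f ab; rewrite /T (total_variationD f a0 ab) fineD // addrAC subrr add0r.
  by rewrite -{1}(fineK fab) lee_fin.
have Tmono a b : 0 <= a -> a <= b -> b <= 1 -> T a <= T b.
  by move=> a0 ab b1; have := TD a b a0 ab b1; have := normr_ge0 (f b - f a); lra.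
pose fl (x : R) : R := (Num.floor x)%:~R.
have flP x : 0 <= x - fl x /\ x - fl x < 1.
  by rewrite /fl; have := floor_itv x; rewrite intrD -[1%:~R]/(1 : R) => /andP[]; lra.
have T0 : T 0 = 0 by rewrite /T total_variationxx.
(* The total variation from 0, continued quasi-periodically with the increment [T 1]. *)
pose v x := fl x * T 1 + T (x - fl x).
have T1 : 0 <= T 1 by rewrite -T0; apply: Tmono; rewrite ?lexx ?ler01.
have fE x : f (x - fl x) = f x by rewrite /fl -mulrNz (periodic_int _ _ fS).
have vd x y : x <= y -> `|f x - f y| <= v y - v x.
  move=> xy; have [x0 x1] := flP x; have [y0 y1] := flP y.
  rewrite -(fE x) -(fE y) /v.
  have [/eqP E|ne] := boolP (fl x == fl y).
    rewrite E distrC; have h : x - fl y <= y - fl y by lra.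
    by rewrite -E in x0 *; have := TD _ _ x0 (_ : x - fl x <= y - fl x) _; rewrite E => /(_ h (ltW y1)); lra.
  have flxy : fl x + 1 <= fl y.
    rewrite /fl -[1]/(1%:~R) -intrD ler_int.
    have : (Num.floor x <= Num.floor y)%R by exact: le_floor.
    by rewrite le_eqVlt => /predU1P[E|]; [move: ne; rewrite /fl E eqxx|rewrite -lezD1].
  (* When an integer separates the two points, their values are compared through [f 0 = f 1]. *)
  have h1 := TD (x - fl x) 1 x0 (ltW x1) (lexx _).
  have h2 := TD 0 (y - fl y) (lexx _) y0 (ltW y1).
  have f10 : f 1 = f 0 by rewrite -[1]add0r fS.
  rewrite f10 in h1; rewrite T0 in h2.
  have h3 := mulr_ge0 (_ : 0 <= fl y - fl x - 1) T1.
  have {}h3 : 0 <= (fl y - fl x - 1) * T 1 by apply: h3; lra.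
  have := ler_distD (f 0) (f (x - fl x)) (f (y - fl y)).
  move: h1 h2 h3; rewrite (distrC (f (x - fl x)) (f 0)) (distrC (f 0) (f (y - fl y))).
  by move=> h1 h2 h3 h4; apply: le_trans h4 _; lra.
exists v, (T 1); split=> //.
- by move=> x y xy; have := vd x y xy; have := normr_ge0 (f x - f y); lra.
- move=> x; have E : fl (x + 1) = fl x + 1 by rewrite /fl floorD1 intrD.
  by rewrite /v E opprD addrACA subrr addr0; ring.
Qed.

Lemma ln_lip (m a b : R) : 0 < m -> m <= a -> m <= b -> `|ln a - ln b| <= m^-1 * `|a - b|.
Proof.
move=> m0; wlog ba : a b / b <= a.
  by move=> W ma mb; have [/W|/ltW/W] := leP b a; [|rewrite distrC (distrC a)]; apply.
move=> ma mb; have a0 : 0 < a by lra.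
have b0 : 0 < b by lra.
rewrite !ger0_norm ?subr_ge0 ?ler_ln ?posrE // -ln_div ?posrE //.
have : ln (1 + (a / b - 1)) <= a / b - 1 by apply: le_ln1Dx; rewrite ltrBrDl subrr divr_gt0.
rewrite addrCA subrr addr0 => h; apply: le_trans h _.
have -> : a / b - 1 = b^-1 * (a - b) by field; rewrite gt_eqF.
by rewrite ler_wpM2r ?subr_ge0 // lef_pV2 ?posrE.
Qed.

End domination.

(** * From maps of the circle to lifts *)

Section lift_of_map.
Variable R : realType.
Local Notation S1 := (circle R).
Variables (d : nat) (h : S1 -> S1).

Lemma cderive_neq0 p : C1_on setT h -> local_C1_diffeo h -> cderive h p != 0.
Proof.
move=> h1 /(_ p) [U [g [[Uo Up Vo] [_ g1 gK]]]].
have hd := cderivableP (proj1 (h1 p I)).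
have [gd _] : cderivable g (h p) /\ {for h p, continuous (cderive g)} by apply: g1; exists p.
have gh1 := is_cderive_comp hd (cderivableP gd).
have gh2 : is_cderive (g \o h) p 1.
  have [x xp] := toS_surj p; exists x, id; split=> //; last exact: is_derive_id.
  have Un : nbhs (toS x) U by rewrite xp; exact: open_nbhs_nbhs.
  have : \forall t \near x, U (toS t) by exact: toS_continuous Un.
  by apply: filterS => t /gK.
have /eqP := is_cderive_uniq gh1 gh2.
by apply: contraTneq => ->; rewrite mulr0 eq_sym oner_eq0.
Qed.

Lemma FdBV_lift : (2 <= d)%N -> FdBV d h -> exists H v V,
  BV_lift d H (Dper h) v V /\ forall x, toS (H x) = h (toS x).
Proof.
move=> d2 [_ _ [H [Hc Hh HS]] hl [h1 hbv]].
have Hd x : is_derive x (1 : R) H (Dper h x).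
  apply: (@is_cderive_lift R h); [by exists 1 => [|t _] /=; [exact: ltr01|exact: Hh]|exact: Hc|].
  exact: cderivableP (proj1 (h1 _ I)).
have Dc : continuous (Dper h).
  move=> x; apply: (continuous_comp (@toS_continuous R x)).
  exact: (proj2 (h1 _ I)).
have DS x : Dper h (x + 1) = Dper h x by rewrite /Dper -[1]/(1%:~R) toS_int.
have D0 x : Dper h x != 0 by exact: cderive_neq0.
have D_gt0 x : 0 < Dper h x.
  rewrite lt0r D0 /= leNgt; apply/negP => Dx.
  (* The increment [d > 0] over a period yields a point of positive derivative; a negative value
     elsewhere would produce a zero in between. *)
  have xx1 : x <= x + 1 by rewrite lerDl.
  have [c /andP[xc _]] := MVTle Hd xx1; rewrite HS addrAC subrr add0r addrAC subrr add0r mulr1 => cE.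
  have Dcd : 0 < Dper h c by rewrite -cE ltr0n ltnW.
  have wc : {within `[x, c], continuous (Dper h)} by exact: continuous_subspaceT.
  have := @IVT _ _ _ _ 0 xc wc; case; last by move=> y _ /eqP; rewrite (negbTE (D0 y)).
  by rewrite ge_min le_max (ltW Dx) (ltW Dcd) orbT.
have [m m0 mD] := periodic_pos_lb Dc DS D_gt0.
have [v [V [vm vS vl]]] := bounded_variation_dominated DS hbv.
have m0' : 0 <= m^-1 by rewrite invr_ge0 ltW.
(* [m^-1] is a Lipschitz constant of [ln] on the values of the derivative, which are at least
   [m]. *)
exists H, (fun x => m^-1 * v x), (m^-1 * V); split=> //; split=> //.
- by move=> x y xy; rewrite ler_wpM2l // vm.
- by move=> x; rewrite vS mulrDr.
- move=> x y xy; apply: le_trans (ln_lip m0 (mD x) (mD y)) _.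
  by rewrite -mulrBr ler_wpM2l // vl.
Qed.

Variables (H DH v : R -> R) (V : R).
Hypothesis L : BV_lift d H DH v V.
Hypothesis Hh : forall x, toS (H x) = h (toS x).
Local Notation Dn := (iter_deriv H DH).

Lemma toS_iter n x : toS (iter n H x) = iter n h (toS x).
Proof. by elim: n => //= n <-; exact: Hh. Qed.

Lemma is_cderive_iter n x : is_cderive (iter n h) (toS x) (Dn n x).
Proof.
exists x, (iter n H); split=> //; last exact: iter_derive L n x.
by exists 1 => [|t _] /=; [exact: ltr01|exact: toS_iter].
Qed.

Lemma cderive_iter n x : cderive (iter n h) (toS x) = Dn n x.
Proof. exact: is_cderiveE (is_cderive_iter n x). Qed.

Lemma has_period_lift x s : has_period h (toS x) s -> exists k : int, iter s H x = x + k%:~R.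
Proof. by move=> [_ hs _]; apply/toS_eq; rewrite toS_iter. Qed.

(** Links arbitrary return times of the lift to [has_period], which demands minimality. *)
Lemma minimal_period x s (k : int) : (0 < s)%N -> iter s H x = x + k%:~R ->
  exists s0 m, [/\ has_period h (toS x) s0, s = (m * s0)%N & (0 < m)%N].
Proof.
move=> s0 hs; pose Q n := (0 < n)%N && `[< iter n h (toS x) = toS x >].
have exQ : exists n, Q n.
  by exists s; rewrite /Q s0 /=; apply/asboolP; rewrite -toS_iter hs toS_int.
case: (ex_minnP exQ) => n /andP[n0 /asboolP nE] nmin.
have hmul j : iter (j * n) h (toS x) = toS x.
  by elim: j => // j IH; rewrite mulSn iterD IH.
have dv : (n %| s)%N.
  rewrite /dvdn -leqn0 leqNgt; apply/negP => r0.
  have := nmin (s %% n)%N; rewrite /Q r0 /= leqNgt ltn_mod n0 => /(_ _)/negP; apply=> //.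
  apply/asboolP; rewrite -[in LHS](hmul (s %/ n)%N) -iterD addnC -divn_eq.
  by rewrite -toS_iter hs toS_int.
exists n, (s %/ n)%N; split; last by rewrite divn_gt0 // dvdn_leq.
  split=> // j /andP[j0 jn] jE; have := nmin j.
  by rewrite /Q j0 /= leqNgt jn => /(_ _)/negP; apply=> //; apply/asboolP.
by rewrite divnK.
Qed.

(** The hypothesis concerns minimal periods only. For a multiple of one, a nearby point is followed
    through the successive turns of the cycle, each contributing a factor above 1. *)
Lemma Tstar_repelling : (forall p s, has_period h p s ->
    \forall q \near p, q <> p -> 1 < cderive (iter s h) q) -> repelling H DH.
Proof.
move=> hT x s k s_gt0 hs; have [s0 [m [per sE m0]]] := minimal_period s_gt0 hs.
have [k0 k0E] := has_period_lift per.
have near1 : \forall y \near x, y != x -> 1 < Dn s0 y.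
  have h1 : \forall y \near x, toS y <> toS x -> 1 < cderive (iter s0 h) (toS y).
    exact: (proj1 (nbhs_toS x _) (hT _ _ per)).
  have e1 : 0 < (1 : R) by [].
  have h2 : \forall y \near x, `|x - y| < 1 by exists 1.
  near=> y => yx; rewrite -cderive_iter.
  have : toS y <> toS x -> 1 < cderive (iter s0 h) (toS y) by near: y.
  apply=> /toS_eq[j jE]; have : `|x - y| < 1 by near: y.
  rewrite jE opprD addNKr normrN ltr_norml => /andP[j1 j2].
  have := int_le0_ge1 R j; have := int_le0_ge1 R (- j); rewrite intrN.
  by case=> ?; case=> ?; try lra; move: yx; rewrite jE (_ : j%:~R = 0 :> R) ?addr0 ?eqxx //; lra.
have yc : {for x, continuous (fun y => iter s0 H y - k0%:~R)}.
  by apply: continuousB; [exact: (iter_cont L)|exact: cst_continuous].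
have all_m n : \forall y \near x, y != x -> 1 < Dn (n.+1 * s0) y.
  elim: n => [|n IH]; first by rewrite mul1n.
  have IH' : \forall y \near x, iter s0 H y - k0%:~R != x -> 1 < Dn (n.+1 * s0) (iter s0 H y - k0%:~R).
    by move: yc; rewrite /prop_for /continuous_at k0E addrK => /(_ _ IH).
  near=> y => yx; rewrite (mulSn n.+1) DnD.
  have a1 : 1 < Dn s0 y by move: yx; near: y.
  have a2 : 1 < Dn (n.+1 * s0) (iter s0 H y).
    rewrite -(subrK k0%:~R (iter s0 H y)) (Dn_int L).
    have : iter s0 H y - k0%:~R != x -> 1 < Dn (n.+1 * s0) (iter s0 H y - k0%:~R) by near: y.
    apply; apply: contra yx => /eqP E; have {}E : iter s0 H y = iter s0 H x by rewrite k0E -E subrK.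
    by case: (ltgtP y x) => // /(iter_lt L s0); rewrite E ltxx.
  rewrite -[1]mulr1; apply: ltr_pM => //.
case: m m0 sE => // m _ ->; have [e /= e0 eP] := all_m m.
by exists e => // y yx yxe; apply: eP => //=; rewrite distrC.
Unshelve. all: by end_near. Qed.

Lemma Par_parabolic p : Par h p <-> exists2 x, toS x = p & parabolic H DH x.
Proof.
split=> [[s per D1]|[x <- [r r0 [[k kE] D1]]]].
  have [x xp] := toS_surj p; exists x => //; rewrite -xp in per D1.
  have [s0 _ _] := per.
  by exists s => //; split; [exact: has_period_lift|rewrite -cderive_iter].
have [s0 [m [per rE m0]]] := minimal_period r0 kE.
exists s0 => //; rewrite cderive_iter; have [k0 k0E] := has_period_lift per.
move: D1; rewrite rE (Dn_mul_periodic L m k0E) => /eqP.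
by rewrite pexpr_eq1 ?(ltW (Dn_gt0 L _ _)) // => /eqP.
Qed.

End lift_of_map.

(** * Operations on periodic functions of bounded variation *)

Section bv_periodic.
Variable R : realType.
Implicit Types (f g v G : R -> R).

Definition bv_periodic f := (forall x, f (x + 1) = f x) /\ exists v V, dominated f v V.

Lemma bv_periodicP f : (forall x, f (x + 1) = f x) -> bounded_variation 0 1 f -> bv_periodic f.
Proof. by move=> fS fbv; split=> //; exact: bounded_variation_dominated. Qed.

Lemma bv_periodic_bv f : bv_periodic f -> bounded_variation 0 1 f.
Proof.
move=> [_ [v [V [vm _ vl]]]]; exists (v 1 - v 0) => _ [s s01 <-].
have <- : variation 0 1 v s = v 1 - v 0.
  by apply: nondecreasing_variation => // x y _ _ /vm.
rewrite /variation !big_nat; apply: ler_sum => i /andP[_ si] /=.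
have [pth lst] := s01.
have le_i : nth 1 (0 :: s) i <= nth 1 (0 :: s) i.+1.
  by have /(pathP 1)/(_ i si)/ltW := pth.
rewrite distrC; apply: le_trans (vl _ _ le_i) _; exact: ler_norm.
Qed.

Lemma bv_periodic_bounded f : bv_periodic f -> exists2 B, 0 < B & forall x, `|f x| <= B.
Proof.
move=> [fS [v [V [vm vS vl]]]].
have V0 : 0 <= V.
  have := vS 0; have : v 0 <= v (0 + 1) by apply: vm; rewrite lerDl.
  by move=> ? ?; lra.
exists (`|f 0| + V + 1); first by have := normr_ge0 (f 0); lra.
move=> x; pose y := x - (Num.floor x)%:~R.
have -> : f x = f y by rewrite /y -mulrNz (periodic_int _ _ fS).
have /andP[y0 y1] : 0 <= y <= 1.
  by rewrite /y; have := floor_itv x; rewrite intrD -[1%:~R]/(1 : R) => /andP[]; lra.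
have := vl 0 y y0; have := vm _ _ y1; have := vS 0; rewrite add0r => vS0 vy.
have := ler_normB (f 0) (f 0 - f y); rewrite opprB addrCA subrr addr0.
by move=> h1 h2; lra.
Qed.

Lemma bv_periodicD f g : bv_periodic f -> bv_periodic g -> bv_periodic (fun x => f x + g x).
Proof.
move=> [fS [v [V [vm vS vl]]]] [gS [w [W [wm wS wl]]]]; split=> [x|]; first by rewrite fS gS.
exists (fun x => v x + w x), (V + W); split=> [x y xy|x|x y xy].
- by rewrite lerD // ?vm ?wm.
- by rewrite vS wS addrACA.
- have := ler_normD (f x - f y) (g x - g y); have := vl _ _ xy; have := wl _ _ xy.
  by rewrite opprD addrACA => ? ? ?; lra.
Qed.

Lemma bv_periodicM f g : bv_periodic f -> bv_periodic g -> bv_periodic (fun x => f x * g x).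
Proof.
move=> fb gb; have [A A0 fA] := bv_periodic_bounded fb; have [B B0 gB] := bv_periodic_bounded gb.
have [fS [v [V [vm vS vl]]]] := fb; have [gS [w [W [wm wS wl]]]] := gb.
split=> [x|]; first by rewrite fS gS.
exists (fun x => B * v x + A * w x), (B * V + A * W); split=> [x y xy|x|x y xy].
- by rewrite lerD // ler_wpM2l ?(ltW A0) ?(ltW B0) ?vm ?wm.
- by rewrite vS wS; ring.
- have -> : f x * g x - f y * g y = (f x - f y) * g x + f y * (g x - g y) by ring.
  have := ler_normD ((f x - f y) * g x) (f y * (g x - g y)); rewrite !normrM.
  have h1 : `|f x - f y| * `|g x| <= (v y - v x) * B by apply: ler_pM => //; exact: vl.
  have h2 : `|f y| * `|g x - g y| <= A * (w y - w x) by apply: ler_pM => //; exact: wl.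
  by move=> h; apply: le_trans h _; lra.
Qed.

Lemma bv_periodicV f m : 0 < m -> (forall x, m <= f x) -> bv_periodic f ->
  bv_periodic (fun x => (f x)^-1).
Proof.
move=> m0 fm [fS [v [V [vm vS vl]]]]; split=> [x|]; first by rewrite fS.
have m0' : 0 <= m ^- 2 by rewrite invr_ge0 exprn_ge0 // ltW.
have f0 x : 0 < f x by apply: lt_le_trans (fm x).
exists (fun x => m ^- 2 * v x), (m ^- 2 * V); split=> [x y xy|x|x y xy].
- by rewrite ler_wpM2l // vm.
- by rewrite vS mulrDr.
- have -> : (f x)^-1 - (f y)^-1 = ((f x)^-1 * (f y)^-1) * (f y - f x).
    by field; rewrite !gt_eqF.
  rewrite normrM distrC -mulrBr; apply: ler_pM => //; last exact: vl.
  rewrite ger0_norm ?mulr_ge0 ?invr_ge0 ?(ltW (f0 _)) // expr2 invfM.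
  by apply: ler_pM; rewrite ?invr_ge0 ?(ltW (f0 _)) // lef_pV2 ?posrE.
Qed.

Lemma bv_periodic_comp f G (k : int) : bv_periodic f -> {homo G : x y / x <= y} ->
  (forall x, G (x + 1) = G x + k%:~R) -> bv_periodic (fun x => f (G x)).
Proof.
move=> [fS [v [V [vm vS vl]]]] Gm GS; split=> [x|]; first by rewrite GS (periodic_int _ _ fS).
exists (fun x => v (G x)), (k%:~R * V); split=> [x y /Gm/vm|x|x y /Gm/vl] //.
by rewrite GS (quasi_periodic_int vS).
Qed.

Lemma bv_periodic_lip f (B : R) : (forall x, f (x + 1) = f x) ->
  (forall x y, `|f x - f y| <= B * `|x - y|) -> bv_periodic f.
Proof.
move=> fS fB; split=> //; have B0 : 0 <= B.
  by have := fB 0 1; rewrite sub0r normrN normr1 mulr1; apply: le_trans.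
exists (fun x => B * x), B; split=> [x y|x|x y xy]; first exact: ler_wpM2l.
  by rewrite mulrDr mulr1.
by apply: le_trans (fB x y) _; rewrite distrC ger0_norm ?subr_ge0 // mulrBr.
Qed.

Lemma bv_periodic_cst c : bv_periodic (fun _ => c).
Proof. by apply: (@bv_periodic_lip _ 0) => // x y; rewrite subrr normr0 mul0r. Qed.

Lemma bv_periodic_sum n (F : nat -> R -> R) : (forall i, bv_periodic (F i)) ->
  bv_periodic (fun x => \sum_(i < n) F i x).
Proof.
move=> Fb; elim: n => [|n IH].
  by rewrite (_ : (fun x => _) = (fun=> 0)); [exact: bv_periodic_cst|apply/funext => x; rewrite big_ord0].
rewrite (_ : (fun x => _) = (fun x => \sum_(i < n) F i x + F n x)); last first.
  by apply/funext => x; rewrite big_ord_recr.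
exact: bv_periodicD.
Qed.

End bv_periodic.

(** * Primitives of continuous functions *)

Section primitive.
Variable R : realType.
Implicit Types f F : R -> R.
Notation mu := (@lebesgue_measure R).

Lemma primitive_right f : continuous f -> exists F, forall x : R, -1 < x -> is_derive x (1 : R) F (f x).
Proof.
move=> fc; exists (fun x => \int[mu]_(t in [set` `[-1, x]]) f t) => x x1.
have fi : mu.-integrable [set` `[-1, x + 1]] (EFin \o f).
  apply: continuous_compact_integrable; first exact: segment_compact.
  exact: continuous_subspaceT.
have xx1 : x < x + 1 by rewrite ltrDl.
have := @continuous_FTC1_closed _ f (-1) x (x + 1) xx1 fi x1 (fc x) => -[h1 h2].
by apply: DeriveDef; [exact: h1|rewrite -derive1E; exact: h2].
Qed.

Lemma primitive_exists f : continuous f -> exists F, forall x, is_derive x (1 : R) F (f x).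
Proof.
move=> fc; have [F1 F1d] := primitive_right fc.
(* Integration from [-1] gives a primitive to the right of [-1] and, after a reflection, one to the
   left of 1. They differ by a constant on the overlap and are glued at 0. *)
have [|F2 F2d] := @primitive_right (fun x => f (- x)).
  by move=> x; apply: continuous_comp; [exact: opp_continuous|exact: fc].
pose G x := - F2 (- x).
have Gd (x : R) : x < 1 -> is_derive x (1 : R) G (f x).
  move=> x1; have h : is_derive (- x) (1 : R) F2 (f (- - x)) by apply: F2d; rewrite ltrN2.
  rewrite opprK in h.
  have : is_derive x (1 : R) (fun x => F2 (- x)) (f x * - 1).
    by apply: (@is_derive1_comp R F2 (fun x => - x)).
  by move=> h'; rewrite -[f x]opprK -[- f x]mulrN1; apply: is_deriveN.
have FG (x : R) : -1 < x -> x < 1 -> F1 x - G x = F1 0 - G 0.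
  move=> xm1 x1; have D (z : R) : -1 < z < 1 -> is_derive z (1 : R) (fun x => F1 x - G x) 0.
    by move=> /andP[z1 z2]; rewrite -[0](subrr (f z)); apply: is_deriveB; [exact: F1d|exact: Gd].
  have main (a b : R) : -1 < a -> b < 1 -> a < b -> F1 a - G a = F1 b - G b.
    move=> a1 b1 ab; have dG z : z \in `]a, b[ -> is_derive z 1 (fun x : R => F1 x - G x) 0.
      by rewrite in_itv /= => /andP[z1 z2]; apply: D; lra.
    have cG : {within `[a, b], continuous (fun x : R => F1 x - G x)}.
      apply: continuous_in_subspaceT => z; rewrite inE /= in_itv /= => /andP[z1 z2].
      by apply: is_derive_cts (D z _); lra.
    have [c _ /eqP] := MVT ab dG cG.
    by rewrite mul0r subr_eq0 => /eqP ->.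
  by case: (ltgtP x 0) => [x0|x0|-> //]; [|symmetry]; apply: main.
pose F x := if 0 < x then F1 x else G x + (F1 0 - G 0).
exists F => x; have [x0|x0] := ltP (-1) x; last first.
  have : is_derive x (1 : R) (fun x => G x + (F1 0 - G 0)) (f x + 0).
    by apply: is_deriveD; apply: Gd; lra.
  rewrite addr0; apply: is_derive_near; exists 1; first exact: ltr01.
  move=> t /=; rewrite /F ltr_norml => /andP[? ?]; case: ltP => //; lra.
have [x1|x1] := ltP x 1; last first.
  apply: is_derive_near (F1d x x0); exists 1; first exact: ltr01.
  move=> t /=; rewrite /F ltr_norml => /andP[? ?]; case: ltP => //; lra.
apply: is_derive_near (F1d x x0).
have e0 : 0 < Num.min (x + 1) (1 - x) by rewrite lt_min; lra.
exists (Num.min (x + 1) (1 - x)) => // t /=.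
rewrite /F lt_min ltr_norml ltr_norml => /andP[/andP[? ?] /andP[? ?]].
by case: ltP => // t0; rewrite -(FG t) ?subrKC // ?addrCA ?subrr ?addr0 //; lra.
Qed.

End primitive.

(** * Maps of the circle given by global lifts *)

Section global_lifts.
Local Open Scope quotient_scope.
Variable R : realType.
Local Notation S1 := (circle R).
Implicit Types (f g h : S1 -> S1) (F dF : R -> R).

Lemma is_cderive_global f F x a : (forall t, toS (F t) = f (toS t)) -> is_derive x (1 : R) F a ->
  is_cderive f (toS x) a.
Proof. by move=> Ff Fd; exists x, F; split=> //; exists 1 => [|t _] /=; [exact: ltr01|exact: Ff]. Qed.

Lemma C1_of_lift f F dF : (forall t, toS (F t) = f (toS t)) -> (forall x, is_derive x (1 : R) F (dF x)) ->
  continuous dF -> C1_on setT f /\ Dper f = dF.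
Proof.
move=> Ff Fd dFc; have fE : Dper f = dF.
  by apply/funext => x; exact: is_cderiveE (is_cderive_global Ff (Fd x)).
split=> // p _; have [x <-] := toS_surj p; split.
  by exists (dF x); exact: is_cderive_global Ff (Fd x).
by apply: continuous_at_toS; rewrite -[_ \o _]/(Dper f) fE; exact: dFc.
Qed.

Lemma C1_continuous f : C1_on setT f -> continuous f.
Proof. by move=> f1 p; have [/cderivableP/is_cderive_continuous fd _] := f1 p I. Qed.

Definition descend F : S1 -> S1 := fun p => toS (F (repr p)).

Lemma descendE F : (forall x, F (x + 1) = F x + 1) -> forall x, descend F (toS x) = toS (F x).
Proof.
move=> FS x; rewrite /descend.
have [k ->] := proj1 (toS_eq (repr (toS x)) x) (reprK (toS x)).
by rewrite (quasi_periodic_int FS) mulr1 toS_int.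
Qed.

End global_lifts.

(** * Conjugates of covering maps *)

Section covering_transport.
Local Open Scope quotient_scope.
Variables (T : topologicalType) (h phi psi : T -> T).
Hypotheses (phic : continuous phi) (psic : continuous psi).
Hypotheses (phiK : cancel phi psi) (psiK : cancel psi phi).

Lemma covering_map_conj : covering_map h -> covering_map (phi \o h \o psi).
Proof.
move=> [hc hs hV]; have cc : continuous (phi \o h \o psi).
  move=> p; apply: (@continuous_comp _ _ _ psi (phi \o h)); first exact: psic.
  by apply: continuous_comp; [exact: hc|exact: phic].
split=> // [q|q].
  by have [p pq] := hs (psi q); exists (phi p); rewrite /= phiK pq psiK.
have [V [Vo Vq [J [U [Uo Ut UV Ug]]]]] := hV (psi q).
have V'o : open (psi @^-1` V) by apply: open_comp Vo => x _; exact: psic.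
exists (psi @^-1` V); split=> //; exists J, (fun i => psi @^-1` (U i)); split=> [i|||i].
- by apply: open_comp (Uo i) => x _; exact: psic.
- by move=> i j _ _ [p [/= ip jp]]; apply: Ut => //; exists (psi p).
- apply/seteqP; split=> [p /=|p [i _ /= Up]].
    rewrite phiK => Vp; have : (h @^-1` V) (psi p) by [].
    by rewrite UV => -[i _ Up]; exists i.
  by rewrite phiK; have : (\bigcup_i U i) (psi p) by [exists i]; rewrite -UV.
- have [g [gU gc gK hg]] := Ug i; exists (phi \o g \o psi); split=> [p Vp|||p Vp] /=.
  + by rewrite phiK; exact: gU.
  + rewrite continuous_open_subspace // => p; rewrite inE /= => Vp.
    apply: (@continuous_comp _ _ _ psi (phi \o g)); first exact: psic.
    apply: (@continuous_comp _ _ _ g phi); last exact: phic.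
    by move: gc; rewrite continuous_open_subspace //; apply; rewrite inE.
  + by move=> p Up; rewrite phiK gK ?psiK.
  + by rewrite phiK hg // psiK.
Qed.

End covering_transport.

(** * The conjugacy with a given density *)

Section conjugation.
Variable R : realType.
Local Notation S1 := (circle R).
Variables (d : nat) (h : S1 -> S1) (H DH v : R -> R) (V : R).
Hypothesis hF : FdBV d h.
Hypothesis L : BV_lift d H DH v V.
Hypothesis Hh : forall x, toS (H x) = h (toS x).
Hypothesis DHE : Dper h = DH.
Local Notation Dn := (iter_deriv H DH).

Variables (Phi rho : R -> R).
Hypotheses (rho0 : forall x, 0 < rho x) (rhoc : continuous rho) (rhobv : bv_periodic rho).
Hypotheses (PhiS : forall x, Phi (x + 1) = Phi x + 1)
  (Phid : forall x, is_derive x (1 : R) Phi (rho x)).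

Lemma Phi_lt x y : x < y -> Phi x < Phi y.
Proof.
move=> xy; have [c _ E] := MVTle Phid (ltW xy).
by rewrite -subr_gt0 E mulr_gt0 // subr_gt0.
Qed.

Lemma Phi_cont : continuous Phi.
Proof. exact: is_derive_cont Phid. Qed.

Lemma Phi_int x (k : int) : Phi (x + k%:~R) = Phi x + k%:~R.
Proof. by rewrite (quasi_periodic_int PhiS) mulr1. Qed.

Lemma Phi_surj y : exists x, Phi x = y.
Proof.
pose k := Num.floor (y - Phi 0); have := floor_itv (y - Phi 0).
rewrite -/k intrD -[1%:~R]/(1 : R) => /andP[k1 k2].
have kk : (k%:~R : R) <= k%:~R + 1 by rewrite lerDl.
have fc : {within `[k%:~R, k%:~R + 1], continuous Phi}.
  by apply: continuous_subspaceT; exact: Phi_cont.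
have := @IVT _ _ _ _ y kk fc; have := Phi_int 0 k; rewrite add0r => E; rewrite PhiS E.
case; last by move=> c _ <-; exists c.
by rewrite ge_min le_max; apply/andP; split; apply/orP; [left|right]; lra.
Qed.

Definition Psi y := projT1 (cid (Phi_surj y)).

Lemma PsiK : cancel Psi Phi.
Proof. by move=> y; rewrite /Psi; case: cid. Qed.

Lemma PhiK : cancel Phi Psi.
Proof.
move=> x; have := PsiK (Phi x).
by case: (ltgtP (Psi (Phi x)) x) => // /Phi_lt hlt E; rewrite E ltxx in hlt.
Qed.

Lemma PsiS x : Psi (x + 1) = Psi x + 1.
Proof. by rewrite -{1}(PsiK x) -PhiS PhiK. Qed.

Lemma Psid x : is_derive x (1 : R) Psi (rho (Psi x))^-1.
Proof.
have := @is_derive_inverse R Phi Psi (rho (Psi x)) (Psi x); rewrite PsiK; apply.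
- by near=> t; exact: PhiK.
- by near=> t; exact: Phi_cont.
- by rewrite gt_eqF.
Unshelve. all: by end_near. Qed.

Lemma Psi_cont : continuous Psi.
Proof. exact: is_derive_cont Psid. Qed.

Lemma Psi_le : {homo Psi : x y / x <= y}.
Proof.
by move=> x y xy; rewrite leNgt; apply/negP => /Phi_lt; rewrite !PsiK ltNge xy.
Qed.

Let phi := descend Phi.
Let psi := descend Psi.
Let htilde := phi \o h \o psi.

Lemma phiE x : toS (Phi x) = phi (toS x). Proof. by rewrite /phi descendE. Qed.

Lemma psiE x : toS (Psi x) = psi (toS x). Proof. by rewrite /psi descendE //; exact: PsiS. Qed.

Lemma phiK : cancel phi psi.
Proof. by move=> p; have [x <-] := toS_surj p; rewrite -phiE -psiE PhiK. Qed.

Lemma psiK : cancel psi phi.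
Proof. by move=> p; have [x <-] := toS_surj p; rewrite -psiE -phiE PsiK. Qed.

Lemma rhoPsi_cont : continuous (fun x => (rho (Psi x))^-1).
Proof.
move=> x; apply: continuousV; first by rewrite gt_eqF.
by apply: continuous_comp; [exact: Psi_cont|exact: rhoc].
Qed.

Lemma rhoS x : rho (x + 1) = rho x. Proof. exact: (proj1 rhobv). Qed.

Lemma rhoV_bv : bv_periodic (fun x => (rho x)^-1).
Proof.
by have [m m0 rm] := periodic_pos_lb rhoc rhoS rho0; exact: bv_periodicV m0 rm rhobv.
Qed.

Lemma phi_C1 : C1_on setT phi /\ Dper phi = rho.
Proof. exact: C1_of_lift phiE Phid rhoc. Qed.

Lemma psi_C1 : C1_on setT psi /\ Dper psi = (fun x => (rho (Psi x))^-1).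
Proof. exact: C1_of_lift psiE Psid rhoPsi_cont. Qed.

Lemma Psi_bv f : bv_periodic f -> bv_periodic (fun x => f (Psi x)).
Proof. by move=> fb; apply: (@bv_periodic_comp _ f Psi 1 fb Psi_le); exact: PsiS. Qed.

Lemma phi_C1BV : C1BV phi.
Proof. by have [h1 h2] := phi_C1; split=> //; rewrite h2; exact: bv_periodic_bv. Qed.

Lemma psi_C1BV : C1BV psi.
Proof.
have [h1 h2] := psi_C1; split=> //; rewrite h2; apply: bv_periodic_bv.
exact: (Psi_bv rhoV_bv).
Qed.

Lemma htilde_iter n p : iter n htilde (phi p) = phi (iter n h p).
Proof. by elim: n => //= n ->; rewrite /htilde /= phiK. Qed.

Lemma htilde_cderive n x :
  is_cderive (iter n htilde) (toS (Phi x)) (rho (iter n H x) * Dn n x * (rho x)^-1).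
Proof.
apply: (@is_cderive_global _ _ (fun t => Phi (iter n H (Psi t)))).
  by move=> t; rewrite phiE (toS_iter Hh) psiE -htilde_iter psiK.
have D y : is_derive y (1 : R) (fun t => Phi (iter n H (Psi t)))
    (rho (iter n H (Psi y)) * (Dn n (Psi y) * (rho (Psi y))^-1)).
  apply: (@is_derive1_comp R Phi (fun t => iter n H (Psi t))).
  apply: (@is_derive1_comp R (iter n H) Psi); first exact: iter_derive L n _.
  exact: Psid.
by have := D (Phi x); rewrite PhiK mulrA.
Qed.

(** Used by contraposition: a point off [Par htilde] comes from a point off [Par h], where the
    density is strictly expanded. *)
Lemma htilde_Par p : Par h p -> Par htilde (phi p).
Proof.
have [x <-] := toS_surj p => -[s per D1]; exists s.
  have [s0 hs smin] := per; split=> // [|j /smin hj]; first by rewrite htilde_iter hs.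
  by rewrite htilde_iter => /(can_inj phiK).
rewrite -phiE; have := is_cderiveE (htilde_cderive s x).
have [k kE] := has_period_lift Hh per; rewrite kE (periodic_int _ _ rhoS) => ->.
by rewrite -(cderive_iter L Hh s x) D1 mulr1 divff // gt_eqF.
Qed.

Lemma htilde_FdBV : FdBV d htilde.
Proof.
have [d0 hcov _ hloc [h1 hbv]] := hF.
have phi1 := proj1 phi_C1; have psi1 := proj1 psi_C1.
have phic := C1_continuous phi1; have psic := C1_continuous psi1.
split=> //.
- exact: (covering_map_conj phic psic phiK psiK hcov).
- exists (fun x => Phi (H (Psi x))); split.
  + move=> x; apply: (@continuous_comp _ _ _ Psi (Phi \o H)); first exact: Psi_cont.
    by apply: continuous_comp; [exact: (iter_cont L 1)|exact: Phi_cont].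
  + by move=> x; rewrite phiE Hh psiE.
  + by move=> x; rewrite PsiS (liftS L) -(Phi_int _ d%:Z).
- move=> p; have [U [g [[Uo Up hUo] [hU gU gK]]]] := hloc (psi p).
  have hUE : htilde @` (psi @^-1` U) = psi @^-1` (h @` U).
    apply/seteqP; split=> [_ [q Uq <-]|q [q' Uq' q'E]] /=.
      by exists (psi q) => //; rewrite /htilde /= phiK.
    by exists (phi q'); rewrite /htilde /= phiK // q'E psiK.
  exists (psi @^-1` U), (phi \o g \o psi); split; split=> //.
  + by apply: open_comp Uo => x _; exact: psic.
  + by rewrite hUE; apply: open_comp hUo => x _; exact: psic.
  + have -> : htilde = phi \o (h \o psi) by [].
    apply: (@C1_on_comp R (psi @^-1` U) setT) => //.
      by apply: open_comp Uo => x _; exact: psic.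
    apply: (@C1_on_comp R (psi @^-1` U) U) => //.
      by apply: open_comp Uo => x _; exact: psic.
    by move=> q _; exact: psi1.
  + rewrite hUE; have oV : open (psi @^-1` (h @` U)).
      by apply: open_comp hUo => x _; exact: psic.
    have -> : phi \o g \o psi = phi \o (g \o psi) by [].
    apply: (@C1_on_comp R (psi @^-1` (h @` U)) setT) => //.
    apply: (@C1_on_comp R (psi @^-1` (h @` U)) (h @` U)) => //.
    by move=> q _; exact: psi1.
  + by move=> q Uq; rewrite /htilde /= phiK gK ?psiK.
- have [|||] := @C1_of_lift R htilde (fun x => Phi (H (Psi x)))
    (fun x => rho (H (Psi x)) * DH (Psi x) * (rho (Psi x))^-1).
  + by move=> x; rewrite phiE Hh psiE.
  + move=> x; rewrite -mulrA; apply: (@is_derive1_comp R Phi (fun t => H (Psi t))).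
    by apply: (@is_derive1_comp R H Psi); [exact: (lift_derive L)|exact: Psid].
  + move=> x; apply: (@continuousM _ _ (fun x => rho (H (Psi x)) * DH (Psi x))); last exact: rhoPsi_cont.
    apply: (@continuous_comp _ _ _ Psi (fun y => rho (H y) * DH y)); first exact: Psi_cont.
    apply: continuousM; last exact: (lift_cont L).
    by apply: continuous_comp; [exact: (iter_cont L 1)|exact: rhoc].
  + move=> c1 DE; split=> //; rewrite DE; apply: bv_periodic_bv.
    apply: (@Psi_bv (fun y => rho (H y) * DH y * (rho y)^-1)).
    apply: bv_periodicM rhoV_bv; apply: bv_periodicM.
      apply: (@bv_periodic_comp _ rho H d%:Z rhobv); last exact: (liftS L).
      by move=> x y; rewrite (iter_leE L 1).
    by apply: bv_periodicP; [exact: (DHS L)|rewrite -DHE].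
Qed.

Lemma conj_of_Phi (K : set (S1 -> S1)) :
  (forall x, ~ parabolic H DH x -> rho x < rho (H x) * DH x) -> K phi ->
  conj_to_expanding K d h.
Proof.
move=> rhoH Kphi; exists htilde, phi; split=> //.
- split; first exact: htilde_FdBV.
  move=> p pP; have [x xp] := toS_surj (psi p); have pE : p = toS (Phi x) by rewrite phiE xp psiK.
  have xP : ~ parabolic H DH x.
    move=> px; apply: pP; rewrite pE phiE; apply: htilde_Par.
    by apply/(Par_parabolic L Hh); exists x.
  have := is_cderiveE (htilde_cderive 1 x); rewrite pE /= => ->.
  by rewrite ltr_pdivlMr // mul1r (DnS H DH 0) Dn0 mul1r; exact: rhoH.
- exists psi; split; [exact: phiK|exact: psiK|exact: phi_C1BV|exact: psi_C1BV].
- by rewrite /conjugates /htilde; apply/funext => p /=; rewrite phiK.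
Qed.

End conjugation.

Section conjugation_of_density.
Variable R : realType.
Local Notation S1 := (circle R).
Variables (d : nat) (h : S1 -> S1) (H DH v : R -> R) (V : R).
Hypothesis hF : FdBV d h.
Hypothesis L : BV_lift d H DH v V.
Hypothesis Hh : forall x, toS (H x) = h (toS x).
Hypothesis DHE : Dper h = DH.

(** The constant [c] makes the primitive increase by 1 over a period. Membership in [K] is tested
    for every such [c], so that a regularity class only has to be stable under scaling and
    primitives. *)
Lemma conj_of_density (K : set (S1 -> S1)) (rho : R -> R) :
  continuous rho -> bv_periodic rho -> (forall x, 0 < rho x) ->
  (forall x, ~ parabolic H DH x -> rho x < rho (H x) * DH x) ->
  (forall (c : R) (Phi : R -> R) phi, (forall x : R, is_derive x (1 : R) Phi (c * rho x)) ->
     (forall x : R, toS (Phi x) = phi (toS x)) -> C1_on setT phi -> Dper phi = (fun x => c * rho x) -> K phi) ->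
  conj_to_expanding K d h.
Proof.
move=> rhoc rhob rho0 rhoH Kphi; have [F Fd] := primitive_exists rhoc.
have F01 : 0 < F 1 - F 0.
  have [c _ ->] := MVTle Fd ler01; rewrite subr0 mulr1; exact: rho0.
have FS x : F (x + 1) = F x + (F 1 - F 0).
  have -> : F 1 = F (0 + 1) by rewrite add0r.
  have D y : is_derive y (1 : R) (fun x => F (x + 1) - F x) 0.
    rewrite -[0](subrr (rho y)); apply: is_deriveB.
    by apply: is_derive_shiftr; rewrite -(proj1 rhob y).
  by rewrite -(is_derive_0_is_cst x 0 D); ring.
pose c := (F 1 - F 0)^-1; have c0 : 0 < c by rewrite invr_gt0.
pose Phi x := c * F x.
have Phid (x : R) : is_derive x (1 : R) Phi (c * rho x) by exact: is_deriveZ.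
have PhiS x : Phi (x + 1) = Phi x + 1 by rewrite /Phi FS mulrDr mulVf // gt_eqF.
have crho0 x : 0 < c * rho x by rewrite mulr_gt0.
have crhoc : continuous (fun x => c * rho x).
  by move=> x; apply: (@continuousM R R (fun=> c) rho); [exact: cst_continuous|exact: rhoc].
have crhob : bv_periodic (fun x => c * rho x).
  by apply: bv_periodicM; [exact: bv_periodic_cst|].
apply: (@conj_of_Phi R d h H DH v V hF L Hh DHE Phi (fun x => c * rho x)) => //.
  by move=> x /rhoH; rewrite -mulrA ltr_pM2l.
have [h1 h2] := C1_of_lift (fun x => esym (descendE PhiS x)) Phid crhoc.
by apply: Kphi Phid _ h1 h2 => x; rewrite descendE.
Qed.

End conjugation_of_density.

(** * Smooth corrections of the density *)

Section smoothing.
Variable R : realType.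
Implicit Types (w kap : R -> R) (e x : R).

Lemma truncn_lt (e : R) n : 0 < e -> (Num.truncn (1 / e) <= n)%N -> n.+1%:R^-1 < e.
Proof.
move=> e0 en; rewrite -[ltRHS]invrK ltf_pV2 ?posrE ?ltr0n ?invr_gt0 //.
by rewrite -[e^-1]mul1r; apply: lt_le_trans (truncnS_gt _) _; rewrite ler_nat.
Qed.

Lemma periodic_unif_continuous w e : continuous w -> (forall x, w (x + 1) = w x) -> 0 < e ->
  exists2 dl : R, 0 < dl & forall x y, `|y - x| < dl -> `|w y - w x| < e.
Proof.
move=> wc wS e0; apply: contrapT => no.
have seq n : exists z : R * R, [/\ 0 <= z.1 <= 1, `|z.2 - z.1| < n.+1%:R^-1 & e <= `|w z.2 - w z.1|].
  apply: contrapT => noz; apply: no; exists n.+1%:R^-1; first by rewrite invr_gt0 ltr0n.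
  move=> x y xy; rewrite ltNge; apply/negP => le_e; apply: noz.
  exists (frac x, y - (Num.floor x)%:~R); split=> /=; first exact: frac01.
    by rewrite /frac opprB addrA subrK.
  by rewrite /frac -mulrNz !(periodic_int _ _ wS).
have [s sP] := choice seq.
have [|y' y'P] := @diagonal_limit R (fun n _ => (s n).1); first by move=> n _; have [] := sP n.
have e2 : 0 < e / 2 by lra.
have [dl dl0 dlP] : exists2 dl : R, 0 < dl & forall y : R, `|y - y' 0%N| < dl -> `|w y - w (y' 0%N)| < e / 2.
  by have /continuousE := wc; exact.
have dl2 : 0 < dl / 2 by lra.
have [n nN nP] := y'P 0%N (dl / 2) (Num.truncn (1 / (dl / 2))) dl2.
have [_ s1 s2] := sP n; have {}nP : `|(s n).1 - y' 0%N| < dl / 2 := nP 0%N (leqnn _); have hn := lt_trans s1 (truncn_lt dl2 nN).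
have d1 : `|w (s n).1 - w (y' 0%N)| < e / 2 by apply: dlP; lra.
have d2 : `|w (s n).2 - w (y' 0%N)| < e / 2.
  by apply: dlP; have := ler_distD (s n).1 (s n).2 (y' 0%N); lra.
by have := ler_distD (w (y' 0%N)) (w (s n).2) (w (s n).1); rewrite (distrC (w (y' 0%N))); lra.
Qed.

(* Averages of the values [w (j / N)], with the positive weights
   [(2 - kap (x - j / N)) ^+ n], which concentrate near [x] as [n] grows. *)
Definition weight kap N n x := \sum_(j < N) (2 - kap (x - j%:R / N%:R)) ^+ n.

Definition smoothing w kap N n x :=
  (\sum_(j < N) w (j%:R / N%:R) * (2 - kap (x - j%:R / N%:R)) ^+ n) / weight kap N n x.

Lemma exprn_small (a e : R) : 0 < a < 1 -> 0 < e -> exists n, a ^+ n < e.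
Proof.
move=> /andP[a0 a1] e0; have a1' : `|a| < 1 by rewrite gtr0_norm.
have /cvgrPdist_lt /(_ _ e0) [n _ nP] := cvg_expr a1'.
exists n; have := nP n (leqnn _); rewrite sub0r normrN; apply: le_lt_trans; exact: ler_norm.
Qed.

Variable kap : R -> R.
Hypotheses (kapc : continuous kap) (kapS : forall x, kap (x + 1) = kap x).
Hypothesis kap01 : forall x, 0 <= kap x <= 1.
Hypothesis kap0 : forall x, kap x = 0 <-> exists k : int, x = k%:~R.

Lemma kap2_ge1 x : 1 <= 2 - kap x. Proof. by have := kap01 x; lra. Qed.

Lemma kap2X_ge0 n x : 0 <= (2 - kap x) ^+ n.
Proof. by apply: exprn_ge0; have := kap2_ge1 x; lra. Qed.

Lemma weight_gt0 N n x : (0 < N)%N -> 0 < weight kap N n x.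
Proof.
case: N => // N _; rewrite /weight big_ord_recl; apply: ltr_pwDl.
  by apply: exprn_gt0; apply: lt_le_trans (kap2_ge1 _).
by apply: sumr_ge0 => i _; exact: kap2X_ge0.
Qed.

Lemma smoothing_approx w e : continuous w -> (forall x, w (x + 1) = w x) -> 0 < e ->
  exists N n, (0 < N)%N /\ forall x, `|smoothing w kap N n x - w x| <= e.
Proof.
move=> wc wS e0; have e2 : 0 < e / 2 by lra.
have [dl dl0 dlP] := periodic_unif_continuous wc wS e2.
have [B B0 wB] := periodic_bounded wc wS.
have kap_ge0 x : 0 <= kap x by have := kap01 x; lra.
have [||eta1 eta10 eta1P] := near_zero (Q := fun t => exists m : int, `|t - m%:~R| < dl) kapc kapS kap_ge0.
- move=> x k [m mP]; exists (m - k); rewrite intrB opprB addrA; exact: mP.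
- by move=> y /kap0[k ->]; exists dl => // x xk; exists k.
have [eta [eta0 eta_le1 etaP]] : exists eta : R, [/\ 0 < eta, eta <= 1 &
    forall t, kap t < eta -> exists m : int, `|t - m%:~R| < dl].
  exists (Num.min eta1 1); split=> [||t]; first by rewrite lt_min eta10 ltr01.
    by rewrite ge_min lexx orbT.
  by rewrite lt_min => /andP[/eta1P].
have eta2 : 0 < eta / 2 by lra.
have [dl' dl'0 dl'P] : exists2 dl : R, 0 < dl & forall y : R, `|y - 0| < dl -> `|kap y - kap 0| < eta / 2.
  by have /continuousE := kapc; exact.
have kap00 : kap 0 = 0 by apply/kap0; exists 0.
(* Grid points away from [x] have weights at most [a ^+ n], while one grid point, within
   [1 / N < dl'] of [x] modulo 1, has weight at least [b ^+ n]. As [a < b] and [N] is fixed first, a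
   large [n] makes the far terms negligible. *)
pose N := (Num.truncn (1 / dl')).+1; pose a := 2 - eta; pose b := 2 - eta / 2.
have N0 : 0 < (N%:R : R) by rewrite ltr0n.
have a_gt0 : 0 < a by rewrite /a; lra.
have b_gt0 : 0 < b by rewrite /b; lra.
have ab1 : 0 < a / b < 1 by rewrite divr_gt0 //= ltr_pdivrMr // mul1r /a /b; lra.
have e4 : 0 < e / 2 / (2 * B * N%:R) by rewrite divr_gt0 // mulr_gt0 // mulr_gt0.
have [n nP] := exprn_small ab1 e4.
exists N, n; split=> // x; pose K (j : 'I_N) := (2 - kap (x - j%:R / N%:R)) ^+ n.
have K0 j : 0 <= K j by exact: kap2X_ge0.
have W0 : 0 < weight kap N n x by exact: weight_gt0.
have b0 : 0 < b ^+ n by apply: exprn_gt0; rewrite /b; lra.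
have Wb : b ^+ n <= weight kap N n x.
  have [f0 f1] : 0 <= x - (Num.floor x)%:~R /\ x - (Num.floor x)%:~R < 1.
    by have := floor_itv x; rewrite intrD -[1%:~R]/(1 : R) => /andP[]; lra.
  set u := x - _ in f0 f1; have uN : 0 <= u * N%:R by rewrite mulr_ge0 // ltW.
  pose j0 := Num.truncn (u * N%:R); have /andP[j0l j0u] := truncn_itv uN; rewrite -/j0 in j0l j0u.
  have j0N : (j0 < N)%N.
    rewrite -(ltr_nat R); apply: le_lt_trans j0l _.
    by rewrite -[ltRHS]mul1r ltr_pM2r.
  rewrite /weight (bigD1 (Ordinal j0N)) //=; apply: ler_wpDr; first by apply: sumr_ge0 => i _; exact: kap2X_ge0.
  have -> : x - j0%:R / N%:R = u - j0%:R / N%:R + (Num.floor x)%:~R by rewrite /u; ring.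
  rewrite (periodic_int _ _ kapS); apply: lerXn2r; rewrite ?nnegrE /b; first lra.
    by have := kap01 (u - j0%:R / N%:R); lra.
  have : `|u - j0%:R / N%:R - 0| < dl'.
    rewrite subr0 ger0_norm; last by rewrite subr_ge0 ler_pdivrMr.
    apply: lt_trans (truncn_lt dl'0 (leqnn _)); rewrite -/N.
    have -> : u - j0%:R / N%:R = (u * N%:R - j0%:R) / N%:R by field; rewrite gt_eqF.
    by rewrite -[ltRHS]mul1r ltr_pM2r ?invr_gt0 //; rewrite -natr1 in j0u; lra.
  by move=> /dl'P; rewrite kap00 subr0 ltr_norml; lra.
have term (j : 'I_N) : `|(w (j%:R / N%:R) - w x) * K j| <= e / 2 * K j + 2 * B * a ^+ n.
  rewrite normrM (ger0_norm (K0 j)).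
  have an : 0 <= 2 * B * a ^+ n by rewrite mulr_ge0 ?exprn_ge0 /a //; lra.
  have [lt|ge] := ltP (kap (x - j%:R / N%:R)) eta.
    have [m mP] := etaP _ lt; apply: ler_wpDr => //; apply: ler_wpM2r => //; apply: ltW.
    by rewrite -(periodic_int (j%:R / N%:R) m wS); apply: dlP; rewrite distrC opprD addrA.
  apply: ler_wpDl; first by rewrite mulr_ge0 // ltW.
  apply: ler_pM => //; first by have := ler_normB (w (j%:R / N%:R)) (w x);
    have := wB (j%:R / N%:R); have := wB x; lra.
  by apply: lerXn2r; rewrite ?nnegrE /a; have := kap01 (x - j%:R / N%:R); lra.
have -> : smoothing w kap N n x - w x = (\sum_(j < N) (w (j%:R / N%:R) - w x) * K j) / weight kap N n x.
  rewrite /smoothing; under [in RHS]eq_bigr do rewrite mulrBl.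
  rewrite sumrB -mulr_sumr -/(weight kap N n x) mulrBl mulfK ?gt_eqF //.
rewrite normrM normfV (gtr0_norm W0) ler_pdivrMr //.
apply: le_trans (ler_norm_sum _ _ _) _; apply: le_trans (ler_sum _ (fun j _ => term j)) _.
rewrite big_split /= -mulr_sumr -/(weight kap N n x) sumr_const card_ord -mulr_natr.
have small : 2 * B * a ^+ n * N%:R <= e / 2 * b ^+ n.
  move: nP; rewrite expr_div_n ltr_pdivrMr // mulrAC ltr_pdivlMr ?mulr_gt0 // => /ltW.
  by apply: le_trans; rewrite [leRHS]mulrC mulrAC.
have := ler_wpM2l (ltW e2) Wb; lra.
Qed.

End smoothing.

(** * Trigonometric polynomials with prescribed zeros *)

Section bump.
Variable R : realType.
Implicit Types (x p : R) (ps : seq R).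

(* [sin^2 (pi x)] *)
Definition bump x : R := (1 - cos (x * (pi *+ 2))) / 2.

Lemma bumpS x : bump (x + 1) = bump x.
Proof. by rewrite /bump [(x + 1) * _]mulrDl mul1r cosD2pi. Qed.

Lemma bump_cont : continuous bump.
Proof.
move=> x; apply: (@continuousM R R (fun x => 1 - cos (x * (pi *+ 2))) (fun=> 2^-1)); last exact: cst_continuous.
apply: (@continuousB R R R (fun=> 1) (fun x => cos (x * (pi *+ 2)))); first exact: cst_continuous.
apply: (@continuous_comp _ _ _ (fun x => x * (pi *+ 2)) cos); last exact: continuous_cos.
exact: mulrr_continuous.
Qed.

Lemma bump01 x : 0 <= bump x <= 1.
Proof. by have := cos_geN1 (x * (pi *+ 2)); have := cos_le1 (x * (pi *+ 2)); rewrite /bump; lra. Qed.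

Lemma bump_eq0 x : bump x = 0 <-> exists k : int, x = k%:~R.
Proof.
split=> [|[k ->]]; last first.
  rewrite -[k%:~R]add0r (periodic_int 0 k bumpS) /bump mul0r cos0 subrr mul0r //.
have [f0 f1] : 0 <= x - (Num.floor x)%:~R /\ x - (Num.floor x)%:~R < 1.
  by have := floor_itv x; rewrite intrD -[1%:~R]/(1 : R) => /andP[]; lra.
rewrite -(subrK (Num.floor x)%:~R x) (periodic_int _ (Num.floor x) bumpS).
set u := x - _ in f0 f1 *; move=> bu; exists (Num.floor x).
move: f0; rewrite le_eqVlt => /predU1P[<-|u0]; first by rewrite add0r.
exfalso; have : 0 < sin (u * pi).
  by apply: sin_gt0_pi; rewrite mulr_gt0 ?pi_gt0 //= -[ltRHS]mul1r ltr_pM2r ?pi_gt0.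
have : cos (u * (pi *+ 2)) = 1 by move: bu; rewrite /bump; lra.
rewrite mulrnAr cos_mulr2n cos2sin2 => E s0; have : 0 < sin (u * pi) ^+ 2 by exact: exprn_gt0.
by move: E; rewrite mulr2n; lra.
Qed.

(** With [ps] representing the parabolic points, this is the function [q] of the density
    constructions. *)
Definition bumps ps x : R := \prod_(p <- ps) bump (x - p).

Lemma bumpsS ps x : bumps ps (x + 1) = bumps ps x.
Proof. by apply: eq_bigr => p _; rewrite addrAC bumpS. Qed.

Lemma bumps_cont ps : continuous (bumps ps).
Proof.
elim: ps => [|p ps IH] x.
  rewrite (_ : bumps [::] = cst 1); first exact: cst_continuous.
  by apply/funext => y; rewrite /bumps big_nil.
rewrite (_ : bumps (p :: ps) = (fun y => bump (y - p) * bumps ps y)); last first.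
  by apply/funext => y; rewrite /bumps big_cons.
apply: (@continuousM R R (fun y => bump (y - p)) (bumps ps)); last exact: IH.
apply: (@continuous_comp _ _ _ (fun y => y - p) bump); last exact: bump_cont.
by apply: continuousB; [exact: id|exact: cst_continuous].
Qed.

Lemma bumps01 ps x : 0 <= bumps ps x <= 1.
Proof.
elim: ps => [|p ps /andP[h0 h1]]; first by rewrite /bumps big_nil ler01 lexx.
have /andP[b0 b1] := bump01 (x - p).
by rewrite /bumps big_cons mulr_ge0 //= -[leRHS]mulr1 ler_pM.
Qed.

Lemma bumps_eq0 ps x : bumps ps x = 0 <-> exists2 p, p \in ps & exists k : int, x = p + k%:~R.
Proof.
split=> [/eqP|[p pps [k ->]]].
  rewrite prodf_seq_eq0 => /hasP[p pps /= /eqP/bump_eq0[k kE]].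
  by exists p => //; exists k; rewrite -kE addrC subrK.
apply/eqP; rewrite prodf_seq_eq0; apply/hasP; exists p => //=.
by rewrite addrAC subrr add0r; apply/eqP/bump_eq0; exists k.
Qed.

End bump.

(** * Classes of differentiable periodic functions *)

Section differentiability_classes.
Variable R : realType.
Implicit Types (eps : R) (f g : R -> R) (A : set (R -> R)).

Definition periodic1 f := forall x, f (x + 1) = f x.

(** Leaving open the condition [A] on the last derivative treats continuous and Hoelder derivatives
    together. *)
Fixpoint Cn A n f := if n is m.+1 then
  periodic1 f /\ exists f', (forall x, is_derive x (1 : R) f (f' x)) /\ Cn A m f'
  else A f.

Definition per_cont : set (R -> R) := [set f | periodic1 f /\ continuous f].

Definition per_hoelder (eps : R) : set (R -> R) := [set f | periodic1 f /\ Defs.hoelder eps f].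

Definition smooth f := forall n, Cn per_cont n f.

(** What the inductions on the number of derivatives require of [A]. By [reg_C1], derivatives of
    lower order also belong to [A] and can be multiplied by the last one. *)
Record regularity A : Prop := Regularity {
  reg_cont : forall f, A f -> per_cont f;
  reg_C1 : forall f f', periodic1 f -> (forall x, is_derive x (1 : R) f (f' x)) ->
    per_cont f' -> A f;
  regD : forall f g, A f -> A g -> A (fun x => f x + g x);
  regM : forall f g, A f -> A g -> A (fun x => f x * g x);
  reg_comp : forall f (G DG : R -> R) (k : int), A f -> (forall x, G (x + 1) = G x + k%:~R) ->
    (forall x, is_derive x (1 : R) G (DG x)) -> per_cont DG -> A (fun x => f (G x)) }.

Lemma periodic_derive f f' : periodic1 f -> (forall x, is_derive x (1 : R) f (f' x)) -> periodic1 f'.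
Proof.
move=> fS fd x; have d1 := is_derive_shiftr (fd (x + 1)); apply: is_derive_uniq d1 _.
by rewrite (_ : (fun y => f (y + 1)) = f) //; apply/funext => y; rewrite fS.
Qed.

Lemma per_cont_regularity : regularity per_cont.
Proof.
split=> // [f f' fS fd _|f g [fS fc] [gS gc]|f g [fS fc] [gS gc]|f G DG k [fS fc] GS Gd _].
- by split=> //; exact: is_derive_cont fd.
- split=> [x|x]; first by rewrite fS gS.
  by apply: (@continuousD R R R f g); [exact: fc|exact: gc].
- split=> [x|x]; first by rewrite fS gS.
  by apply: (@continuousM R R f g); [exact: fc|exact: gc].
- split=> [x|x]; first by rewrite GS (periodic_int _ _ fS).
  by apply: continuous_comp; [exact: (is_derive_cont Gd)|exact: fc].
Qed.

Lemma le_powRl (a b eps : R) : 0 <= eps -> 0 <= a -> a <= b -> a `^ eps <= b `^ eps.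
Proof.
by move=> e0 a0 ab; apply: ge0_ler_powR; rewrite ?nnegrE // (le_trans a0 ab).
Qed.

Lemma one_powR (eps : R) : 1 `^ eps = 1 :> R. Proof. by rewrite powR1. Qed.

Lemma hoelder_bounded eps f : 0 < eps -> per_hoelder eps f -> exists2 B, 0 <= B & forall x, `|f x| <= B.
Proof.
move=> e0 [fS [C CP]]; have C0 : 0 <= C.
  by have := CP 1 0; rewrite subr0 normr1 powR1 mulr1; apply: le_trans.
exists (`|f 0| + C); first by rewrite addr_ge0.
move=> x; rewrite -(periodic_int x (- Num.floor x) fS) mulrNz; set u := x - _.
have [f0 f1] : 0 <= u /\ u < 1.
  by have := floor_itv x; rewrite intrD -[1%:~R]/(1 : R) /u => /andP[]; lra.
have h1 : `|f u - f 0| <= C * u `^ eps by have := CP u 0; rewrite subr0 (ger0_norm f0).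
have h2 : C * u `^ eps <= C.
  by rewrite ler_piMr // -(one_powR eps) le_powRl // ltW.
have := ler_normD (f u - f 0) (f 0); rewrite subrK => h3.
by apply: le_trans h3 _; rewrite [leRHS]addrC lerD2r; exact: le_trans h1 h2.
Qed.

Lemma hoelder_ge0 eps f C : (forall x y, `|f x - f y| <= C * `|x - y| `^ eps) -> 0 <= C.
Proof. by move=> /(_ 1 0); rewrite subr0 normr1 powR1 mulr1; apply: le_trans. Qed.

(** For [eps <= 1] the Lipschitz bound suffices at distances up to 1; beyond, the bound of a
    periodic function takes over. *)
Lemma lipschitz_hoelder eps f B : 0 < eps <= 1 -> periodic1 f -> continuous f ->
  (forall x y, `|f x - f y| <= B * `|x - y|) -> Defs.hoelder eps f.
Proof.
move=> /andP[e0 e1] fS fc fB; have [M M0 fM] := periodic_bounded fc fS.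
have B0 : 0 <= B.
  by have := fB 0 1; rewrite sub0r normrN normr1 mulr1; apply: le_trans.
exists (B + 2 * M) => x y; have p0 := powR_ge0 `|x - y| eps.
have [le1|gt1] := leP `|x - y| 1.
  have : `|x - y| <= `|x - y| `^ eps.
    have [/eqP xy|xy] := boolP (x - y == 0); first by rewrite xy normr0.
    by rewrite ger1_powR // normr_gt0 xy le1.
  move=> h; apply: le_trans (fB x y) _.
  have := ler_wpM2l B0 h; have := mulr_ge0 (ltW M0) p0; lra.
have : 1 <= `|x - y| `^ eps by rewrite -(one_powR eps) le_powRl // ltW.
move=> h; have := fM x; have := fM y; have := ler_normB (f x) (f y).
have := mulr_ge0 B0 p0; have := ler_wpM2l (ltW M0) h; lra.
Qed.

Lemma per_hoelder_regularity eps : 0 < eps <= 1 -> regularity (per_hoelder eps).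
Proof.
move=> e01; have /andP[e0 e1] := e01.
have hc f : per_hoelder eps f -> per_cont f.
  move=> [fS [C CP]]; split=> //; have C0 := hoelder_ge0 CP; apply/continuousE => x e e_gt0.
  exists ((e / (C + 1)) `^ eps^-1); first by rewrite powR_gt0 // divr_gt0 //; lra.
  move=> y yx; apply: le_lt_trans (CP y x) _.
  have en : eps != 0 by rewrite gt_eqF.
  have h : `|y - x| `^ eps <= e / (C + 1).
    have E : e / (C + 1) = ((e / (C + 1)) `^ eps^-1) `^ eps.
      by rewrite -powRrM mulVf // powRr1 // divr_ge0 //; lra.
    by rewrite [leRHS]E le_powRl ?(ltW e0) // ltW.
  apply: le_lt_trans (ler_wpM2l C0 h) _; rewrite mulrA ltr_pdivrMr; last lra.
  by rewrite mulrC ltr_pM2l //; lra.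
have lip f f' : periodic1 f -> (forall x, is_derive x (1 : R) f (f' x)) -> per_cont f' ->
    exists B, forall x y, `|f x - f y| <= B * `|x - y|.
  move=> fS fd [f'S f'c]; have [B B0 f'B] := periodic_bounded f'c f'S; exists B => x y.
  wlog xy : x y / x <= y.
    by move=> W; have [/W//|/ltW/W] := leP x y; rewrite distrC (distrC y).
  have [c _] := MVTle fd xy; rewrite distrC (distrC x) => ->.
  by rewrite normrM ler_wpM2r.
split=> // [f f' fS fd f'c|f g [fS [C CP]] [gS [D DP]]|f g fH gH|f G DG k [fS [C CP]] GS Gd [DGS DGc]].
- have [B BP] := lip f f' fS fd f'c; split=> //.
  by apply: lipschitz_hoelder BP => //; exact: is_derive_cont fd.
- split=> [x|]; first by rewrite fS gS.
  exists (C + D) => x y; rewrite opprD addrACA mulrDl.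
  by apply: le_trans (ler_normD _ _) _; rewrite lerD.
- have [A A0 fA] := hoelder_bounded e0 fH; have [B B0 gB] := hoelder_bounded e0 gH.
  have [fS [C CP]] := fH; have [gS [D DP]] := gH; split=> [x|]; first by rewrite fS gS.
  exists (C * B + A * D) => x y.
  have -> : f x * g x - f y * g y = (f x - f y) * g x + f y * (g x - g y) by ring.
  apply: le_trans (ler_normD _ _) _; rewrite !normrM mulrDl lerD //.
    by rewrite mulrAC ler_pM.
  by rewrite -mulrA ler_pM.
- split=> [x|]; first by rewrite GS (periodic_int _ _ fS).
  have [B B0 DGB] := periodic_bounded DGc DGS; have C0 := hoelder_ge0 CP.
  exists (C * B `^ eps) => x y; apply: le_trans (CP _ _) _; rewrite -mulrA ler_wpM2l //.
  rewrite -powRM ?(ltW B0) // le_powRl // ?(ltW e0) //.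
  wlog xy : x y / x <= y.
    by move=> W; have [/W//|/ltW/W] := leP x y; rewrite distrC (distrC y).
  have [c _] := MVTle Gd xy; rewrite distrC (distrC x) => ->.
  by rewrite normrM ler_wpM2r.
Qed.

End differentiability_classes.

Section class_closure.
Variable R : realType.
Variable A : set (R -> R).
Hypothesis RA : regularity A.
Implicit Types f g : R -> R.

Lemma Cn_per n f : Cn A n f -> periodic1 f.
Proof. by case: n => [/(reg_cont RA)[]|n []]. Qed.

Lemma Cn_cont n f : Cn A n f -> continuous f.
Proof. by case: n => [/(reg_cont RA)[]|n [_ [f' [fd _]]]] //; exact: is_derive_cont fd. Qed.

Lemma Cn_low n f : Cn A n.+1 f -> Cn A n f.
Proof.
elim: n f => [|n IH] f [fS [f' [fd f'n]]]; last by split=> //; exists f'; split=> //; exact: IH.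
exact: (reg_C1 RA fS fd (reg_cont RA f'n)).
Qed.

Lemma CnD n f g : Cn A n f -> Cn A n g -> Cn A n (fun x => f x + g x).
Proof.
elim: n f g => [|n IH] f g; first exact: regD.
move=> [fS [f' [fd f'n]]] [gS [g' [gd g'n]]]; split=> [x|]; first by rewrite fS gS.
by exists (fun x => f' x + g' x); split=> [x|]; [exact: is_deriveD|exact: IH].
Qed.

Lemma CnM n f g : Cn A n f -> Cn A n g -> Cn A n (fun x => f x * g x).
Proof.
elim: n f g => [|n IH] f g; first exact: regM.
move=> fn gn; have [fS [f' [fd f'n]]] := fn; have [gS [g' [gd g'n]]] := gn.
split=> [x|]; first by rewrite fS gS.
exists (fun x => f' x * g x + f x * g' x); split=> [x|].
  have := @is_deriveM R R f g x 1 (f' x) (g' x) (fd x) (gd x).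
  by move=> h; apply: is_derive_eq h _; rewrite /GRing.scale /=; ring.
by apply: CnD; apply: IH => //; exact: Cn_low.
Qed.

Lemma Cn_comp n f (G DG : R -> R) (k : int) : (forall x, G (x + 1) = G x + k%:~R) ->
  (forall x, is_derive x (1 : R) G (DG x)) -> Cn A n DG -> Cn A n f -> Cn A n (fun x => f (G x)).
Proof.
move=> GS Gd; have DGS : Cn A n DG -> per_cont DG by move=> h; split; [exact: Cn_per h|exact: Cn_cont h].
elim: n f DGS => [|n IH] f DGS DGn; first by move=> fA; exact: (reg_comp RA fA GS Gd (DGS DGn)).
move=> [fS [f' [fd f'n]]]; split=> [x|]; first by rewrite GS (periodic_int _ _ fS).
exists (fun x => f' (G x) * DG x); split=> [x|].
  by apply: (@is_derive1_comp R f G).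
have DGn' := Cn_low DGn; apply: CnM => //; apply: IH => //.
by move=> h; split; [exact: Cn_per h|exact: Cn_cont h].
Qed.

Lemma Cn_sum n N (F : nat -> R -> R) : (forall i, Cn A n (F i)) -> Cn A n (fun=> 0) ->
  Cn A n (fun x => \sum_(i < N) F i x).
Proof.
move=> Fn c0; elim: N => [|N IH].
  by rewrite (_ : (fun x => _) = (fun=> 0)) //; apply/funext => x; rewrite big_ord0.
rewrite (_ : (fun x => _) = (fun x => \sum_(i < N) F i x + F N x)); first exact: CnD.
by apply/funext => x; rewrite big_ord_recr.
Qed.

Lemma Cn_derivable n f : Cn A n f -> (forall k x, (k < n)%N -> derivable (derive1n k f) x 1) /\
  A (derive1n n f).
Proof.
elim: n f => [|n IH] f; first by split=> //; rewrite derive1n0.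
move=> [fS [f' [fd f'n]]]; have [h1 h2] := IH _ f'n.
have E : derive1 f = f' by apply/funext => x; rewrite derive1E; have [_ ->] := fd x.
have ES k : derive1n k.+1 f = derive1n k f' by rewrite /derive1n iterSr E.
split; last by rewrite ES.
by case=> [|k] x kn; [rewrite derive1n0; have [] := fd x|rewrite ES; exact: h1].
Qed.

Lemma derivable_Cn n f : periodic1 f -> (forall k x, (k < n)%N -> derivable (derive1n k f) x 1) ->
  (periodic1 (derive1n n f) -> A (derive1n n f)) -> Cn A n f.
Proof.
elim: n f => [|n IH] f fS fd fA; first by exact: fA.
have ES k : derive1n k.+1 f = derive1n k (derive1 f) by rewrite /derive1n iterSr.
have d1 x : is_derive x (1 : R) f (derive1 f x).
  by apply: DeriveDef; [exact: (fd 0%N)|rewrite derive1E].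
split=> //; exists (derive1 f); split=> //; apply: IH.
- exact: periodic_derive fS d1.
- by move=> k x kn; rewrite -ES; exact: fd.
- by move=> h; move: fA; rewrite ES; exact.
Qed.

Lemma smooth_Cn n f : smooth f -> Cn A n f.
Proof.
move=> fs; have {fs} := fs n.+1; elim: n f => [|n IH] f [fS [f' [fd f'n]]].
  exact: (reg_C1 RA fS fd f'n).
by split=> //; exists f'; split=> //; exact: IH.
Qed.

End class_closure.

Section smooth_functions.
Variable R : realType.
Implicit Types (f g : R -> R).
Local Notation PC := (@per_cont R).
Let RC := per_cont_regularity R.

Lemma smooth_cst (c : R) : smooth (fun _ => c).
Proof.
move=> n; elim: n c => [|n IH] c; first by split=> // x; exact: cst_continuous.
by split=> //; exists (fun=> 0); split=> [x|]; [exact: is_derive_cst|exact: IH].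
Qed.

Lemma smoothD f g : smooth f -> smooth g -> smooth (fun x => f x + g x).
Proof. by move=> fs gs n; exact: CnD. Qed.

Lemma smoothM f g : smooth f -> smooth g -> smooth (fun x => f x * g x).
Proof. by move=> fs gs n; exact: CnM. Qed.

Lemma smoothX f n : smooth f -> smooth (fun x => f x ^+ n).
Proof.
move=> fs; elim: n => [|n IH]; first exact: smooth_cst.
rewrite (_ : (fun x => _) = (fun x => f x * f x ^+ n)); first exact: smoothM.
by apply/funext => x; rewrite exprS.
Qed.

Lemma smooth_sum N (F : nat -> R -> R) : (forall i, smooth (F i)) -> smooth (fun x => \sum_(i < N) F i x).
Proof. by move=> Fs n; apply: (Cn_sum RC) => [i|]; [exact: Fs|exact: smooth_cst]. Qed.

Lemma smooth_shift f (p : R) : smooth f -> smooth (fun x => f (x - p)).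
Proof.
move=> fs n; apply: (@Cn_comp R PC RC n f (fun x => x - p) (fun=> 1) 1) => //; last exact: smooth_cst.
- by move=> x; rewrite addrAC.
- by move=> x; rewrite -[1 in X in is_derive _ _ _ X]addr0; apply: is_deriveD.
Qed.

(** The induction runs over a whole family [G] closed under derivation, because the derivative of a
    composite involves another member of the family. *)
Lemma smooth_outer (G : set (R -> R)) (U : set R) f :
  (forall g x, G g -> U x -> {for x, continuous g}) ->
  (forall g, G g -> exists2 g', G g' & forall x, U x -> is_derive x (1 : R) g (g' x)) ->
  (forall x, U (f x)) -> smooth f -> forall g, G g -> smooth (fun x => g (f x)).
Proof.
move=> Gc Gd fU fs g Gg n; elim: n g Gg => [|n IH] g Gg.
  have [fS fc] := fs 0%N; split=> [x|x]; first by rewrite fS.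
  by apply: continuous_comp; [exact: fc|exact: Gc].
have [fS [f' [fd f'n]]] := fs n.+1; have [g' Gg' gd] := Gd g Gg.
split=> [x|]; first by rewrite fS.
exists (fun x => g' (f x) * f' x); split=> [x|].
  by have gd' := gd _ (fU x); apply: (@is_derive1_comp R g f).
by apply: CnM => //; exact: IH.
Qed.

Lemma smoothV f : (forall x, 0 < f x) -> smooth f -> smooth (fun x => (f x)^-1).
Proof.
move=> f0 fs.
pose G : set (R -> R) := [set g | exists c k, g = (fun y => c * (y^-1) ^+ k)].
have Gd g : G g -> exists2 g', G g' & forall x : R, 0 < x -> is_derive x (1 : R) g (g' x).
  move=> [c [k ->]]; exists (fun y => (- c * k%:R) * (y^-1) ^+ k.+1); first by exists (- c * k%:R), k.+1.
  move=> x x0; have xn : x != 0 by rewrite gt_eqF.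
  have d1 : is_derive x (1 : R) (fun y => y^-1) (- x ^- 2).
    by have := @is_deriveV R id x 1 1 xn (is_derive_id _ _); rewrite /GRing.scale /= mulr1.
  have : is_derive x (1 : R) (fun y => (y^-1) ^+ k) (k%:R * (x^-1) ^+ k.-1 * (- x ^- 2)).
    by have := is_deriveX k d1; rewrite exprfctE.
  move=> d2; have := @is_deriveZ R R R _ c x 1 _ d2; rewrite /GRing.scale /= => d3.
  apply: is_derive_eq d3 _; case: k {d2} => [|k] /=; first by rewrite !mul0r !mulr0 mul0r.
  by rewrite -(exprVn x 2) !exprS; ring.
have := @smooth_outer G [set y | 0 < y] f; apply=> //.
- by move=> g x Gg x0; have [g' _ gd] := Gd g Gg; exact: is_derive_cts (gd x x0).
- by exists 1, 1%N; apply/funext => y; rewrite mul1r expr1.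
Qed.

Lemma smooth_trig (a b : R) : smooth (fun x => a * cos (x * (pi *+ 2)) + b * sin (x * (pi *+ 2))).
Proof.
move=> n; have der (a' b' x : R) : is_derive x (1 : R)
    (fun x => a' * cos (x * (pi *+ 2)) + b' * sin (x * (pi *+ 2)))
    ((b' * (pi *+ 2)) * cos (x * (pi *+ 2)) + (- a' * (pi *+ 2)) * sin (x * (pi *+ 2))).
  have dm : is_derive x (1 : R) (fun x => x * (pi *+ 2)) (pi *+ 2).
    by apply: is_derive_eq; rewrite /GRing.scale /= mulr1 mulr0 add0r.
  have dc : is_derive x (1 : R) (fun x => cos (x * (pi *+ 2))) (- sin (x * (pi *+ 2)) * (pi *+ 2)).
    exact: (@is_derive1_comp R cos (fun x => x * (pi *+ 2))).
  have ds : is_derive x (1 : R) (fun x => sin (x * (pi *+ 2))) (cos (x * (pi *+ 2)) * (pi *+ 2)).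
    exact: (@is_derive1_comp R sin (fun x => x * (pi *+ 2))).
  have := is_deriveD (is_deriveZ a' dc) (is_deriveZ b' ds).
  by rewrite /GRing.scale /= => h; apply: is_derive_eq h _; ring.
elim: n a b => [|n IH] a b; first split.
- by move=> x; rewrite mulrDl mul1r cosD2pi sinD2pi.
- by apply: is_derive_cont => x; exact: der.
- split; first by move=> x; rewrite [(x + 1) * _]mulrDl mul1r cosD2pi sinD2pi.
  by exists (fun x => (b * (pi *+ 2)) * cos (x * (pi *+ 2)) + (- a * (pi *+ 2)) * sin (x * (pi *+ 2))); split.
Qed.

Lemma smooth_bump : smooth (@bump R).
Proof.
rewrite (_ : @bump R = (fun x => 2^-1 + (- 2^-1 * cos (x * (pi *+ 2)) + 0 * sin (x * (pi *+ 2))))).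
  by apply: smoothD; [exact: smooth_cst|exact: smooth_trig].
by apply/funext => x; rewrite /bump; ring.
Qed.

Lemma smooth_bumps ps : smooth (@bumps R ps).
Proof.
elim: ps => [|p ps IH].
  rewrite (_ : bumps [::] = (fun=> 1)); first exact: smooth_cst.
  by apply/funext => y; rewrite /bumps big_nil.
rewrite (_ : bumps (p :: ps) = (fun y => bump (y - p) * bumps ps y)).
  by apply: smoothM => //; apply: smooth_shift; exact: smooth_bump.
by apply/funext => y; rewrite /bumps big_cons.
Qed.

Lemma smooth_smoothing w N n : (0 < N)%N -> smooth (smoothing w (@bump R) N n).
Proof.
move=> N0; have term j : smooth (fun x : R => (2 - bump (x - j%:R / N%:R)) ^+ n).
  apply: smoothX; apply: (@smoothD (fun=> 2) (fun x => - bump (x - j%:R / N%:R))); first exact: smooth_cst.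
  rewrite (_ : (fun x => _) = (fun x => -1 * bump (x - j%:R / N%:R))).
    by apply: smoothM; [exact: smooth_cst|apply: smooth_shift; exact: smooth_bump].
  by apply/funext => x; rewrite mulN1r.
apply: smoothM; last apply: smoothV.
- apply: (@smooth_sum N (fun j x => w (j%:R / N%:R) * (2 - bump (x - j%:R / N%:R)) ^+ n)) => j.
  by apply: smoothM; [exact: smooth_cst|exact: term].
- by move=> x; apply: weight_gt0 => //; exact: bump01.
- exact: (@smooth_sum N (fun j x => (2 - bump (x - j%:R / N%:R)) ^+ n)).
Qed.

End smooth_functions.

(** * The flat function *)

Section flat_function.
Variable R : realType.

(* All derivatives of [exp (- 1 / t)] are combinations of the [flat k]. *)
Definition flat k (t : R) : R := if 0 < t then (t^-1) ^+ k * expR (- t^-1) else 0.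

Lemma flat_bound k (t : R) : 0 <= t -> flat k t <= k.+2`!%:R * t ^+ 2.
Proof.
rewrite /flat le_eqVlt => /predU1P[<-|t0]; first by rewrite ltxx expr0n mulr0.
rewrite t0 expRN; have u0 : 0 < t^-1 by rewrite invr_gt0.
have /= h := expR_ge1Dxn k.+1 (ltW u0).
have f0 : 0 < (k.+2`!%:R : R) by rewrite ltr0n fact_gt0.
have {}h : (t^-1) ^+ k.+2 / k.+2`!%:R <= expR t^-1 by apply: le_trans h; rewrite lerDr.
rewrite ler_pdivrMr ?expR_gt0 //; rewrite ler_pdivrMr // in h.
have t2 : 0 < t ^+ 2 by rewrite exprn_gt0.
have -> : (t^-1) ^+ k = (t^-1) ^+ k.+2 * t ^+ 2.
  by rewrite !exprS expr0; field; rewrite gt_eqF.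
by rewrite [leRHS]mulrAC ler_pM2r // [leRHS]mulrC.
Qed.

Lemma flat_le0 k (t : R) : t <= 0 -> flat k t = 0.
Proof. by rewrite /flat leNgt; case: ltP. Qed.

Lemma flat_ge0 k (t : R) : 0 <= flat k t.
Proof. by rewrite /flat; case: ltP => // t0; rewrite mulr_ge0 ?expR_ge0 ?exprn_ge0 ?invr_ge0 ?ltW. Qed.

Lemma flat0_le1 (t : R) : flat 0 t <= 1.
Proof.
rewrite /flat; case: ltP => // t0.
by rewrite expr0 mul1r expR_le1 oppr_le0 invr_ge0 ltW.
Qed.

Lemma flat0_gt0 (t : R) : 0 < t -> 0 < flat 0 t.
Proof. by rewrite /flat => ->; rewrite mulr_gt0 ?expR_gt0 // expr0. Qed.

Lemma flat_derive k (t : R) : is_derive t (1 : R) (flat k) (flat k.+2 t - k%:R * flat k.+1 t).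
Proof.
have [t0|t0|->] := ltgtP t 0.
- rewrite !flat_le0 ?ltW // mulr0 subr0.
  apply: (@is_derive_near R _ (fun=> 0)).
  exists (- t); first by rewrite /= oppr_gt0.
  by move=> x /=; rewrite ltr_norml => /andP[h1 h2]; apply: flat_le0; lra.
- apply: (@is_derive_near R _ (fun x => (x^-1) ^+ k * expR (- x^-1))).
    exists t => // x /=; rewrite ltr_norml /flat => /andP[h1 h2].
    by case: ltP => //; lra.
  have tn : t != 0 by rewrite gt_eqF.
  have d1 : is_derive t (1 : R) (fun y => y^-1) (- t ^- 2).
    by have := @is_deriveV R id t 1 1 tn (is_derive_id _ _); rewrite /GRing.scale /= mulr1.
  have d2 : is_derive t (1 : R) (fun y => (y^-1) ^+ k) (k%:R * (t^-1) ^+ k.-1 * (- t ^- 2)).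
    by have := is_deriveX k d1; rewrite exprfctE.
  have d3 : is_derive t (1 : R) (fun y => expR (- y^-1)) (expR (- t^-1) * - (- t ^- 2)).
    apply: (@is_derive1_comp R expR (fun y => - y^-1)); exact: is_deriveN.
  have := is_deriveM d2 d3; rewrite /GRing.scale /= => h; apply: is_derive_eq h _.
  rewrite /flat t0 -(exprVn t 2); case: k {d2} => [|k] /=; rewrite !exprS ?expr0; ring.
- rewrite !flat_le0 // mulr0 subr0.
  apply/is_derive1_caratheodory; exists (fun z => if 0 < z then flat k z / z else 0); split.
  + move=> z; rewrite (flat_le0 k (lexx 0)) !subr0; case: ltP => z0; last by rewrite flat_le0 // mul0r.
    by rewrite divfK // gt_eqF.
  + apply/cvgrPdist_lt => e e0; rewrite ltxx.
    have f0 : 0 < (k.+2`!%:R : R) by rewrite ltr0n fact_gt0.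
    exists (e / k.+2`!%:R); first by rewrite /= divr_gt0.
    move=> z /=; rewrite !sub0r !normrN; move=> ze; case: (ltP 0 z) => z0; last by rewrite normr0.
    move: ze; rewrite (gtr0_norm z0) ltr_pdivlMr // => ze.
    rewrite ger0_norm; last by rewrite divr_ge0 ?flat_ge0 // ltW.
    rewrite ltr_pdivrMr //; apply: le_lt_trans (flat_bound k (ltW z0)) _.
    by rewrite expr2 mulrA ltr_pM2r // mulrC.
  + by rewrite ltxx.
Qed.

Lemma smooth_flat f k : smooth f -> smooth (fun x => flat k (f x)).
Proof.
move=> fs n; elim: n k => [|n IH] k.
  have [fS fc] := fs 0%N; split=> [x|x]; first by rewrite fS.
  by apply: continuous_comp; [exact: fc|exact: is_derive_cts (flat_derive k _)].
have [fS [f' [fd f'n]]] := fs n.+1; split=> [x|]; first by rewrite fS.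
exists (fun x => (flat k.+2 (f x) + - k%:R * flat k.+1 (f x)) * f' x); split=> [x|].
  by have fk := flat_derive k (f x); rewrite mulNr; apply: (@is_derive1_comp R (flat k) f).
have RC := per_cont_regularity R; apply: CnM => //; apply: CnD => //.
by apply: CnM => //; exact: smooth_cst.
Qed.

End flat_function.

(** * Replacing the correction by a smoothing *)

Section corrected_density.
Variables (R : realType) (d : nat) (H DH v : R -> R) (V : R).
Hypothesis L : BV_lift d H DH v V.
Hypothesis Rep : repelling H DH.
Local Notation Dn := (iter_deriv H DH).
Variables (q : R -> R) (s : nat).
Hypothesis s0 : (0 < s)%N.
Hypothesis sP : forall x, parabolic H DH x -> (exists k : int, iter s H x = x + k%:~R) /\ Dn s x = 1.
Hypotheses (qc : continuous q) (qS : forall x, q (x + 1) = q x) (q_ge0 : forall x, 0 <= q x).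
Hypothesis qP : forall x, q x = 0 <-> parabolic H DH x.
Local Notation rho0 := (avg_density H DH s).

(* The correction [rho - rho0] vanishes near the parabolic points, so it may
   be divided by the weight [g] before being replaced by a smoothing. *)
Lemma corrected_density : exists2 eta : R, 0 < eta & forall g : R -> R,
  continuous g -> (forall x, g (x + 1) = g x) -> (forall x, 0 <= g x <= 1) ->
  (forall x, eta <= q x -> 0 < g x) ->
  (exists C e0 : R, [/\ 0 < C, 0 < e0 &
     forall x, q x < e0 -> g x + g (H x) * DH x <= C * (Dn s x - 1)]) ->
  exists w N n, (0 < N)%N /\
    let rhat x := rho0 x + g x * smoothing w (@bump R) N n x in
    (forall x, 0 < rhat x) /\ forall x, ~ parabolic H DH x -> rhat x < rhat (H x) * DH x.
Proof.
have [rho [rhoc rhoS rho_gt0 rhoH [eta' eta'0 rhoE']]] := expanding_density L Rep s0 sP qc qS q_ge0 qP.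
have [eta [eta0 rhoE]] : exists eta : R, 0 < eta /\ forall x, q x < eta -> rho x = rho0 x by exists eta'.
exists eta => // g gc gS g01 g_gt0 [C [e0 [C0 e00 gC]]].
have r0c : continuous rho0 by exact: (avg_density_cont L).
have r0S : forall x, rho0 (x + 1) = rho0 x := avg_density_1 L s.
(* Where [q x < eta] the numerator vanishes, so [w x = 0] there, also if [g x = 0]. *)
pose w x := (rho x - rho0 x) / g x.
have w0 x : q x < eta -> w x = 0 by move=> /rhoE E; rewrite /w E subrr mul0r.
have wg x : g x * w x = rho x - rho0 x.
  have [qx|/g_gt0 gx] := ltP (q x) eta; first by rewrite w0 // rhoE // subrr mulr0.
  by rewrite /w mulrC divfK // gt_eqF.
have wS x : w (x + 1) = w x by rewrite /w rhoS r0S gS.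
have wc : continuous w.
  move=> x; have [qx|/g_gt0 gx] := ltP (q x) eta; last first.
    apply: (@continuousM R R (fun x => rho x - rho0 x) (fun x => (g x)^-1)).
      by apply: continuousB; [exact: rhoc|exact: r0c].
    by apply: continuousV; [rewrite gt_eqF|exact: gc].
  have E0 : 0 < eta - q x by lra.
  have qcx : q t @[t --> x] --> q x by exact: qc.
  have /cvgrPdist_lt /(_ _ E0) nr := qcx.
  have nr' : \forall t \near x, w t = 0.
    apply: filterS nr => t; rewrite ltr_norml => /andP[h1 h2]; apply: w0; lra.
  apply/cvgrPdist_lt => e e_gt0; apply: filterS nr' => t ->.
  by rewrite (w0 _ qx) subrr normr0.
have [e1 [e10 e1e0 e1P]] : exists e1 : R, [/\ 0 < e1, e1 <= e0 &
    forall x, q x < e1 -> [/\ q x < eta, q (H x) < eta & 0 < q x -> 1 < Dn s x]].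
  have [a a0 aP] := q_near_invariant L qc qS q_ge0 qP 2 eta0.
  have [b b0 bP] := q_near_repelling L Rep s0 sP qc qS q_ge0 qP.
  exists (Num.min e0 (Num.min a b)); split=> [||x]; rewrite ?lt_min ?ge_min ?lexx //.
    by rewrite e00 a0 b0.
  move=> /andP[_ /andP[xa xb]]; split; [exact: (aP x xa 0%N)|exact: (aP x xa 1%N)|].
  by move=> q0; apply: bP.
have Hc : continuous H by exact: (iter_cont L 1).
have rhoHc : continuous (fun x => rho (H x) * DH x).
  move=> x; apply: (@continuousM R R (fun x => rho (H x)) DH); last exact: (lift_cont L).
  by apply: continuous_comp; [exact: Hc|exact: rhoc].
have [mu mu0 muP] : exists2 mu : R, 0 < mu & forall x, e1 <= q x -> mu <= rho (H x) * DH x - rho x.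
  (* The term [e1 - q x] makes the maximum positive on the whole circle, so that it has a positive
     lower bound, and it is not positive on the region [e1 <= q x] of interest. *)
  pose F x := Num.max (rho (H x) * DH x - rho x) (e1 - q x).
  have [|||mu mu0 muP] := @periodic_pos_lb R F.
  - move=> x; apply: (@continuous_max R R (fun x => rho (H x) * DH x - rho x) (fun x => e1 - q x)).
      by apply: continuousB; [exact: rhoHc|exact: rhoc].
    by apply: continuousB; [exact: cst_continuous|exact: qc].
  - by move=> x; rewrite /F (liftS L) (DHS L) rhoS qS -[d%:R]/((d%:Z)%:~R) (periodic_int _ _ rhoS).
  - move=> x; rewrite /F lt_max; apply/orP; have [qx|qx] := ltP (q x) e1; first by right; lra.
    by left; rewrite subr_gt0; apply: rhoH; rewrite gt_eqF //; lra.
  exists mu => // x qx; have := muP x; rewrite /F le_max => /orP[//|h]; exfalso; lra.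
have [m m0 mP] := periodic_pos_lb rhoc rhoS rho_gt0.
have [M M0 MP] := periodic_bounded (lift_cont L) (DHS L).
have {}MP x : DH x <= M by apply: le_trans (ler_norm _) (MP x).
(* The three bounds let the error consume at most half of, respectively, the gain [Dn s x - 1] near
   the parabolic points, the defect [mu] elsewhere, and the minimum [m] of [rho]. *)
pose e := Num.min (1 / (2 * C)) (Num.min (mu / (2 * (M + 1))) (m / 2)).
have e_gt0 : 0 < e by rewrite !lt_min !divr_gt0 //; lra.
have eC : e * C <= 1 / 2.
  have : e <= 1 / (2 * C) by rewrite ge_min lexx.
  by rewrite ler_pdivlMr; lra.
have eM : e * (M + 1) <= mu / 2.
  have : e <= mu / (2 * (M + 1)) by rewrite !ge_min lexx orbT.
  by rewrite ler_pdivlMr; lra.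
have em : e <= m / 2 by rewrite !ge_min lexx !orbT.
have [N [n [N0 Pw]]] := smoothing_approx (@bump_cont R) (@bumpS R) (@bump01 R) (@bump_eq0 R) wc wS e_gt0.
exists w, N, n; split=> //; set P := smoothing w _ N n in Pw *; set rhat := fun x => _.
have close x : `|rhat x - rho x| <= e.
  have -> : rhat x - rho x = g x * (P x - w x) by rewrite mulrBr wg /rhat; ring.
  have /andP[g0 g1] := g01 x; rewrite normrM (ger0_norm g0).
  by apply: le_trans (Pw x); rewrite ler_piMl.
split=> [x|x npx].
  by have := close x; have := mP x; rewrite ler_norml => h1 /andP[h2 h3]; lra.
have qx0 : 0 < q x.
  by rewrite lt_def q_ge0 andbT; apply/eqP => /qP.
have DH0 := lift_gt0 L x.
have [qx|qx] := ltP (q x) e1; last first.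
  have h1 := muP x qx; have := close x; have := close (H x); have := MP x.
  rewrite !ler_norml => h2 /andP[h3 _] /andP[_ h4].
  have h5 : (rho (H x) - e) * DH x <= rhat (H x) * DH x by rewrite ler_pM2r //; lra.
  have h6 : e * DH x <= e * M by rewrite ler_pM2l.
  lra.
have [qe qHe D1] := e1P x qx; have {}D1 := D1 qx0.
(* Here [w] vanishes at [x] and at [H x], so the correction costs at most
   [e * (g x + g (H x) * DH x)], while [rho0] gains [Dn s x - 1]. *)
have := Pw x; have := Pw (H x); rewrite !w0 // !subr0 !ler_norml => /andP[P1 _] /andP[_ P2].
have /andP[g0 _] := g01 x; have /andP[g0' _] := g01 (H x).
have h1 := gC x (lt_le_trans qx e1e0).
have h2 : - e * (g (H x) * DH x) <= P (H x) * (g (H x) * DH x).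
  by rewrite ler_wpM2r // mulr_ge0 // ltW.
have h3 : P x * g x <= e * g x by rewrite ler_wpM2r.
have h4 : e * (g x + g (H x) * DH x) <= e * (C * (Dn s x - 1)) by rewrite ler_pM2l.
have h5 : (e * C) * (Dn s x - 1) <= (1 / 2) * (Dn s x - 1) by rewrite ler_pM2r // subr_gt0.
have h6 := avg_density_H H DH s x.
rewrite /rhat mulrDl h6; lra.
Qed.

End corrected_density.

(** * Real analytic functions *)

Section analytic_expansion.
Variable R : realType.
Implicit Types (F G : R -> R) (x t r M : R) (a b : nat -> R).

(** A convergent power series together with Cauchy bounds at the radius [r], which make its
    remainders geometric. *)
Definition expansion a r M F x := [/\ 0 < r, forall n, `|a n| * r ^+ n <= M &
  forall t, `|t| < r -> series (fun n => a n * t ^+ n) @ \oo --> F (x + t)].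

Lemma analyticI a r F x : 0 < r ->
  (forall t, `|t| < r -> series (fun n => a n * t ^+ n) @ \oo --> F (x + t)) -> analytic_at F x.
Proof. by move=> r0 aF; exists a, r; split=> // t /aF; rewrite (_ : x + (t - x) = t) //; ring. Qed.

Lemma analytic_expansion F x : analytic_at F x -> exists a r M, expansion a r M F x.
Proof.
move=> [a [rho [rho0 aF]]]; pose r := rho / 2; have r0 : 0 < r by rewrite /r; lra.
have r1 : `|x + r - x| < rho by rewrite addrAC subrr add0r gtr0_norm /r; lra.
have /cvgP/cvg_series_cvg_0/cvgP/cvg_seq_bounded [M [_ MP]] := aF _ r1.
exists a, r, (M + 1); split=> // [n|t tr].
  have /MP/(_ n I) : M < M + 1 by rewrite ltrDl.
  by rewrite /= addrAC subrr add0r normrM (ger0_norm (exprn_ge0 n (ltW r0))).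
have := aF (x + t); rewrite addrAC subrr add0r; apply; apply: lt_trans tr _; rewrite /r; lra.
Qed.

Lemma geometric_sum (q : R) N j : 0 <= q <= 1 / 2 -> \sum_(N <= n < N + j) q ^+ n <= 2 * q ^+ N.
Proof.
move=> /andP[q0 q2]; suff : \sum_(N <= n < N + j) q ^+ n <= 2 * q ^+ N - 2 * q ^+ (N + j).
  by move=> h; apply: le_trans h _; rewrite gerBl mulr_ge0 // exprn_ge0.
elim: j => [|j IH]; first by rewrite addn0 big_geq // subrr.
rewrite addnS big_nat_recr ?leq_addr //=.
have : q ^+ (N + j) * q <= q ^+ (N + j) * (1 / 2) by rewrite ler_wpM2l // exprn_ge0.
by rewrite exprSr; lra.
Qed.

Lemma expansion_tail a r M F x : expansion a r M F x -> forall t N, `|t| <= r / 2 ->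
  `|F (x + t) - \sum_(0 <= n < N) a n * t ^+ n| <= 2 * M * (`|t| / r) ^+ N.
Proof.
move=> [r0 aM aF] t N tr; have t1 : `|t| < r by lra.
have M0 : 0 <= M by apply: le_trans (aM 0%N); rewrite mulr_ge0 ?exprn_ge0 // ltW.
have q2 : 0 <= `|t| / r <= 1 / 2.
  by rewrite divr_ge0 ?(ltW r0) //= ler_pdivrMr //; lra.
apply/ler_addgt0Pr => e e0; have /cvgrPdist_lt /(_ _ e0) [K _ KP] := aF t t1.
have := KP (N + K)%N (leq_addl _ _); rewrite /series /= => h.
rewrite (big_cat_nat (leq0n N) (leq_addr K N)) /= in h.
apply: le_trans (_ : `|\sum_(N <= n < N + K) a n * t ^+ n| + e <= _); last first.
  rewrite lerD2r; apply: le_trans (ler_norm_sum _ _ _) _.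
  apply: le_trans (_ : M * \sum_(N <= n < N + K) (`|t| / r) ^+ n <= _); last first.
    by rewrite [2 * M]mulrC -mulrA ler_wpM2l // geometric_sum.
  rewrite mulr_sumr; apply: ler_sum => i _; rewrite normrM normrX expr_div_n mulrA.
  by rewrite ler_pdivlMr ?exprn_gt0 // mulrAC ler_wpM2r ?exprn_ge0.
set A := \sum_(0 <= _ < N) _ in h *; set B := \sum_(_ <= _ < _) _ in h *.
have -> : F (x + t) - A = (F (x + t) - (A + B)) + B by ring.
by apply: le_trans (ler_normD _ _) _; rewrite addrC lerD2l ltW.
Qed.

End analytic_expansion.

(** * Composition of power series by majorants *)

Section analytic_composition.
Variable R : realType.
Implicit Types (F G : R -> R) (x t r M : R) (a b : nat -> R) (p P q Q : {poly R}).

(** Cauchy's majorant relation; it forces the coefficients of [P] to be nonnegative. *)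
Definition dominates p P := forall i, `|p`_i| <= P`_i.

Lemma dominatesM p P q Q : dominates p P -> dominates q Q -> dominates (p * q) (P * Q).
Proof.
move=> pP qQ i; rewrite !coefM; apply: le_trans (ler_norm_sum _ _ _) _.
by apply: ler_sum => j _; rewrite normrM ler_pM.
Qed.

Lemma dominatesX p P n : dominates p P -> dominates (p ^+ n) (P ^+ n).
Proof.
move=> pP; elim: n => [|n IH]; last by rewrite !exprS; exact: dominatesM.
by move=> i; rewrite !expr0 coef1 normr_nat.
Qed.

Lemma dominates_sum N (a : nat -> R) p P : dominates p P ->
  dominates (\sum_(0 <= n < N) a n *: p ^+ n) (\sum_(0 <= n < N) `|a n| *: P ^+ n).
Proof.
move=> pP i; rewrite !coef_sum; apply: le_trans (ler_norm_sum _ _ _) _.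
by apply: ler_sum => n _; rewrite !coefZ normrM ler_wpM2l // dominatesX.
Qed.

Lemma agree_exp p q m : (forall i, (i <= m)%N -> p`_i = q`_i) ->
  forall n i, (i <= m)%N -> (p ^+ n)`_i = (q ^+ n)`_i.
Proof.
move=> pq; elim=> [|n IH] i im; first by rewrite !expr0.
rewrite !exprS !coefM; apply: eq_bigr => j _; rewrite pq ?IH //.
  by apply: leq_trans im; exact: leq_subr.
by apply: leq_trans im; rewrite -ltnS.
Qed.

Lemma low_exp p n i : p`_0 = 0 -> (i < n)%N -> (p ^+ n)`_i = 0.
Proof.
move=> p0; elim: n i => // n IH i; rewrite ltnS => im.
rewrite exprS coefM big1 // => -[[|j] ji] _ /=; first by rewrite p0 mul0r.
rewrite IH ?mulr0 //; apply: leq_trans im; rewrite ltn_subrL /= -ltnS.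
by apply: leq_trans ji.
Qed.

(** At half the radius each term of degree [m] is smaller than that of the majorant at [s] by a
    factor [2^m]. The bound is uniform in the degree of [p]. *)
Lemma horner_tail p P N (s t : R) B : dominates p P -> 0 < s -> `|t| <= s / 2 -> P.[s] <= B ->
  `|p.[t] - \sum_(0 <= m < N) p`_m * t ^+ m| <= B * (1 / 2) ^+ N.
Proof.
move=> pP s0 ts PB; pose l := (N + maxn (size p) (size P))%N.
have P0 i : 0 <= P`_i by apply: le_trans (pP i).
have -> : p.[t] = \sum_(0 <= m < l) p`_m * t ^+ m.
  by rewrite (@horner_coef_wide _ l) ?big_mkord // (leq_trans (leq_maxl _ (size P))) // leq_addl.
rewrite (big_cat_nat (leq0n N) (leq_addr _ N)) /= addrAC subrr add0r.
apply: le_trans (ler_norm_sum _ _ _) _.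
apply: (@le_trans _ _ (\sum_(N <= m < l) P`_m * s ^+ m * (1 / 2) ^+ N)).
  rewrite !big_nat; apply: ler_sum => m /andP[Nm _]; rewrite normrM normrX -mulrA.
  apply: ler_pM; rewrite ?exprn_ge0 //.
  apply: (@le_trans _ _ ((s * (1 / 2)) ^+ m)).
    by apply: lerXn2r; rewrite ?nnegrE ?mulr_ge0 ?(ltW s0) //; lra.
  rewrite exprMn ler_wpM2l ?exprn_ge0 ?(ltW s0) //.
  by apply: ler_wiXn2l => //; lra.
rewrite -mulr_suml ler_wpM2r ?exprn_ge0 //; apply: le_trans PB.
have -> : P.[s] = \sum_(0 <= m < l) P`_m * s ^+ m.
  by rewrite (@horner_coef_wide _ l) ?big_mkord // (leq_trans (leq_maxr (size p) _)) // leq_addl.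
rewrite (big_cat_nat (leq0n N) (leq_addr _ N)) /= lerDr.
by apply: sumr_ge0 => i _; rewrite mulr_ge0 ?exprn_ge0 // ltW.
Qed.

(** The factor [B] on the left avoids the exponent [n - 1] on the right. *)
Lemma exp_diff (u v B : R) n : `|u| <= B -> `|v| <= B ->
  B * `|u ^+ n - v ^+ n| <= n%:R * B ^+ n * `|u - v|.
Proof.
move=> uB vB; have B0 : 0 <= B by apply: le_trans uB.
elim: n => [|n IH]; first by rewrite !expr0 subrr normr0 mulr0 !mul0r.
have -> : u ^+ n.+1 - v ^+ n.+1 = u * (u ^+ n - v ^+ n) + (u - v) * v ^+ n by rewrite !exprS; ring.
apply: le_trans (ler_wpM2l B0 (ler_normD _ _)) _; rewrite !normrM mulrDr normrX.
have h1 : B * (`|u| * `|u ^+ n - v ^+ n|) <= B * (n%:R * B ^+ n * `|u - v|).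
  rewrite mulrCA; apply: le_trans (_ : B * (B * `|u ^+ n - v ^+ n|) <= _); last exact: ler_wpM2l.
  by rewrite ler_wpM2r // mulr_ge0.
have h2 : B * (`|u - v| * `|v| ^+ n) <= B * (`|u - v| * B ^+ n).
  by rewrite ler_wpM2l // ler_wpM2l // lerXn2r ?nnegrE.
by rewrite -natr1 exprS; lra.
Qed.

Lemma natr_le_exp2 n : (n%:R : R) <= 2 ^+ n.
Proof. by rewrite -natrX ler_nat ltnW // ltn_expl. Qed.

Lemma cvg_geometric_rate (u : nat -> R) (l C : R) :
  (forall n, (0 < n)%N -> `|l - u n| <= C * (1 / 2) ^+ n) -> u @ \oo --> l.
Proof.
move=> uC; apply/cvgrPdist_lt => e e0.
have C0 : 0 < `|C| + 1 by rewrite ltr_wpDl.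
have h2 : `|1 / 2 : R| < 1 by rewrite ger0_norm; lra.
have /cvgrPdist_lt /(_ _ (divr_gt0 e0 C0)) [N _ NP] := cvg_expr h2.
exists N.+1 => // n /= nN; apply: le_lt_trans (uC n (leq_trans _ nN)) _ => //.
have := NP n (ltnW nN); rewrite sub0r normrN ger0_norm ?exprn_ge0 // ltr_pdivlMr //.
apply: le_lt_trans; rewrite mulrC ler_wpM2l ?exprn_ge0 //.
by have := ler_norm C; lra.
Qed.

(** [S N] composes truncations of the two series. Its coefficients below [N] do not depend on [N],
    as [g N] has no constant term. The error has three parts: the tail of [S N], the tail of [F],
    and the replacement of [u] by its truncation [v]. *)
Lemma analytic_comp F G x : analytic_at F (G x) -> analytic_at G x -> analytic_at (fun t => F (G t)) x.
Proof.
move=> /analytic_expansion[a [r [M Fe]]] /analytic_expansion[b [rho [K Ge]]].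
have [r0 aM _] := Fe; have [rho0 bK _] := Ge.
have M0 : 0 <= M by apply: le_trans (aM 0%N); rewrite mulr_ge0 ?exprn_ge0 // ltW.
have K0 : 0 <= K by apply: le_trans (bK 0%N); rewrite mulr_ge0 ?exprn_ge0 // ltW.
have b0 : b 0%N = G x.
  have := expansion_tail Ge (t := 0) 1; rewrite normr0 mul0r expr1 mulr0 addr0 big_nat1 expr0 mulr1.
  by move=> /(_ _)/wrap[|]; [lra|rewrite normr_le0 subr_eq0 => /eqP].
(* Small enough for the majorant of [G - G x] to be at most [r / 2] at [s]. *)
pose s : R := Num.min (rho / 2) (r * rho / (4 * (K + 1))).
have s0 : 0 < s by rewrite lt_min !divr_gt0 ?mulr_gt0 //; lra.
have s1 : s <= rho / 2 by rewrite ge_min lexx.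
have s2 : 2 * K * (s / rho) <= r / 2.
  have : s <= r * rho / (4 * (K + 1)) by rewrite ge_min lexx orbT.
  rewrite ler_pdivlMr; last lra.
  move=> h; rewrite mulrA ler_pdivrMr //; lra.
clearbody s.
pose b' k : R := if k is 0 then 0 else b k.
pose g N : {poly R} := \poly_(k < N) b' k; pose g' N : {poly R} := \poly_(k < N) `|b' k|.
have gg' N : dominates (g N) (g' N).
  by move=> i; rewrite !coef_poly; case: ifP => //; rewrite normr0.
have g's N : (g' N).[s] <= r / 2.
  rewrite horner_poly; apply: le_trans s2.
  have sr0 : 0 <= s / rho by apply: divr_ge0; exact: ltW.
  have sr : 0 <= s / rho <= 1 / 2 by rewrite sr0 /= ler_pdivrMr //; lra.
  case: N => [|N]; first by rewrite big_ord0 mulr_ge0 // ?mulr_ge0 //; lra.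
  rewrite -(big_mkord xpredT (fun i => `|b' i| * s ^+ i)) big_nat_recl // normr0 mul0r add0r.
  apply: (@le_trans _ _ (K * \sum_(1 <= i < 1 + N) (s / rho) ^+ i)); last first.
    by have := ler_wpM2l K0 (geometric_sum 1 N sr); rewrite expr1 mulrCA mulrA.
  rewrite big_add1 /= mulr_sumr; apply: ler_sum => i _.
  rewrite expr_div_n mulrA ler_pdivlMr ?exprn_gt0 // mulrAC ler_wpM2r ?exprn_ge0 ?(ltW s0) //.
pose S N := \sum_(0 <= n < N) a n *: g N ^+ n.
pose S' N := \sum_(0 <= n < N) `|a n| *: g' N ^+ n.
have S's N : (S' N).[s] <= 2 * M.
  rewrite /S' horner_sum.
  apply: (@le_trans _ _ (M * \sum_(0 <= n < 0 + N) (1 / 2) ^+ n)); last first.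
    have h2 : 0 <= (1 / 2 : R) <= 1 / 2 by lra.
    by have := ler_wpM2l M0 (geometric_sum 0 N h2); rewrite expr0 mulr1 [M * 2]mulrC.
  rewrite mulr_sumr; apply: ler_sum => n _; rewrite hornerZ horner_exp.
  have g0 : 0 <= (g' N).[s].
    rewrite horner_poly; apply: sumr_ge0 => i _; rewrite mulr_ge0 ?exprn_ge0 //; exact: ltW.
  apply: (@le_trans _ _ (`|a n| * (r / 2) ^+ n)).
    by rewrite ler_wpM2l // lerXn2r ?nnegrE //; lra.
  by rewrite -[1 / 2]/(1 * 2^-1) mul1r exprMn mulrA ler_wpM2r // exprn_ge0.
have SS' N : dominates (S N) (S' N) by exact: dominates_sum.
pose c m := (S m.+1)`_m.
have Sc N m : (m < N)%N -> (S N)`_m = c m.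
  move=> mN; rewrite /c /S !coef_sum (big_cat_nat (leq0n m.+1) mN) /= [X in _ + X]big1_seq ?addr0.
    rewrite !big_nat; apply: eq_bigr => n _; rewrite !coefZ; congr (_ * _).
    apply: (@agree_exp _ _ m) => // i im; rewrite !coef_poly ltnS im.
    by rewrite (leq_ltn_trans im mN).
  move=> n /andP[_]; rewrite mem_index_iota => /andP[mn _]; rewrite coefZ low_exp ?mulr0 //.
  by rewrite coef_poly; case: ifP.
apply: (@analyticI _ c (s / 2)); first by rewrite divr_gt0.
move=> t ts; apply: (@cvg_geometric_rate _ _ (4 * M + 4 * M * K / r)) => N N0.
set u := G (x + t) - G x; pose v := (g N).[t].
have tr : `|t| <= rho / 2 by lra.
have q4 : 0 <= `|t| / rho <= 1 / 4.
  by apply/andP; split; [exact: divr_ge0 (normr_ge0 _) (ltW rho0)|rewrite ler_pdivrMr //; lra].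
(* The ratio [1 / 4], due to [s / 2 <= rho / 4], leaves room for the [N] terms that are summed
   below: [N / 4^N <= 1 / 2^N]. *)
have uv : `|u - v| <= 2 * K * (1 / 4) ^+ N.
  have -> : u - v = G (x + t) - \sum_(0 <= n < N) b n * t ^+ n.
    rewrite /u /v -b0 horner_poly -(big_mkord xpredT (fun i => b' i * t ^+ i)).
    clear v; case: N N0 => // N _; rewrite !big_nat_recl // /= mul0r add0r expr0 mulr1; ring.
  apply: le_trans (expansion_tail Ge N tr) _; rewrite ler_wpM2l ?mulr_ge0 //.
  by have /andP[q0 q1] := q4; rewrite lerXn2r ?nnegrE //; lra.
have ur : `|u| <= r / 2.
  have := expansion_tail Ge 1 tr; rewrite big_nat1 expr0 mulr1 b0 expr1 => h.
  apply: le_trans h _; apply: le_trans s2; rewrite ler_wpM2l ?mulr_ge0 //.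
  by rewrite ler_wpM2r ?invr_ge0 ?(ltW rho0) //; lra.
have vr : `|v| <= r / 2.
  apply: le_trans (g's N); rewrite /v !horner_poly; apply: le_trans (ler_norm_sum _ _ _) _.
  apply: ler_sum => i _; rewrite normrM normrX ler_wpM2l // lerXn2r ?nnegrE //; lra.
have ts' : `|t| <= s / 2 by exact: ltW.
have e1 := horner_tail N (SS' N) s0 ts' (S's N).
have e2 := expansion_tail Fe N ur.
have e3 : `|\sum_(0 <= n < N) a n * u ^+ n - (S N).[t]| <= 4 * M * K / r * (1 / 2) ^+ N.
  rewrite /S horner_sum -sumrB; apply: le_trans (ler_norm_sum _ _ _) _.
  apply: (@le_trans _ _ (\sum_(0 <= n < N) 4 * M * K / r * (1 / 4) ^+ N)).
    apply: ler_sum => n _; rewrite hornerZ horner_exp -/v -mulrBr normrM.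
    have h := exp_diff n ur vr.
    have h1 := ler_wpM2l (normr_ge0 (a n)) h.
    have h2 : `|a n| * (n%:R * (r / 2) ^+ n * `|u - v|) <= M * (2 * K * (1 / 4) ^+ N).
      rewrite [leLHS]mulrA; apply: ler_pM => //.
        by rewrite mulr_ge0 // mulr_ge0 // exprn_ge0 // divr_ge0 // ltW.
      apply: (@le_trans _ _ (`|a n| * r ^+ n)); last exact: aM.
      rewrite ler_wpM2l // expr_div_n mulrA ler_pdivrMr ?exprn_gt0 // mulrC.
      by rewrite ler_wpM2l ?natr_le_exp2 // exprn_ge0 // ltW.
    rewrite mulrAC ler_pdivlMr //; lra.
  have C0 : 0 <= 4 * M * K / r by rewrite divr_ge0 ?mulr_ge0 // ltW.
  rewrite sumr_const_nat subn0 -[_ *+ N]mulr_natr; move: C0; set C1 := 4 * M * K / r => C0.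
  rewrite -mulrA ler_wpM2l //.
  have -> : (1 / 4 : R) = (1 / 2) * (1 / 2) by field.
  rewrite exprMn -mulrA ler_piMr ?exprn_ge0 // -[1 / 2]/(1 * 2^-1) mul1r exprVn.
  by rewrite mulrC ler_pdivrMr ?exprn_gt0 // mul1r natr_le_exp2.
have uE : G (x + t) = G x + u by rewrite /u; ring.
rewrite /series /= uE.
have -> : \sum_(0 <= k < N) c k * t ^+ k = \sum_(0 <= m < N) (S N)`_m * t ^+ m.
  by rewrite !big_nat; apply: eq_bigr => m /andP[_ mN]; rewrite Sc.
have u12 : 2 * M * (`|u| / r) ^+ N <= 2 * M * (1 / 2) ^+ N.
  rewrite ler_wpM2l ?mulr_ge0 // lerXn2r ?nnegrE ?divr_ge0 ?(ltW r0) //.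
  by rewrite ler_pdivrMr //; lra.
set A := \sum_(0 <= n < N) a n * u ^+ n in e2 e3; set B := \sum_(_ <= _ < _) _ in e1 *.
have -> : F (G x + u) - B = (F (G x + u) - A) + (A - (S N).[t]) + ((S N).[t] - B) by ring.
apply: le_trans (ler_normD _ _) _; apply: le_trans (lerD (ler_normD _ _) (lexx _)) _.
have h1 := le_trans e2 u12; lra.
Qed.

End analytic_composition.

(** * Closure properties of analytic functions *)

Section analytic_functions.
Variable R : realType.
Implicit Types (F G f g : R -> R) (x t r M : R) (a b : nat -> R) (p : {poly R}).

Lemma analytic_near F G x : (\forall t \near x, F t = G t) -> analytic_at G x -> analytic_at F x.
Proof.
move=> [e /= e0 FG] [a [rho [rho0 aG]]]; exists a, (Num.min e rho); split=> [|t].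
  by rewrite lt_min e0.
by rewrite lt_min => /andP[te tr]; rewrite FG /= ?(distrC x) //; exact: aG.
Qed.

Lemma analytic_horner p x : analytic_at (fun t => p.[t]) x.
Proof.
pose q := p \Po ('X + x%:P); apply: (@analyticI _ (fun i => q`_i) 1) => // t _.
apply/cvgrPdist_lt => e e0; exists (size q) => // n /= qn.
rewrite /series /= big_mkord -(horner_coef_wide _ qn) /q horner_comp !hornerE.
by rewrite [t + x]addrC subrr normr0.
Qed.

Lemma analytic_cst (c : R) x : analytic_at (fun=> c) x.
Proof. by have := analytic_horner c%:P x; under eq_fun do rewrite hornerC. Qed.

Lemma analytic_id x : analytic_at (fun t => t) x.
Proof. by have := analytic_horner 'X x; under eq_fun do rewrite hornerX. Qed.

Lemma analyticD F G x : analytic_at F x -> analytic_at G x -> analytic_at (fun t => F t + G t) x.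
Proof.
move=> [a [r [r0 aF]]] [b [s [s0 bG]]]; exists (fun n => a n + b n), (Num.min r s).
split=> [|t]; first by rewrite lt_min r0.
rewrite lt_min => /andP[tr ts].
rewrite (_ : series _ = series (fun n => a n * (t - x) ^+ n) \+ series (fun n => b n * (t - x) ^+ n)).
  by apply: cvgD; [exact: aF|exact: bG].
by apply/funext => n; rewrite /series /= -big_split /=; apply: eq_bigr => i _; rewrite mulrDl.
Qed.

Lemma analyticX2 F x : analytic_at F x -> analytic_at (fun t => F t ^+ 2) x.
Proof.
move=> Fx; apply: (@analytic_comp _ (fun y => y ^+ 2)) => //.
by have := analytic_horner 'X^2 (F x); under eq_fun do rewrite hornerXn.
Qed.

Lemma analyticZ (c : R) F x : analytic_at F x -> analytic_at (fun t => c * F t) x.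
Proof.
move=> Fx; apply: (@analytic_comp _ (fun y => c * y)) => //.
by have := analytic_horner (c *: 'X) (F x); under eq_fun do rewrite hornerZ hornerX.
Qed.

(** Polarization reduces products to squares, which are compositions. *)
Lemma analyticM F G x : analytic_at F x -> analytic_at G x -> analytic_at (fun t => F t * G t) x.
Proof.
move=> Fx Gx; rewrite (_ : (fun t => _) =
    (fun t => 4^-1 * ((F t + G t) ^+ 2 + -1 * (F t + -1 * G t) ^+ 2))).
  apply: analyticZ; apply: analyticD; first by apply: analyticX2; exact: analyticD.
  by apply: analyticZ; apply: analyticX2; apply: analyticD => //; exact: analyticZ.
by apply/funext => t; field.
Qed.

Lemma analyticX n F x : analytic_at F x -> analytic_at (fun t => F t ^+ n) x.
Proof.
move=> Fx; elim: n => [|n IH]; first exact: analytic_cst.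
by under eq_fun do rewrite exprS; exact: analyticM.
Qed.

Lemma analytic_sum N (F : nat -> R -> R) x : (forall i, analytic_at (F i) x) ->
  analytic_at (fun t => \sum_(i < N) F i t) x.
Proof.
move=> Fx; elim: N => [|N IH]; first by under eq_fun do rewrite big_ord0; exact: analytic_cst.
by under eq_fun do rewrite big_ord_recr /=; exact: analyticD.
Qed.

Lemma analyticV F x : F x != 0 -> analytic_at F x -> analytic_at (fun t => (F t)^-1) x.
Proof.
move=> F0 Fx; apply: (@analytic_comp _ (fun y => y^-1)) => //; move: (F x) F0 => y y0.
have y0' : 0 < `|y| by rewrite normr_gt0.
apply: (@analyticI _ (fun n => y^-1 * (- y^-1) ^+ n) `|y|) => // t ty.
have z1 : `|- (t / y)| < 1 by rewrite normrN normrM normfV ltr_pdivrMr // mul1r.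
have := @cvg_geometric_series _ y^-1 _ z1; rewrite /geometric.
have -> : y^-1 * (1 - - (t / y))^-1 = (y + t)^-1.
  by rewrite opprK -invfM mulrDr mulr1 mulrCA divff // mulr1.
apply: cvg_trans; apply: near_eq_cvg; near=> n; apply: eq_bigr => i _.
by rewrite -mulrA -exprMn mulNr [y^-1 * t]mulrC.
Unshelve. all: by end_near. Qed.

Lemma analytic_cos0 : analytic_at (@cos R) 0.
Proof.
apply: (@analyticI _ (fun n => (~~ odd n)%:R * (-1) ^+ n./2 / n`!%:R) 1) => // t _.
rewrite add0r cosE; have := @is_cvg_series_cos_coeff R t.
by rewrite cos_coeffE.
Qed.

Lemma analytic_sin0 : analytic_at (@sin R) 0.
Proof.
apply: (@analyticI _ (fun n => (odd n)%:R * (-1) ^+ n.-1./2 / n`!%:R) 1) => // t _.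
rewrite add0r sinE; have := @is_cvg_series_sin_coeff R t.
by rewrite sin_coeffE.
Qed.

Lemma analytic_shift F (c : R) x : analytic_at F (x + c) -> analytic_at (fun t => F (t + c)) x.
Proof.
move=> Fx; apply: (@analytic_comp _ F (fun t => t + c)) => //.
by apply: analyticD; [exact: analytic_id|exact: analytic_cst].
Qed.

Lemma analytic_cos x : analytic_at (@cos R) x.
Proof.
rewrite (_ : cos = (fun t => cos x * cos (t + - x) + (- sin x) * sin (t + - x))).
  apply: analyticD; apply: analyticZ; apply: analytic_shift; rewrite subrr.
    exact: analytic_cos0.
  exact: analytic_sin0.
by apply/funext => t; have {1}-> : t = x + (t - x) by [ring]; rewrite cosD mulNr.
Qed.

Lemma exp_rate_cvg (u : nat -> R) (C : R) : (forall n, `|u n| <= C * (1 / 2) ^+ n) -> cvgn (series u).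
Proof.
move=> uC; apply: normed_cvg.
have C0 : 0 <= C by have := uC 0%N; rewrite expr0 mulr1; apply: le_trans.
apply: (@series_le_cvg _ _ (geometric C (1 / 2))) => [n|n|n|] /=.
- exact: normr_ge0.
- by rewrite mulr_ge0 ?exprn_ge0.
- exact: uC.
- by apply: is_cvg_geometric_series; rewrite ger0_norm; lra.
Qed.

Lemma analytic_derive F F' x : (forall t, is_derive t (1 : R) F (F' t)) -> analytic_at F x -> analytic_at F' x.
Proof.
move=> Fd /analytic_expansion[a [r [M [r0 aM aF]]]].
have rX n : 0 < r ^+ n by rewrite exprn_gt0.
have aM' n : `|a n| <= M / r ^+ n by rewrite ler_pdivlMr.
have M0 : 0 <= M by apply: le_trans (aM 0%N); rewrite mulr_ge0.
(* Differentiating the series twice brings in [n.+1] and [n.+2], each at most a constant times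
   [2^n]; the ratio [1 / 8] leaves [1 / 2] after both. *)
pose K := r / 8; have K0 : 0 < K by rewrite /K; lra.
have KE n : K ^+ n = r ^+ n * (1 / 8) ^+ n by rewrite /K -exprMn; congr (_ ^+ _); field.
have S2 n : (n.+1%:R : R) <= 2 * 2 ^+ n by rewrite -exprS natr_le_exp2.
have c1 : cvgn (pseries a K).
  apply: cvgP; apply: (aF K); rewrite gtr0_norm // /K; lra.
have half n : (1 / 8 : R) ^+ n * 2 ^+ n * 2 ^+ n = (1 / 2) ^+ n.
  by rewrite -!exprMn; congr (_ ^+ _); field.
have t8 n : 0 <= (1 / 8 : R) ^+ n by exact: exprn_ge0.
have t2 n : 1 <= (2 : R) ^+ n by apply: exprn_ege1; lra.
have c2 : cvgn (pseries (pseries_diffs a) K).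
  apply: (@exp_rate_cvg _ (2 * M / r)) => n; rewrite /pseries_diffs normrM (gtr0_norm (exprn_gt0 n K0)).
  rewrite normrM normr_nat KE.
  apply: (@le_trans _ _ (2 * 2 ^+ n * (M / r ^+ n.+1) * (r ^+ n * (1 / 8) ^+ n))).
    rewrite ler_wpM2r ?mulr_ge0 ?(ltW (rX _)) //; apply: ler_pM => //; exact: aM'.
  have -> : 2 * 2 ^+ n * (M / r ^+ n.+1) * (r ^+ n * (1 / 8) ^+ n) = 2 * M / r * ((1 / 8) ^+ n * 2 ^+ n).
    by rewrite exprS; field; rewrite !gt_eqF.
  by rewrite ler_wpM2l ?divr_ge0 ?mulr_ge0 ?(ltW r0) // -(half n) ler_peMr // mulr_ge0 //.
have c3 : cvgn (pseries (pseries_diffs (pseries_diffs a)) K).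
  apply: (@exp_rate_cvg _ (8 * M / r ^+ 2)) => n; rewrite /pseries_diffs normrM (gtr0_norm (exprn_gt0 n K0)).
  rewrite !normrM !normr_nat KE.
  apply: (@le_trans _ _ (2 * 2 ^+ n * (2 * 2 ^+ n.+1 * (M / r ^+ n.+2)) * (r ^+ n * (1 / 8) ^+ n))).
    rewrite ler_wpM2r ?mulr_ge0 ?(ltW (rX _)) //; apply: ler_pM; rewrite ?mulr_ge0 //.
    by apply: ler_pM => //; exact: aM'.
  rewrite -(half n) !exprS expr0.
  by rewrite le_eqVlt; apply/orP; left; apply/eqP; field; rewrite !gt_eqF.
apply: (@analyticI _ (pseries_diffs a) K) => // t tK.
have tK' : `|t| < `|K| by rewrite (gtr0_norm K0).
have d1 := pseries_snd_diffs c1 c2 c3 tK'.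
have cv := is_cvg_pseries_inside c2 tK'.
suff <- : limn (pseries (pseries_diffs a) t) = F' (x + t) by exact: cv.
apply: is_derive_uniq d1 _.
apply: (@is_derive_near _ _ (fun t : R => F (t + x))).
  exists (K - `|t|); first by rewrite /= subr_gt0.
  move=> y /= ty; rewrite addrC; apply: cvg_lim => //; apply: aF.
  have := ler_normB t (t - y); rewrite opprB addrCA subrr addr0 /K in ty *; lra.
by apply: is_derive_shiftr; rewrite addrC.
Qed.

End analytic_functions.

(** * Primitives and orders of vanishing *)

Section analytic_estimates.
Variable R : realType.
Implicit Types (F G f g : R -> R) (x t r M : R) (a b : nat -> R).

(** The mean value theorem transfers the remainder estimate from the series of [F'] to the
    integrated series. *)
Lemma analytic_primitive F F' x : (forall t, is_derive t (1 : R) F (F' t)) -> analytic_at F' x -> analytic_at F x.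
Proof.
move=> Fd /analytic_expansion[a [r [M Fe]]]; have [r0 aM _] := Fe.
have M0 : 0 <= M by apply: le_trans (aM 0%N); rewrite expr0 mulr1.
pose c n := if n is m.+1 then a m / m.+1%:R else F x.
apply: (@analyticI _ c (r / 2)); first lra.
move=> t tr; apply: (@cvg_geometric_rate _ _ _ (2 * r * M)) => -[//|n] _.
pose T n (y : R) := \sum_(0 <= k < n) a k / k.+1%:R * y ^+ k.+1.
have Td (y : R) : is_derive y (1 : R) (T n) (\sum_(0 <= k < n) a k * y ^+ k).
  elim: n => [|n IH].
    by rewrite big_geq // (_ : T 0%N = (fun=> 0)); [exact: is_derive_cst|apply/funext => z; rewrite /T big_geq].
  have -> : T n.+1 = (fun y => T n y + a n / n.+1%:R * y ^+ n.+1).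
    by apply/funext => z; rewrite /T big_nat_recr.
  have d1 := @is_deriveX R R id n.+1 y 1 1 (is_derive_id _ _); rewrite exprfctE in d1.
  have := is_deriveD IH (is_deriveZ (a n / n.+1%:R) d1); rewrite /GRing.scale /= => h.
  by rewrite big_nat_recr //=; apply: is_derive_eq h _; rewrite mulr1 mulrA divfK.
pose W y := F (y + x) - T n y.
have Wd (y : R) : is_derive y (1 : R) W (F' (x + y) - \sum_(0 <= k < n) a k * y ^+ k).
  by apply: is_deriveB; apply: is_derive_shiftr; rewrite addrC.
have Wb y : `|y| <= `|t| -> `|F' (x + y) - \sum_(0 <= k < n) a k * y ^+ k| <= 2 * M * (1 / 2) ^+ n.
  move=> yt; have yr : `|y| <= r / 2 by lra.
  apply: le_trans (expansion_tail Fe n yr) _; rewrite ler_wpM2l ?mulr_ge0 //.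
  by rewrite lerXn2r ?nnegrE ?divr_ge0 ?(ltW r0) // ler_pdivrMr //; lra.
have W0 : W 0 = F x.
  rewrite /W /T add0r big1 ?subr0 // => k _; rewrite exprS mul0r mulr0 //.
have WE : F (x + t) - series (fun n => c n * t ^+ n) n.+1 = W t - W 0.
  by rewrite W0 /W /T /series /= big_nat_recl //= expr0 mulr1 addrC [t + x]addrC; ring.
rewrite WE; have : `|W t - W 0| <= 2 * M * (1 / 2) ^+ n * `|t|.
  have [t0|t0] := leP 0 t.
    have [z /andP[z0 z1] ->] := MVTle Wd t0; rewrite normrM subr0 ler_wpM2r //.
    by apply: Wb; rewrite !ger0_norm.
  have [z /andP[z0 z1] E] := MVTle Wd (ltW t0); rewrite distrC E normrM sub0r normrN ler_wpM2r //.
  by apply: Wb; rewrite (ltr0_norm t0) ler0_norm //; lra.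
move=> h; apply: le_trans h _; rewrite exprSr.
have h : 0 <= 2 * M * (1 / 2) ^+ n by rewrite mulr_ge0 ?exprn_ge0 ?mulr_ge0.
have := ler_wpM2l h (ltW tr); lra.
Qed.

(** Positivity off [x] excludes that all coefficients vanish; the first nonzero one, of order [k],
    dominates the remainder near [x]. *)
Lemma analytic_lower_bound f x (e0 : R) : analytic_at f x -> 0 < e0 ->
  (forall t, 0 < `|t| < e0 -> 0 < f (x + t)) -> 0 <= f x ->
  exists k (c e : R), [/\ 0 < c, 0 < e & forall t, `|t| < e -> c * `|t| ^+ k <= f (x + t)].
Proof.
move=> /analytic_expansion[a [r [M fe]]] e00 fpos fx; have [r0 aM af] := fe.
have M0 : 0 <= M by apply: le_trans (aM 0%N); rewrite expr0 mulr1.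
have exk : exists k, a k != 0.
  apply: contrapT => no; have a0 k : a k = 0.
    by apply/eqP; apply: contrapT => /negP ak; apply: no; exists k.
  pose t := Num.min (e0 / 2) (r / 2); have t0 : 0 < t by rewrite lt_min !divr_gt0.
  have te : t <= e0 / 2 by rewrite ge_min lexx.
  have tr : t <= r / 2 by rewrite ge_min lexx orbT.
  clearbody t; have tr' : `|t| <= r / 2 by rewrite gtr0_norm.
  have := expansion_tail fe 0 tr'; have := fpos t; rewrite gtr0_norm // => /(_ _)/wrap[|ft].
    by rewrite t0 /=; lra.
  have tr2 : `|t| < r by rewrite gtr0_norm //; lra.
  have := af t tr2; rewrite (_ : series _ = (fun=> 0)); last first.
    by apply/funext => n; rewrite /series /= big1 // => i _; rewrite a0 mul0r.
  by move=> /cvg_lim; rewrite lim_cst // => /(_ (@norm_hausdorff _ _)) E _; rewrite -E ltxx in ft.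
case: (ex_minnP exk) => k ak kmin.
have amin n : (n < k)%N -> a n = 0.
  by move=> nk; apply/eqP; apply: contraLR nk => /kmin; rewrite -leqNgt.
have ak0 : 0 < `|a k| by rewrite normr_gt0.
have rk : 0 < r ^+ k.+1 by rewrite exprn_gt0.
exists k, (`|a k| / 2), (Num.min e0 (Num.min (r / 2) (`|a k| * r ^+ k.+1 / (4 * M + 1)))).
split; [by rewrite divr_gt0| |].
  by rewrite !lt_min e00 !divr_gt0 ?mulr_gt0 //; lra.
move=> t; rewrite !lt_min => /andP[te /andP[tr tM]].
have f0 : 0 <= f (x + t).
  by have [/eqP ->|tn] := boolP (t == 0); [rewrite addr0|apply: ltW; apply: fpos; rewrite normr_gt0 tn].
have := expansion_tail fe k.+1 (ltW tr).
rewrite big_nat_recr //= big1_seq ?add0r; last first.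
  by move=> n; rewrite mem_index_iota => /andP[_ /andP[_ nk]]; rewrite amin // mul0r.
have h1 : 2 * M * (`|t| / r) ^+ k.+1 <= `|a k| / 2 * `|t| ^+ k.
  rewrite expr_div_n mulrA ler_pdivrMr // exprS.
  have : `|t| * (4 * M + 1) <= `|a k| * r ^+ k.+1.
    by move: tM; rewrite ltr_pdivlMr; [move=> /ltW|lra].
  have tk : 0 <= `|t| ^+ k by exact: exprn_ge0.
  move=> /(ler_wpM2r tk) h2; have := mulr_ge0 (normr_ge0 t) tk; lra.
have h2 : `|a k * t ^+ k| = `|a k| * `|t| ^+ k by rewrite normrM normrX.
have := ler_normB (f (x + t)) (f (x + t) - a k * t ^+ k).
rewrite opprB addrCA subrr addr0 h2 (ger0_norm f0) => h3 h4; lra.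
Qed.

Lemma analytic_bump x : analytic_at (@bump R) x.
Proof.
rewrite (_ : @bump R = (fun y => 2^-1 + - 2^-1 * cos (y * (pi *+ 2)))).
  apply: analyticD; first exact: analytic_cst.
  apply: analyticZ; apply: (@analytic_comp _ cos (fun y => y * (pi *+ 2))); first exact: analytic_cos.
  by apply: analyticM; [exact: analytic_id|exact: analytic_cst].
by apply/funext => y; rewrite /bump; ring.
Qed.

Lemma analytic_bumps ps x : analytic_at (@bumps R ps) x.
Proof.
elim: ps => [|p ps IH].
  by rewrite (_ : bumps [::] = (fun=> 1)); [exact: analytic_cst|apply/funext => y; rewrite /bumps big_nil].
rewrite (_ : bumps (p :: ps) = (fun y => bump (y - p) * bumps ps y)).
  by apply: analyticM => //; apply: (@analytic_shift _ (@bump R)); exact: analytic_bump.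
by apply/funext => y; rewrite /bumps big_cons.
Qed.

Lemma analytic_smoothing w N n x : (0 < N)%N -> analytic_at (smoothing w (@bump R) N n) x.
Proof.
move=> N0; have term j : analytic_at (fun y : R => (2 - bump (y - j%:R / N%:R)) ^+ n) x.
  apply: analyticX; rewrite (_ : (fun y => _) = (fun y => 2 + -1 * bump (y - j%:R / N%:R))).
    apply: analyticD; first exact: analytic_cst.
    by apply: analyticZ; apply: (@analytic_shift _ (@bump R)); exact: analytic_bump.
  by apply/funext => y; rewrite mulN1r.
apply: analyticM; last apply: analyticV.
- apply: (@analytic_sum _ N (fun j y => w (j%:R / N%:R) * (2 - bump (y - j%:R / N%:R)) ^+ n)) => j.
  exact: analyticZ.
- by rewrite gt_eqF //; apply: weight_gt0 => //; exact: bump01.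
- exact: (@analytic_sum _ N (fun j y => (2 - bump (y - j%:R / N%:R)) ^+ n)).
Qed.

End analytic_estimates.

(** * The conjugacies *)

Section corrections.
Local Open Scope quotient_scope.
Variable R : realType.
Local Notation S1 := (circle R).
Variables (d : nat) (h : S1 -> S1) (H DH v : R -> R) (V : R).
Hypothesis hF : FdBV d h.
Hypothesis L : BV_lift d H DH v V.
Hypothesis Hh : forall x, toS (H x) = h (toS x).
Hypothesis DHE : Dper h = DH.
Local Notation Dn := (iter_deriv H DH).

Lemma smooth_lipschitz (f : R -> R) : smooth f ->
  exists2 B : R, 0 < B & forall x y, `|f x - f y| <= B * `|x - y|.
Proof.
move=> /(_ 1%N)[fS [f' [fd [f'S f'c]]]]; have [B B0 f'B] := periodic_bounded f'c f'S.
exists B => // x y; wlog xy : x y / x <= y.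
  by move=> W; have [/W//|/ltW/W] := leP x y; rewrite distrC (distrC y).
have [c _] := MVTle fd xy; rewrite distrC (distrC x) => ->.
by rewrite normrM ler_wpM2r.
Qed.

Lemma DH_bv : bv_periodic DH.
Proof. by have [_ _ _ _ [_ hbv]] := hF; apply: bv_periodicP; [exact: (DHS L)|rewrite -DHE]. Qed.

Lemma Dn_bv n : bv_periodic (Dn n).
Proof.
elim: n => [|n IH].
  by rewrite (_ : Dn 0 = (fun=> 1)); [exact: bv_periodic_cst|apply/funext => x; exact: Dn0].
rewrite (_ : Dn n.+1 = (fun x => Dn n x * DH (iter n H x))); last by apply/funext => x; exact: DnS.
apply: bv_periodicM => //; apply: (@bv_periodic_comp _ DH (iter n H) (d%:Z ^+ n) DH_bv).
  by move=> x y; rewrite (iter_leE L).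
by move=> x; rewrite (iter_add1 L) rmorphXn.
Qed.

Section one_correction.
Variables (s : nat) (corr : R -> R).
Hypothesis corrs : smooth corr.
Let rhat x := avg_density H DH s x + corr x.
Hypothesis rhat_gt0 : forall x, 0 < rhat x.
Hypothesis rhatH : forall x, ~ parabolic H DH x -> rhat x < rhat (H x) * DH x.

Lemma conj_of_correction (K : set (S1 -> S1)) :
  (forall (c : R) (Phi : R -> R) phi, (forall x : R, is_derive x (1 : R) Phi (c * rhat x)) ->
     (forall x : R, toS (Phi x) = phi (toS x)) -> C1_on setT phi ->
     Dper phi = (fun x => c * rhat x) -> K phi) ->
  conj_to_expanding K d h.
Proof.
apply: (conj_of_density hF L Hh DHE _ _ rhat_gt0 rhatH).
  move=> x; apply: continuousD; first exact: (avg_density_cont L).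
  by have [_] := corrs 0%N; apply.
apply: bv_periodicD; first exact: (bv_periodic_sum s Dn_bv).
have [B _ BP] := smooth_lipschitz corrs.
by apply: bv_periodic_lip BP; have [] := corrs 0%N.
Qed.

Variable A : set (R -> R).
Hypothesis RA : regularity A.

(** No derivative is lost: composing with [H] one step at a time only uses that its derivative [DH]
    is itself in the class. *)
Lemma Cn_Dn n i : Cn A n DH -> Cn A n (Dn i).
Proof.
move=> DHn; have comp j : Cn A n (fun x => DH (iter j H x)).
  elim: j => // j IH; under eq_fun do rewrite iterSr.
  apply: (Cn_comp RA (k := d%:Z) _ (lift_derive L) DHn IH); exact: (liftS L).
elim: i => [|i IH].
  rewrite (_ : Dn 0 = (fun=> 1)); last by apply/funext => x; exact: Dn0.
  by apply: smooth_Cn => //; exact: smooth_cst.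
rewrite (_ : Dn i.+1 = (fun x => Dn i x * DH (iter i H x))); last by apply/funext => x; exact: DnS.
exact: CnM.
Qed.

Lemma Cn_rhat n (c : R) : Cn A n DH -> Cn A n (fun x => c * rhat x).
Proof.
move=> DHn; apply: CnM => //; first by apply: smooth_Cn => //; exact: smooth_cst.
apply: CnD => //; last exact: smooth_Cn.
apply: (@Cn_sum R A RA n s (fun i => Dn i)) => [i|]; first exact: Cn_Dn.
by apply: smooth_Cn => //; exact: smooth_cst.
Qed.

End one_correction.

Lemma Cr_of_correction s corr (r : nat) (eps : R) : (2 <= r)%N -> 0 < eps <= 1 -> smooth corr ->
  Cr_hoelder r eps h -> forall c phi, C1_on setT phi ->
  Dper phi = (fun x => c * (avg_density H DH s x + corr x)) -> Cr_hoelder r eps phi.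
Proof.
move=> r2 e01 corrs [_ hd hh] c phi phi1 phiE; have RA := per_hoelder_regularity e01.
have DHn : Cn (per_hoelder eps) r.-1 DH.
  rewrite DHE in hd hh; apply: (derivable_Cn (DHS L)) => // hS; by split.
have := Cn_rhat s corrs RA c DHn; rewrite -phiE => /(Cn_derivable)[h1 [_ h2]].
by split.
Qed.

Lemma Cinfty_of_correction s corr : smooth corr -> Cinfty h -> forall c phi, C1_on setT phi ->
  Dper phi = (fun x => c * (avg_density H DH s x + corr x)) -> Cinfty phi.
Proof.
move=> corrs [_ hd] c phi phi1 phiE; split; first exact: phi1.
move=> k x.
have DHn : Cn (@per_cont R) k.+1 DH.
  rewrite DHE in hd; apply: (derivable_Cn (DHS L)) => // hS; split=> // y.
  by apply: differentiable_continuous; apply/derivable1_diffP.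
have := Cn_rhat s corrs (per_cont_regularity R) c DHn; rewrite -phiE => /(Cn_derivable)[h1 _].
exact: h1.
Qed.

End corrections.

(** * Smooth and analytic corrections *)

Section periodic_points.
Variable R : realType.
Variables (d : nat) (H DH v : R -> R) (V : R).
Hypothesis L : BV_lift d H DH v V.
Hypothesis Rep : repelling H DH.
Local Notation Dn := (iter_deriv H DH).
Variables (s : nat) (ps : seq R).
Hypothesis s0 : (0 < s)%N.
Hypothesis sP : forall x, parabolic H DH x -> (exists k : int, iter s H x = x + k%:~R) /\ Dn s x = 1.
Hypothesis psP : forall p, p \in ps -> parabolic H DH p.
Hypothesis psE : forall x, parabolic H DH x -> exists2 p, p \in ps & exists k : int, x = p + k%:~R.
Local Notation q := (@bumps R ps).

Lemma bumps_parabolic x : q x = 0 <-> parabolic H DH x.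
Proof.
rewrite bumps_eq0; split=> [[p /psP pp [k ->]]|/psE //]; exact: (parabolic_int L).
Qed.

Lemma bumps_ge0 x : 0 <= q x. Proof. by have /andP[] := bumps01 ps x. Qed.

Lemma Dn_ge1_near : exists2 e0 : R, 0 < e0 & forall x, q x < e0 -> 1 <= Dn s x.
Proof.
have [e0 e00 e0P] := q_near_repelling L Rep s0 sP (@bumps_cont R ps) (bumpsS ps) bumps_ge0 bumps_parabolic.
exists e0 => // x qx; have := bumps_ge0 x; rewrite le_eqVlt => /predU1P[E|q0]; last first.
  by apply: ltW; apply: e0P.
by have [_ ->] := sP (proj1 (bumps_parabolic x) (esym E)).
Qed.

Lemma smooth_correction : exists2 corr, smooth corr &
  let rhat x := avg_density H DH s x + corr x in
  (forall x, 0 < rhat x) /\ forall x, ~ parabolic H DH x -> rhat x < rhat (H x) * DH x.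
Proof.
have qc := @bumps_cont R ps; have qS := bumpsS ps.
have [eta eta0 etaP] := corrected_density L Rep s0 sP qc qS bumps_ge0 bumps_parabolic.
(* The shift by [eta / 2] makes [g] vanish on a whole neighbourhood of the parabolic points, where
   the required estimate reduces to [0 <= Dn s x - 1]. *)
pose g x := flat 0 (q x - eta / 2).
have gs : smooth g.
  by apply: smooth_flat; apply: smoothD; [exact: smooth_bumps|exact: smooth_cst].
have [gS gc] := gs 0%N; have [|||w [N [n [N0 [h1 h2]]]]] := etaP g gc gS.
- by move=> x; rewrite flat_ge0 flat0_le1.
- by move=> x qx; apply: flat0_gt0; lra.
- have e2 : 0 < eta / 2 by lra.
  have [a a0 aP] := q_near_invariant L qc qS bumps_ge0 bumps_parabolic 2 e2.
  have [b b0 bP] := Dn_ge1_near.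
  exists 1, (Num.min a b); split=> [||x]; [exact: ltr01|by rewrite lt_min a0|].
  rewrite lt_min mul1r => /andP[qa /bP Db].
  have := aP x qa 0%N isT; have := aP x qa 1%N isT => /= q1 q0.
  by rewrite /g !flat_le0 ?mul0r ?addr0; lra.
exists (fun x => g x * smoothing w (@bump R) N n x) => //.
by apply: smoothM => //; exact: smooth_smoothing.
Qed.

Hypothesis Ha : forall x, analytic_at H x.

Lemma iter_analytic n x : analytic_at (iter n H) x.
Proof.
elim: n x => [|n IH] x; first exact: analytic_id.
by apply: (@analytic_comp _ H (iter n H)).
Qed.

Lemma Dn_analytic n x : analytic_at (Dn n) x.
Proof. exact: analytic_derive (iter_derive L n) (iter_analytic n x). Qed.

(** By analyticity [Dn s - 1] vanishes to finite order at each point of [ps]. The bound [e <= 1]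
    allows all the exponents to be raised to the largest one. *)
Lemma Dn_lower_bound : exists m (c e : R), [/\ 0 < c, 0 < e & e <= 1 /\
  forall p t, p \in ps -> `|t| < e -> c * `|t| ^+ m <= Dn s (p + t) - 1].
Proof.
have one p : p \in ps -> exists k (c e : R), [/\ 0 < c, 0 < e &
    forall t, `|t| < e -> c * `|t| ^+ k <= Dn s (p + t) - 1].
  move=> /psP pp; have [[k kE] D1] := sP pp; have [dl' dl'0 dl'P] := Rep s0 kE.
  have [dl [dl0 dlP]] : exists dl : R, 0 < dl /\ forall y, y != p -> `|y - p| < dl -> 1 < Dn s y by exists dl'.
  apply: (@analytic_lower_bound _ (fun x => Dn s x - 1) p dl) => //.
  - by apply: analyticD; [exact: Dn_analytic|exact: analytic_cst].
  - move=> t /andP[t0 te]; have E : p + t - p = t by ring.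
    by rewrite subr_gt0; apply: dlP; rewrite ?E // -subr_eq0 E -normr_gt0.
  - by rewrite D1 subrr.
move: (ps) one; elim=> [|p l IH] one.
  by exists 0%N, 1, 1; split; [exact: ltr01|exact: ltr01|split].
have [|m [c [e [c0 e0 [e1 mP]]]]] := IH.
  by move=> p' p'l; apply: one; rewrite inE p'l orbT.
have [k [c' [e' [c'0 e'0 kP]]]] := one p (mem_head _ _).
exists (maxn m k), (Num.min c c'), (Num.min e e'); split; [by rewrite lt_min c0|by rewrite lt_min e0|].
split=> [|p' t]; first by rewrite ge_min e1.
have le b j j' (b0 : 0 < b) : `|t| < e -> (j <= maxn m k)%N -> Num.min c c' <= b ->
    Num.min c c' * `|t| ^+ maxn m k <= b * `|t| ^+ j.
  move=> te jm cb; apply: ler_pM; rewrite ?exprn_ge0 ?le_min ?(ltW c0) ?(ltW c'0) //.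
  by apply: ler_wiXn2l => //; apply: le_trans e1; exact: ltW.
rewrite inE lt_min => /predU1P[->|p'l] /andP[te te'].
  by apply: le_trans (kP t te'); apply: le => //; rewrite ?leq_maxr // ge_min lexx orbT.
by apply: le_trans (mP p' t p'l te); apply: le => //; rewrite ?leq_maxl // ge_min lexx.
Qed.

Lemma analytic_correction : exists2 corr, smooth corr /\ (forall x, analytic_at corr x) &
  let rhat x := avg_density H DH s x + corr x in
  (forall x, 0 < rhat x) /\ forall x, ~ parabolic H DH x -> rhat x < rhat (H x) * DH x.
Proof.
have qc := @bumps_cont R ps; have qS := bumpsS ps.
have [eta eta0 etaP] := corrected_density L Rep s0 sP qc qS bumps_ge0 bumps_parabolic.
have [m [c [e [c0 e0 [e1 mP]]]]] := Dn_lower_bound.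
have [B B0 qB] := smooth_lipschitz (smooth_bumps ps).
have [M M0 MP] := periodic_bounded (lift_cont L) (DHS L).
(* As [q] is Lipschitz and vanishes at the parabolic points, [q ^+ m] is at most of the size [|t|^m]
   that bounds [Dn s - 1] from below. *)
pose g x := q x ^+ m.
have gs : smooth g by apply: smoothX; exact: smooth_bumps.
have [gS gc] := gs 0%N; have [|||w [N [n [N0 [h1 h2]]]]] := etaP g gc gS.
- by move=> x; have /andP[q0 q1] := bumps01 ps x; rewrite /g exprn_ge0 ?exprn_ile1.
- by move=> x qx; apply: exprn_gt0; lra.
(* At distance [|t|] from a parabolic point, [q x] is at most [B * |t|], [q (H x)] at most
   [B * M * |t|], and [DH x] at most [M]. *)
- pose C := B ^+ m + (B * M) ^+ m * M.
  have C0 : 0 < C by rewrite /C addr_gt0 ?mulr_gt0 ?exprn_gt0 ?mulr_gt0.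
  pose Q x := g x + g (H x) * DH x <= C / c * (Dn s x - 1).
  have [||a' a'0 a'P] := near_zero (Q := Q) qc qS bumps_ge0.
  + move=> x k; rewrite /Q (Dn_int L) (DH_int L); have [k' /= ->] := iter_intE L 1 x k.
    by rewrite !(periodic_int _ _ gS).
  + move=> y qy; have yp := proj1 (bumps_parabolic y) qy; exists e => // x.
    have [p pp [k yE]] := psE yp; set t := x - y => te.
    have xE : x = p + t + k%:~R by rewrite /t yE; ring.
    have Dx : c * `|t| ^+ m <= Dn s x - 1 by rewrite xE (Dn_int L); exact: mP.
    have q1 : q x <= B * `|t|.
      by have := qB x y; rewrite qy subr0 ger0_norm //; exact: bumps_ge0.
    have q2 : q (H x) <= B * M * `|t|.
      have qHy : q (H y) = 0 by apply/bumps_parabolic; exact: (parabolic_H L).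
      have := qB (H x) (H y); rewrite qHy subr0 ger0_norm ?bumps_ge0 // => h.
      apply: le_trans h _; rewrite -mulrA ler_wpM2l ?(ltW B0) // /t.
      wlog xy : x y {yp qy qHy yE t te xE Dx q1} / x <= y.
        by move=> W; have [/W//|/ltW/W] := leP x y; rewrite distrC (distrC y).
      have [z _] := MVTle (lift_derive L) xy; rewrite distrC (distrC x) => ->.
      by rewrite normrM ler_wpM2r.
    have g1 : g x <= B ^+ m * `|t| ^+ m.
      by rewrite -exprMn lerXn2r ?nnegrE ?bumps_ge0 ?mulr_ge0 ?(ltW B0).
    have g2 : g (H x) * DH x <= (B * M) ^+ m * `|t| ^+ m * M.
      apply: ler_pM; [by rewrite exprn_ge0 ?bumps_ge0|exact: ltW (lift_gt0 L x)| |].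
        rewrite -exprMn lerXn2r ?nnegrE ?bumps_ge0 ?mulr_ge0 ?(ltW B0) ?(ltW M0) //.
      exact: le_trans (ler_norm _) (MP x).
    rewrite /Q mulrAC; apply: (@le_trans _ _ (C * `|t| ^+ m)).
      by move: g1 g2; rewrite /C mulrDl; lra.
    by rewrite ler_pdivlMr // -mulrA ler_pM2l // mulrC.
  exists (C / c), a'; split; [by rewrite divr_gt0|exact: a'0|exact: a'P].
exists (fun x => g x * smoothing w (@bump R) N n x) => //; split.
  by apply: smoothM => //; exact: smooth_smoothing.
move=> x; apply: analyticM; last exact: analytic_smoothing.
by apply: analyticX; exact: analytic_bumps.
Qed.

End periodic_points.

Lemma analytic_continuous (R : realType) (F : R -> R) (x : R) : analytic_at F x -> {for x, continuous F}.
Proof.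
move=> /analytic_expansion[a [r [M Fe]]]; have [r0 aM _] := Fe.
have M0 : 0 <= M by apply: le_trans (aM 0%N); rewrite expr0 mulr1.
have tail t : `|t| <= r / 2 -> `|F (x + t) - a 0%N| <= 2 * M * (`|t| / r).
  by move=> /(expansion_tail Fe 1); rewrite big_nat1 !expr1 mulr1.
have Fx : F x = a 0%N.
  have := tail 0; rewrite normr0 mul0r mulr0 addr0 normr_le0 subr_eq0 => /(_ _)/wrap[|/eqP //].
  by rewrite divr_ge0 // ltW.
apply/cvgrPdist_lt => e e0; have M1 : 0 < 2 * M + 1 by lra.
exists (Num.min (r / 2) (e * r / (2 * M + 1))) => [|t /=].
  by rewrite /= lt_min !divr_gt0 ?mulr_gt0.
rewrite lt_min distrC => /andP[tr te]; have := tail (t - x) (ltW tr).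
rewrite (_ : x + (t - x) = t); last ring.
rewrite -Fx distrC mulrA => h; apply: le_lt_trans h _; rewrite ltr_pdivrMr //.
move: te; rewrite ltr_pdivlMr // => te; have := normr_ge0 (t - x); lra.
Qed.

Lemma analytic_lift (R : realType) (h : circle R -> circle R) (H : R -> R) : Comega h -> continuous H ->
  (forall x, toS (H x) = h (toS x)) -> forall x, analytic_at H x.
Proof.
move=> ha Hc Hh x; have [F [Ff Fa]] := ha x.
have Hl : local_lift h x H by exists 1 => [|t _] /=; [exact: ltr01|exact: Hh].
have HF := local_lift_diff Hl Ff (Hc x) (analytic_continuous Fa).
by apply: analytic_near HF _; apply: analyticD => //; exact: analytic_cst.
Qed.

Theorem theorem2p1 (R : realType) (d : nat) (h : circle R -> circle R)
    (d_ge2 : (2 <= d)%N) (hT : Tstar d h) :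
  [/\ finite_set (Par h),
      conj_to_expanding setT d h,
      forall (r : nat) (eps : R), (2 <= r)%N -> 0 < eps <= 1 ->
        Cr_hoelder r eps h -> conj_to_expanding (Cr_hoelder r eps) d h,
      Cinfty h -> conj_to_expanding (@Cinfty R) d h &
      Comega h -> conj_to_expanding (@Comega R) d h].
Proof.
have [hF hP] := hT; have [H [v [V [L Hh]]]] := FdBV_lift d_ge2 hF.
have Rep := Tstar_repelling L Hh hP.
have [s s0 sP] := parabolic_common_period L Rep.
have [ps [psP psE]] := parabolic_finite L Rep.
(* One smooth correction serves all the classes except the analytic one. *)
have [corr corrs [pos expd]] := smooth_correction L Rep s0 sP psP psE.
have conj K := @conj_of_correction R d h H (Dper h) v V hF L Hh erefl s corr corrs pos expd K.
split.
- apply: (@sub_finite_set _ _ (@toS R @` [set` ps])); last exact: finite_image.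
  move=> p /(Par_parabolic L Hh)[x <- /psE[y yps [k ->]]]; exists y => //.
  by rewrite toS_int.
- exact: conj.
- move=> r eps r2 e01 hr; apply: conj => c Phi phi _ _.
  exact: (Cr_of_correction L erefl r2 e01 corrs hr).
- move=> hi; apply: conj => c Phi phi _ _.
  exact: (Cinfty_of_correction L erefl corrs hi).
- move=> ha; have Ha := analytic_lift ha (iter_cont L 1) Hh.
  have [corr' [corr's corr'a] [pos' expd']] := analytic_correction L Rep s0 sP psP psE Ha.
  apply: (@conj_of_correction R d h H (Dper h) v V hF L Hh erefl s corr' corr's pos' expd').
  move=> c Phi phi Phid phiE _ _ x; exists Phi; split.
    by exists 1 => [|t _] /=; [exact: ltr01|exact: phiE].
  apply: analytic_primitive Phid _; apply: analyticZ; apply: analyticD => //.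
  by apply: (@analytic_sum R s (fun i => iter_deriv H (Dper h) i)) => i; exact: Dn_analytic L Ha i x.
Qed.
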